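(* Let $(t_k)_{k=1}^\infty$ be a sequence of real numbers with $1>t_1>t_2>t_3>\dots>0$ and $\lim_{k\to\infty}t_k=0$. Let $n\ge1$, $0<s\le1/2$, $a\ge2s$, and assume that $\sum_{k=1}^\infty t_k^\gamma<\infty$, where $1/\gamma>(a-2s)/(2s)$. If $f\in H_s(\mathbb{R}^n)$, then $$\lim_{k\to\infty}S_{t_k}f(x)=f(x)$$ for almost every $x\in\mathbb{R}^n$.
   Context: The Fourier transform is $\hat f(\xi)=\int_{\mathbb{R}^n}e^{-i\xi\cdot x}f(x)\,dx$. For $f\in L^2(\mathbb{R}^n)$ and $a>0$, $S_tf(x)=(2\pi)^{-n}\int_{\mathbb{R}^n}e^{i\xi\cdot x}e^{it|\xi|^a}\hat f(\xi)\,d\xi$, i.e. $S_tf$ is the $L^2$ function with Fourier transform $e^{it|\xi|^a}\hat f(\xi)$. The Sobolev space is $H_s=\{f\in\mathscr{S}' : \|f\|_{H_s}<\infty\}$ with $\|f\|_{H_s}=\left(\int_{\mathbb{R}^n}(1+|\xi|^2)^s|\hat f(\xi)|^2\,d\xi\right)^{1/2}$. *)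

(* Defs.v *)
(* The real numbers are an arbitrary R : realType, the complex numbers are
   R[i] (with its numFieldType topology, written R[i]^o), and R^n is the type of
   n-tuples over R with its product Borel sigma-algebra.  measurableTypeR R,
   which is convertible to R, is the domain of the one-dimensional
   lebesgue_measure.  Elements of L^2 and H_s are represented by Borel
   functions; each class of Lebesgue measurable functions modulo null sets
   contains one. *)
From HB Require Import structures.
From mathcomp Require Import all_boot all_order all_algebra.
From mathcomp Require Import complex.
From mathcomp Require Import all_classical all_reals all_analysis.

Set Implicit Arguments.
Unset Strict Implicit.
Unset Printing Implicit Defensive.

Import Order.TTheory GRing.Theory Num.Theory Normc.
Import numFieldNormedType.Exports.

Local Open Scope classical_set_scope.
Local Open Scope complex_scope.
Local Open Scope ring_scope.

Notation euclidean R n := (n.-tuple (measurableTypeR R)).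

Section lebesgue_euclidean.
Context (R : realType).
Local Open Scope ereal_scope.

Definition tcons n (p : measurableTypeR R * euclidean R n) :
    euclidean R n.+1 :=
  cons_tuple p.1 p.2.

Lemma measurable_tcons n :
  measurable_fun [set: measurableTypeR R * euclidean R n] (@tcons n).
Proof. exact: (measurable_cons measurable_fst measurable_snd). Qed.

Section step.
Context n (m : {sigma_finite_measure set (euclidean R n) -> \bar R}).

Definition lebesgue_cons : set (euclidean R n.+1) -> \bar R :=
  pushforward (@lebesgue_measure R \x m) (@tcons n).

Let lebesgue_cons0 : lebesgue_cons set0 = 0.
Proof. by rewrite /lebesgue_cons /pushforward preimage_set0 measure0. Qed.

Let lebesgue_cons_ge0 A : 0 <= lebesgue_cons A.
Proof. exact: (measure_ge0 (@lebesgue_measure R \x m)). Qed.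

Let lebesgue_cons_sigma_additive : semi_sigma_additive lebesgue_cons.
Proof.
exact: (measure_semi_sigma_additive (s :=
  measure_function_pushforward__canonical__measure_function_Measure
    (@lebesgue_measure R \x m) (@measurable_tcons n))).
Qed.

HB.instance Definition _ := isMeasure.Build _ _ _ lebesgue_cons
  lebesgue_cons0 lebesgue_cons_ge0 lebesgue_cons_sigma_additive.

Let lebesgue_cons_sigma_finite : sigma_finite setT lebesgue_cons.
Proof.
have /sigma_finiteP[F [TF ndF Foo]] := sigma_finiteT (@lebesgue_measure R).
have /sigma_finiteP[G [TG ndG Goo]] := sigma_finiteT m.
pose u (x : euclidean R n.+1) : measurableTypeR R * euclidean R n :=
  (thead x, [tuple of behead x]).
have uK p : u (tcons p) = p by case: p => x y; congr pair; exact: val_inj.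
have mu : measurable_fun setT u.
  by apply/measurable_fun_pair; [exact: measurable_tnth|exact: measurable_behead].
exists (fun k => u @^-1` (F k `*` G k)) => [|k].
  rewrite -preimage_bigcup (_ : \bigcup_k _ = setT) ?preimage_setT//.
  rewrite -setXTT TF TG; apply/seteqP; split=> [[x y] [k _ [? ?]]|[x y]].
    by split; exists k.
  move=> [/= [i _ Fix] [j _ Gjy]]; exists (maxn i j) => //; split.
  - by move: x Fix; exact/subsetPset/ndF/leq_maxl.
  - by move: y Gjy; exact/subsetPset/ndG/leq_maxr.
have [[mFk Fk] [mGk Gk]] := (Foo k, Goo k); split.
  by rewrite -[X in measurable X]setTI; apply: mu => //; exact: measurableX.
rewrite /lebesgue_cons /pushforward (_ : _ @^-1` _ = F k `*` G k).
  by rewrite product_measure1E// lte_mul_pinfty// ge0_fin_numE.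
by rewrite -comp_preimage (_ : u \o _ = id) ?preimage_id//; exact/funext.
Qed.

HB.instance Definition _ := Measure_isSigmaFinite.Build _ _ _ lebesgue_cons
  lebesgue_cons_sigma_finite.

End step.

(* lebesgue_euclid 0 is the unit mass on the one-point space and
   lebesgue_euclid n.+1 is the product of lebesgue_measure with
   lebesgue_euclid n, carried to R^(n+1) by tcons. *)
Fixpoint lebesgue_euclid n :
    {sigma_finite_measure set (euclidean R n) -> \bar R} :=
  if n is n'.+1 then
    [the {sigma_finite_measure set _ -> \bar R}
      of lebesgue_cons (lebesgue_euclid n')]
  else [the {sigma_finite_measure set _ -> \bar R} of \d_ [tuple]].

End lebesgue_euclidean.
Arguments lebesgue_euclid : clear implicits.

Section fourier.
Context (R : realType) (n : nat).
Local Notation E := (euclidean R n).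
Local Notation C := R[i].
Local Notation mu := (lebesgue_euclid R n).
Implicit Types (x y xi : E) (f g h phi psi : E -> C) (u : (E -> C) -> C).

Definition dot x y : R := \sum_(i < n) (tnth x i : R) * tnth y i.

Definition enorm x : R := Num.sqrt (dot x x).

Definition cis (theta : R) : C := cos theta +i* sin theta.

Definition cmeasurable f :=
  measurable_fun setT (fun x => complex.Re (f x)) /\
  measurable_fun setT (fun x => complex.Im (f x)).

Definition cintegrable f :=
  mu.-integrable setT (fun x => (complex.Re (f x))%:E) /\
  mu.-integrable setT (fun x => (complex.Im (f x))%:E).

Definition cintegral f : C :=
  (\int[mu]_x complex.Re (f x)) +i* (\int[mu]_x complex.Im (f x)).

Definition L2 f :=
  cmeasurable f /\ (\int[mu]_x ((normc (f x) ^+ 2)%:E) < +oo)%E.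

Definition fourier f xi : C := cintegral (fun x => cis (- dot xi x) * f x).

Definition upd x (i : 'I_n) (r : R) : E :=
  [tuple if j == i then r else tnth x j | j < n].

Definition pderivable (i : 'I_n) f x :=
  derivable (fun r : R => complex.Re (f (upd x i r))) (tnth x i) 1 /\
  derivable (fun r : R => complex.Im (f (upd x i r))) (tnth x i) 1.

Definition pderiv (i : 'I_n) f x : C :=
  derive1 (fun r : R => complex.Re (f (upd x i r))) (tnth x i) +i*
  derive1 (fun r : R => complex.Im (f (upd x i r))) (tnth x i).

Definition pderivs (s : seq 'I_n) f : E -> C := foldr pderiv f s.

(* Existence of all iterated partial derivatives together with their
   boundedness makes each of them Lipschitz, so phi is of class C^oo. *)
Definition schwartz phi :=
  (forall s i x, pderivable i (pderivs s phi) x) /\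
  (forall s (N : nat), exists M : R, forall x,
     (1 + enorm x) ^+ N * normc (pderivs s phi x) <= M).

Definition schwartz_cvg0 (phi_ : nat -> E -> C) :=
  forall s (N : nat) (e : R), 0 < e -> \forall k \near \oo, forall x,
    (1 + enorm x) ^+ N * normc (pderivs s (phi_ k) x) <= e.

(* A tempered distribution is a total functional of which only the values on
   Schwartz functions matter.  The Schwartz space being metrizable, continuity
   is sequential continuity, at 0 by linearity. *)
Definition tempered u :=
  (forall (c : C) phi psi, schwartz phi -> schwartz psi ->
     u (fun x => c * phi x + psi x) = c * u phi + u psi) /\
  (forall phi_ : nat -> E -> C, (forall k, schwartz (phi_ k)) ->
     schwartz_cvg0 phi_ -> (u (phi_ k) : C^o) @[k --> \oo] --> (0 : C^o)).

Definition dfourier u phi : C := u (fourier phi).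

Definition represents f u :=
  cmeasurable f /\ forall phi, schwartz phi ->
    cintegrable (fun x => f x * phi x) /\
    u phi = cintegral (fun x => f x * phi x).

Definition distr f phi : C := cintegral (fun x => f x * phi x).

(* The function \hat u, chosen up to a null set, when the tempered distribution
   \hat u is a function. *)
Definition fourier_fun u : E -> C :=
  xget (cst 0) [set g | represents g (dfourier u)].

Definition sobolev_norm (s : R) u : \bar R :=
  ((\int[mu]_xi ((1 + enorm xi ^+ 2) `^ s * normc (fourier_fun u xi) ^+ 2)%:E)
    `^ 2^-1)%E.

Definition sobolev (s : R) u :=
  [/\ tempered u, exists g, represents g (dfourier u)
    & (sobolev_norm s u < +oo)%E].

(* A function f is identified with the distribution distr f, which requires
   f phi to be integrable for every Schwartz function phi. *)
Definition sobolev_fun (s : R) f :=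
  represents f (distr f) /\ sobolev s (distr f).

(* S_t f, chosen up to a null set. *)
Definition schrodinger (a t : R) f : E -> C :=
  xget (cst 0) [set h | L2 h /\
    represents (fun xi => cis (t * enorm xi `^ a) * fourier_fun (distr f) xi)
      (dfourier (distr h))].

End fourier.

(* Main.v *)
(* Write S_t f for the flow and G_t(xi) = e^(it|xi|^a) \hat f(xi). With
   p = 2s/a <= 1, the bound |e^(iu) - e^(iv)|^2 <= 4 |u - v|^p and Bessel's
   inequality give ||S_u f - S_v f||_2^2 <= C |u - v|^p, with C controlled by the
   H_s norm of f. The rest is chaining, and uses nothing else about S_t. Put
   b = 1 + gamma, so that 1 - 1/b < p. Round t_k down to a multiple of 2^-l with
   2^(-l-1) < t_k^b <= 2^-l: the squared L^2 norms of the errors are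
   O(t_k^(bp)) = O(t_k^gamma), hence summable, and the errors tend to 0 a.e. The
   rounded point is joined to 0 through the dyadic tree. At level j <= l the path
   only meets nodes of size at most 2^(-j/b), of which there are
   O(2^(j(1 - 1/b))), and each increment has squared L^2 norm O(2^(-jp)); the
   maxima of the increments over the levels are therefore summable a.e.

   S_t f is the L^2 limit of the inverse Fourier integrals of G_t times Gaussians
   of increasing width. Its Fourier transform is computed by Gaussian summation,
   and an L^1 function with zero Fourier transform vanishes a.e.
   because it is orthogonal to all products of tent functions. *)
Require Import Defs.
From HB Require Import structures.
From mathcomp Require Import all_boot all_order all_algebra.
From mathcomp Require Import ring lra.
From mathcomp Require Import complex.
From mathcomp Require Import all_classical all_reals all_analysis measurable_realfun.

Set Implicit Arguments.
Unset Strict Implicit.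
Unset Printing Implicit Defensive.

Import Order.TTheory GRing.Theory Num.Theory Normc.
Import numFieldNormedType.Exports.

Local Open Scope classical_set_scope.
Local Open Scope complex_scope.
Local Open Scope ring_scope.

(** The function S_u f is chosen for each u separately, up to a null set, so for a fixed x nothing
    is known about its dependence on u. Chaining copes with this because it touches only countably
    many times, the t_k and the dyadic i/2^l, and draws all its information from the Holder bound
    [flow_holder]. The size of the constant in that bound is immaterial, so crude factors from
    complex integration are kept.

    A second obstacle sits at time 0. Membership in H_s says that f is integrable against Schwartz
    functions and that its distributional transform is a weighted L^2 function; that f itself lies
    in L^2 is a consequence and not a datum. Hence f and S_u f are compared through pairings with
    transforms of translated Gaussians, which are explicit: as functions of the centre these
    pairings are Fourier integrals of h(x) exp(-|x|^2/2), an integrable function, and uniqueness for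
    integrable functions applies.

    Gaussians are also products over the coordinates, which reduces their integrals over R^n to one
    variable; there the transform comes from a linear differential equation. *)

Local Notation Re := complex.Re.
Local Notation Im := complex.Im.

(** * Complex-valued integrals *)

Section complex_numbers.
Context (R : rcfType).
Implicit Types z w : R[i].

Lemma sqr_normc_ReIm z : normc z ^+ 2 = Re z ^+ 2 + Im z ^+ 2.
Proof. by case: z => a b /=; rewrite sqr_sqrtr// addr_ge0 ?sqr_ge0. Qed.

Lemma normc_ge0 z : 0 <= normc z.
Proof. by case: z => a b /=; exact: sqrtr_ge0. Qed.

Lemma norm_Re_le_normc z : `|Re z| <= normc z.
Proof.
rewrite -(@ler_pXn2r _ 2)// ?nnegrE ?normc_ge0// sqr_normc_ReIm real_normK ?num_real//.
by rewrite lerDl sqr_ge0.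
Qed.

Lemma norm_Im_le_normc z : `|Im z| <= normc z.
Proof.
rewrite -(@ler_pXn2r _ 2)// ?nnegrE ?normc_ge0// sqr_normc_ReIm real_normK ?num_real//.
by rewrite lerDr sqr_ge0.
Qed.

Lemma normc_le_ReIm z : normc z <= `|Re z| + `|Im z|.
Proof.
rewrite -(@ler_pXn2r _ 2)// ?nnegrE ?normc_ge0 ?addr_ge0//.
rewrite sqr_normc_ReIm sqrrD !real_normK ?num_real//.
by rewrite -addrA lerD2l lerDr mulrn_wge0// mulr_ge0.
Qed.

Lemma Re_add z w : Re (z + w) = Re z + Re w. Proof. by case: z w => [? ?] [? ?]. Qed.
Lemma Im_add z w : Im (z + w) = Im z + Im w. Proof. by case: z w => [? ?] [? ?]. Qed.
Lemma Re_opp z : Re (- z) = - Re z. Proof. by case: z. Qed.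
Lemma Im_opp z : Im (- z) = - Im z. Proof. by case: z. Qed.
Lemma Re_mul z w : Re (z * w) = Re z * Re w - Im z * Im w.
Proof. by case: z w => [? ?] [? ?]. Qed.
Lemma Im_mul z w : Im (z * w) = Re z * Im w + Im z * Re w.
Proof. by case: z w => [? ?] [? ?]. Qed.

Lemma normc_real (r : R) : normc r%:C = `|r|.
Proof. by rewrite /= expr0n addr0 sqrtr_sqr. Qed.

Lemma normc_conj z : normc z^* = normc z.
Proof. by case: z => a b /=; rewrite sqrrN. Qed.

Lemma conjcM z w : (z * w)^* = z^* * w^*.
Proof. exact: rmorphM. Qed.

Lemma mulc_conj z : z * z^* = (normc z ^+ 2)%:C.
Proof.
rewrite sqr_normc_ReIm; case: z => a b; apply/eqP; rewrite eq_complex /=.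
by rewrite mulrN opprK -!expr2 eqxx mulrN (mulrC b) addNr eqxx.
Qed.

Lemma complex_ext z w : Re z = Re w -> Im z = Im w -> z = w.
Proof. by case: z w => [? ?] [? ?] /= -> ->. Qed.

Lemma sqr_normcB_le z w : normc (z - w) ^+ 2 <= (normc z ^+ 2 + normc w ^+ 2) *+ 2.
Proof.
rewrite !sqr_normc_ReIm Re_add Im_add Re_opp Im_opp.
have h (a b : R) : (a - b) ^+ 2 <= (a ^+ 2 + b ^+ 2) *+ 2.
  rewrite -subr_ge0 (_ : _ - _ = (a + b) ^+ 2) ?sqr_ge0//; ring.
by rewrite (le_trans (lerD (h _ _) (h _ _)))// -mulrnDl addrACA.
Qed.

End complex_numbers.

Section cis.
Context (R : realType).
Implicit Types x y : R.

Lemma cisD x y : cis (x + y) = cis x * cis y.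
Proof.
apply: complex_ext; rewrite ?Re_mul ?Im_mul /= ?cosD ?sinD//.
by rewrite addrC.
Qed.

Lemma cis0 : cis (0 : R) = 1.
Proof. by rewrite /cis cos0 sin0. Qed.

Lemma normc_cis x : normc (cis x) = 1.
Proof. by rewrite /= cos2Dsin2 sqrtr1. Qed.

Lemma cis_conj x : (cis x)^* = cis (- x).
Proof. by rewrite /cis /= cosN sinN. Qed.

End cis.

Section cintegral.
Context d (T : measurableType d) (R : realType).
Implicit Types f g : T -> R[i].

(* On R^n, cmeas, cintable and cint are convertible to cmeasurable, cintegrable
   and cintegral. *)
Definition cmeas f := measurable_fun setT (fun x => Re (f x)) /\
  measurable_fun setT (fun x => Im (f x)).

Lemma cmeasD f g : cmeas f -> cmeas g -> cmeas (fun x => f x + g x).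
Proof.
move=> [f1 f2] [g1 g2]; split.
  by under eq_fun do rewrite Re_add; exact: measurable_funD.
by under eq_fun do rewrite Im_add; exact: measurable_funD.
Qed.

Lemma cmeasN f : cmeas f -> cmeas (fun x => - f x).
Proof.
move=> [f1 f2]; split.
  by under eq_fun do rewrite Re_opp; exact: measurableT_comp.
by under eq_fun do rewrite Im_opp; exact: measurableT_comp.
Qed.

Lemma cmeasB f g : cmeas f -> cmeas g -> cmeas (fun x => f x - g x).
Proof. by move=> cf cg; apply: cmeasD => //; exact: cmeasN. Qed.

Lemma cmeasM f g : cmeas f -> cmeas g -> cmeas (fun x => f x * g x).
Proof.
move=> [f1 f2] [g1 g2]; split.
  under eq_fun do rewrite Re_mul.
  by apply: measurable_funB; exact: measurable_funM.
under eq_fun do rewrite Im_mul.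
by apply: measurable_funD; exact: measurable_funM.
Qed.

Lemma cmeas_cst (c : R[i]) : cmeas (fun=> c).
Proof. by split; exact: measurable_cst. Qed.

Lemma cmeas_conj f : cmeas f -> cmeas (fun x => (f x)^*).
Proof.
move=> [f1 f2]; split; first by move: f1; congr measurable_fun; apply/funext => x; case: (f x).
rewrite (_ : (fun x => _) = (fun x => - Im (f x))); first exact: measurableT_comp.
by apply/funext => x; case: (f x).
Qed.

Lemma cmeas_real (r : T -> R) : measurable_fun setT r -> cmeas (fun x => (r x)%:C).
Proof. by move=> mr; split => //; exact: measurable_cst. Qed.

Lemma cmeas_cis (r : T -> R) : measurable_fun setT r -> cmeas (fun x => cis (r x)).
Proof.
move=> mr; split; apply: measurableT_comp => //.
  by apply: continuous_measurable_fun; exact: continuous_cos.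
by apply: continuous_measurable_fun; exact: continuous_sin.
Qed.

Lemma cmeas_normc f : cmeas f -> measurable_fun setT (fun x => normc (f x)).
Proof.
move=> [f1 f2].
rewrite (_ : (fun x => _) = (fun x => Num.sqrt (Re (f x) ^+ 2 + Im (f x) ^+ 2))).
  apply: measurableT_comp.
    by apply: continuous_measurable_fun; exact: sqrt_continuous.
  by apply: measurable_funD; exact: measurable_funX.
by apply/funext => x; case: (f x).
Qed.

Variable m : {measure set T -> \bar R}.

Definition cintable f := m.-integrable setT (fun x => (Re (f x))%:E) /\
  m.-integrable setT (fun x => (Im (f x))%:E).

Definition cint f : R[i] := (\int[m]_x Re (f x)) +i* (\int[m]_x Im (f x)).

Lemma eq_cint f g : f =1 g -> cint f = cint g.
Proof. by move=> /funext ->. Qed.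

Lemma eq_cintable f g : f =1 g -> cintable f -> cintable g.
Proof. by move=> /funext ->. Qed.

Lemma eq_Rintegrable (u v : T -> R) : u =1 v ->
  m.-integrable setT (fun x => (u x)%:E) -> m.-integrable setT (fun x => (v x)%:E).
Proof. by move=> /funext ->. Qed.

Lemma integrable_le (u v : T -> R) : measurable_fun setT u ->
  (forall x, `|u x| <= v x) -> m.-integrable setT (EFin \o v) ->
  m.-integrable setT (EFin \o u).
Proof.
move=> mu uv iv; apply: le_integrable iv => //; first exact/measurable_EFinP.
move=> x _ /=; rewrite lee_fin (le_trans (uv x))//; exact: ler_norm.
Qed.

Lemma cintableP f : cintable f <->
  cmeas f /\ m.-integrable setT (fun x => (normc (f x))%:E).
Proof.
split=> [[i1 i2]|[[f1 f2] i]].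
  have m1 := measurable_int _ i1; have m2 := measurable_int _ i2.
  have cf : cmeas f by split; exact/measurable_EFinP.
  split => //; apply: (@integrable_le _ (fun x => `|Re (f x)| + `|Im (f x)|)).
  - exact: cmeas_normc.
  - by move=> x; rewrite ger0_norm ?normc_ge0// normc_le_ReIm.
  - apply: (eq_integrable _ (fun x => `|(Re (f x))%:E| + `|(Im (f x))%:E|)%E) => //.
    by apply: integrableD => //; exact: integrable_abse.
split; apply: (@integrable_le _ (fun x => normc (f x))) => // x.
  exact: norm_Re_le_normc.
exact: norm_Im_le_normc.
Qed.

Lemma cintable_cmeas f : cintable f -> cmeas f.
Proof. by move/cintableP => []. Qed.

Lemma cintable_normc f : cintable f -> m.-integrable setT (fun x => (normc (f x))%:E).
Proof. by move/cintableP => []. Qed.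

Lemma cintable_le f (v : T -> R) : cmeas f -> (forall x, normc (f x) <= v x) ->
  m.-integrable setT (fun x => (v x)%:E) -> cintable f.
Proof.
move=> cf fv iv; apply/cintableP; split => //.
apply: integrable_le iv; first exact: cmeas_normc.
by move=> x; rewrite ger0_norm ?normc_ge0.
Qed.

Lemma cintable_conj f : cintable f -> cintable (fun x => (f x)^*).
Proof.
move=> cf; apply: cintable_le (cintable_normc cf); first exact/cmeas_conj/cintable_cmeas.
by move=> x; rewrite normc_conj.
Qed.

Lemma cint_conj f : cintable f -> cint (fun x => (f x)^*) = (cint f)^*.
Proof.
move=> [f1 f2]; rewrite /cint /=; congr Complex.
  by apply: eq_Rintegral => x _; case: (f x).
rewrite -mulN1r -RintegralZl//.
by apply: eq_Rintegral => x _; rewrite mulN1r; case: (f x).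
Qed.

Lemma cintableD f g : cintable f -> cintable g -> cintable (fun x => f x + g x).
Proof.
move=> [f1 f2] [g1 g2]; split.
  by under eq_fun do rewrite Re_add EFinD; exact: integrableD.
by under eq_fun do rewrite Im_add EFinD; exact: integrableD.
Qed.

Lemma cintableZl c f : cintable f -> cintable (fun x => c * f x).
Proof.
move=> cf; apply: (@cintable_le _ (fun x => normc c * normc (f x))).
- by apply: cmeasM; [exact: cmeas_cst|exact: cintable_cmeas].
- by move=> x; rewrite normcM.
- under eq_fun do rewrite EFinM.
  by apply: integrableZl => //; exact: cintable_normc.
Qed.

Lemma cintD f g : cintable f -> cintable g ->
  cint (fun x => f x + g x) = cint f + cint g.
Proof.
move=> [f1 f2] [g1 g2]; rewrite /cint; apply: complex_ext => /=.
  by rewrite -RintegralD//; apply: eq_Rintegral => x _; rewrite Re_add.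
by rewrite -RintegralD//; apply: eq_Rintegral => x _; rewrite Im_add.
Qed.

Lemma cintZl c f : cintable f -> cint (fun x => c * f x) = c * cint f.
Proof.
move=> [f1 f2]; apply: complex_ext; rewrite ?Re_mul ?Im_mul /=.
  rewrite -!RintegralZl// -RintegralB//; last 2 first.
  - exact: (integrableZl measurableT (Re c) f1).
  - exact: (integrableZl measurableT (Im c) f2).
  by apply: eq_Rintegral => x _; rewrite Re_mul.
rewrite -!RintegralZl// -RintegralD//; last 2 first.
- exact: (integrableZl measurableT (Re c) f2).
- exact: (integrableZl measurableT (Im c) f1).
by apply: eq_Rintegral => x _; rewrite Im_mul.
Qed.

Lemma cintableN f : cintable f -> cintable (fun x => - f x).
Proof.
by move=> cf; under eq_fun do rewrite -mulN1r; exact: cintableZl.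
Qed.

Lemma cintableB f g : cintable f -> cintable g -> cintable (fun x => f x - g x).
Proof. by move=> cf cg; apply: cintableD => //; exact: cintableN. Qed.

Lemma cintB f g : cintable f -> cintable g ->
  cint (fun x => f x - g x) = cint f - cint g.
Proof.
move=> cf cg; rewrite cintD//; last exact: cintableN.
congr (_ + _); rewrite -[RHS]mulN1r -cintZl//.
by apply: eq_cint => x; rewrite mulN1r.
Qed.

Lemma cint_real (r : T -> R) : cint (fun x => (r x)%:C) = (\int[m]_x r x)%:C.
Proof.
rewrite /cint; apply: complex_ext => //=.
by rewrite Rintegral_cst// mul0r.
Qed.

(** Real and imaginary parts are bounded separately, hence the 2; it reappears as the leading 2 in
    [normc_four] and [gconv_lipschitz]. *)
Lemma normc_cint f : cintable f -> normc (cint f) <= 2 * \int[m]_x normc (f x).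
Proof.
move=> cf; have [f1 f2] := cf; have nf := cintable_normc cf.
rewrite (le_trans (normc_le_ReIm _))//= mulr_natl mulr2n; apply: lerD.
  rewrite (le_trans (le_normr_Rintegral _ _))//; apply: le_Rintegral => //.
    exact: integrable_norm.
  by move=> x _; exact: norm_Re_le_normc.
rewrite (le_trans (le_normr_Rintegral _ _))//; apply: le_Rintegral => //.
  exact: integrable_norm.
by move=> x _; exact: norm_Im_le_normc.
Qed.

Lemma EFin_Rintegral (r : T -> R) : m.-integrable setT (EFin \o r) ->
  (\int[m]_x r x)%:E = (\int[m]_x (r x)%:E)%E.
Proof. by move=> ir; rewrite fineK//; exact: integrable_fin_num. Qed.

End cintegral.

Arguments cint : simpl never.

(* Integrability of every slice, and not only of almost every one, spares a
   detour through null sets. *)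
Lemma Rintegral_swap d1 d2 (T1 : measurableType d1) (T2 : measurableType d2)
    (R : realType) (m1 : {sigma_finite_measure set T1 -> \bar R})
    (m2 : {sigma_finite_measure set T2 -> \bar R}) (f : T1 * T2 -> R) :
  (m1 \x m2)%E.-integrable setT (EFin \o f) ->
  (forall x, m2.-integrable setT (fun y => (f (x, y))%:E)) ->
  (forall y, m1.-integrable setT (fun x => (f (x, y))%:E)) ->
  \int[m1]_x \int[m2]_y f (x, y) = \int[m2]_y \int[m1]_x f (x, y).
Proof.
move=> fi f2 f1; rewrite /Rintegral; congr fine.
transitivity (\int[m1]_x \int[m2]_y (f (x, y))%:E)%E.
  by apply: eq_integral => x _; rewrite fineK//; exact: integrable_fin_num.
rewrite (Fubini fi); apply: eq_integral => y _ /=.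
by rewrite fineK//; exact: (integrable_fin_num measurableT (f1 y)).
Qed.

Lemma cint_swap d1 d2 (T1 : measurableType d1) (T2 : measurableType d2)
    (R : realType) (m1 : {sigma_finite_measure set T1 -> \bar R})
    (m2 : {sigma_finite_measure set T2 -> \bar R}) (f : T1 * T2 -> R[i]) :
  cintable (m1 \x m2)%E f ->
  (forall x, cintable m2 (fun y => f (x, y))) ->
  (forall y, cintable m1 (fun x => f (x, y))) ->
  cint m1 (fun x => cint m2 (fun y => f (x, y))) =
  cint m2 (fun y => cint m1 (fun x => f (x, y))).
Proof.
move=> [fR fI] f2 f1; rewrite /cint; apply: complex_ext => /=.
  apply: (@Rintegral_swap _ _ _ _ _ m1 m2 (fun p => Re (f p))) => //.
    by move=> x; case: (f2 x).
  by move=> y; case: (f1 y).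
apply: (@Rintegral_swap _ _ _ _ _ m1 m2 (fun p => Im (f p))) => //.
  by move=> x; case: (f2 x).
by move=> y; case: (f1 y).
Qed.

Lemma integrable_prod d1 d2 (T1 : measurableType d1) (T2 : measurableType d2)
    (R : realType) (m1 : {sigma_finite_measure set T1 -> \bar R})
    (m2 : {sigma_finite_measure set T2 -> \bar R}) (u : T1 -> R) (v : T2 -> R) :
  m1.-integrable setT (EFin \o u) -> m2.-integrable setT (EFin \o v) ->
  (m1 \x m2)%E.-integrable setT (fun p => (u p.1 * v p.2)%:E).
Proof.
move=> iu iv; have mu := measurable_int _ iu; have mv := measurable_int _ iv.
have /measurable_EFinP mu' := mu; have /measurable_EFinP mv' := mv.
apply/integrable12ltyP.
  apply/measurable_EFinP; apply: measurable_funM.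
    exact: measurableT_comp mu' measurable_fst.
  exact: measurableT_comp mv' measurable_snd.
have avoo := (integrableP _ _ _ iv).2; have auoo := (integrableP _ _ _ iu).2.
have av0 : (0 <= \int[m2]_y `|(v y)%:E|)%E by exact: integral_ge0.
have au0 : (0 <= \int[m1]_x `|(u x)%:E|)%E by exact: integral_ge0.
rewrite (_ : (\int[m1]_x _ = (\int[m1]_x `|(u x)%:E|) * \int[m2]_y `|(v y)%:E|)%E).
  by apply: lte_mul_pinfty => //; rewrite ge0_fin_numE.
rewrite -ge0_integralZr//; last exact: measurableT_comp.
apply: eq_integral => x _; rewrite -ge0_integralZl//; last exact: measurableT_comp.
by apply: eq_integral => y _; rewrite EFinM abseM.
Qed.

(** * One-dimensional Gaussians *)

Section improper_ftc.
Context (R : realType).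
Local Notation mu := (@lebesgue_measure R).

(** The fundamental theorem of calculus on [[-(k+1), k+1]]: the bound on [x * F x] makes both
    boundary values O(1/k), and dominated convergence takes k to infinity. *)
Lemma Rintegral_derive_eq0 (F f : R -> R) :
  (forall x : R, is_derive x 1 F (f x)) -> continuous f ->
  mu.-integrable setT (EFin \o f) -> (exists K, forall x, `|x * F x| <= K) ->
  \int[mu]_x f x = 0.
Proof.
move=> dF cf intf [K FK].
have F0 (u : nat -> R) : (forall k, `|u k| = k.+1%:R) -> F (u k) @[k --> \oo] --> (0 : R).
  move=> uk; apply/norm_cvg0P.
  apply: (@squeeze_cvgr _ _ _ _ (cst 0) (fun k => K * harmonic k)).
  - near=> k; rewrite normr_ge0/= /harmonic /= ler_pdivlMr// -(uk k) mulrC -normrM.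
    exact: FK.
  - exact: cvg_cst.
  - rewrite -[X in _ --> X](mulr0 K); apply: cvgMr; exact: cvg_harmonic.
have Fy : F k.+1%:R @[k --> \oo] --> (0 : R) by apply: F0 => k; rewrite normr_nat.
have FNy : F (- k.+1%:R) @[k --> \oo] --> (0 : R).
  by apply: F0 => k; rewrite normrN normr_nat.
pose f_ k x := (f x * \1_(`[- k.+1%:R, k.+1%:R]%classic : set R) x)%:E.
have mf : measurable_fun setT f by exact: continuous_measurable_fun.
have intf_ k : (\int[mu]_x f_ k x = (F k.+1%:R)%:E - (F (- k.+1%:R))%:E)%E.
  rewrite -(@continuous_FTC2 _ f F).
  - rewrite [RHS]integral_mkcond/=; apply: eq_integral => x _.
    by rewrite /f_ patchE indicE; case: ifPn => _; rewrite (mulr1, mulr0).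
  - by rewrite (@lt_trans _ _ 0)// ?oppr_lt0 ltr0n.
  - exact: continuous_subspaceT.
  - have cF : continuous F.
      by move=> x; apply/differentiable_continuous/derivable1_diffP; case: (dF x).
    split.
    + by move=> x _; case: (dF x).
    + exact/cvg_at_right_filter/cF.
    + exact/cvg_at_left_filter/cF.
  - by move=> x _; rewrite derive1E; exact: derive_val.
have mf_ k : measurable_fun setT (f_ k).
  by apply/measurable_EFinP; apply: measurable_funM.
have h : ((F k.+1%:R - F (- k.+1%:R))%:E @[k --> \oo] --> \int[mu]_x (f x)%:E)%E.
  have -> : (fun k => (F k.+1%:R - F (- k.+1%:R))%:E) = (fun k => \int[mu]_x f_ k x)%E.
    by apply/funext => k; rewrite intf_ EFinB.
  have [|||_ _ //] := @dominated_convergence _ _ _ mu _ measurableT f_ (EFin \o f)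
    (EFin \o (fun x => `|f x|)) mf_ (proj2 (measurable_EFinP _ _) mf).
  - apply: aeW => x _; apply: cvg_near_cst.
    near=> k; rewrite /f_ indicE mem_set ?mulr1//= in_itv/= -ler_norml.
    apply: ltW; apply: (lt_le_trans (truncnS_gt `|x|)).
    rewrite ler_nat ltnS; near: k; exact: nbhs_infty_ge.
  - exact: integrable_norm.
  - apply: aeW => x k _; rewrite /f_ /= lee_fin normrM indicE.
    by case: (_ \in _); rewrite ?normr1 ?mulr1// normr0 mulr0.
have h0 : ((F k.+1%:R - F (- k.+1%:R))%:E @[k --> \oo] --> (0 : R)%:E)%E.
  apply: cvg_EFin; first exact: nearW.
  rewrite -[X in _ --> X]subr0; exact: cvgB.
by rewrite /Rintegral (cvg_unique _ h h0).
Unshelve. all: end_near. Qed.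

End improper_ftc.

Section gaussian.
Context (R : realType).
Local Notation mu := (@lebesgue_measure R).
Implicit Types m s x r theta : R.

Lemma normal_peakE s : 0 < s -> normal_peak s = (s * Num.sqrt (pi *+ 2))^-1.
Proof.
move=> s0; rewrite /normal_peak -mulrnAr sqrtrM ?sqr_ge0//.
by rewrite sqrtr_sqr ger0_norm ?ltW.
Qed.

Lemma normal_pdf_exp m s x : 0 < s -> normal_pdf m s x =
  (s * Num.sqrt (pi *+ 2))^-1 * expR (- (((x - m) / s) ^+ 2 / 2)).
Proof.
move=> s0; rewrite normal_pdfE ?gt_eqF// normal_peakE//; congr (_ * expR _).
by field; rewrite gt_eqF.
Qed.

Lemma sqrt2pi_gt0 : 0 < Num.sqrt (pi *+ 2) :> R.
Proof. by rewrite sqrtr_gt0 pmulrn_lgt0// pi_gt0. Qed.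

Lemma normal_pdf_center m s x : 0 < s -> normal_pdf m s x = normal_pdf 0 s (x - m).
Proof. by move=> s0; rewrite !normal_pdf_exp// subr0. Qed.

Lemma normal_pdf_sym m s x : 0 < s -> normal_pdf m s x = normal_pdf x s m.
Proof. by move=> s0; rewrite !normal_pdf_exp// -(opprB x) mulNr sqrrN. Qed.

Lemma normal_pdf_wider m s x : 0 < s ->
  normal_pdf m s x <= 2 * normal_pdf m (2 * s) x.
Proof.
move=> s0; have q0 := sqrt2pi_gt0; rewrite !normal_pdf_exp ?mulr_gt0//.
rewrite mulrA; set u := (x - m) / s.
rewrite (_ : 2 * _ = (s * Num.sqrt (pi *+ 2))^-1); last first.
  by field; rewrite !gt_eqF.
rewrite ler_pM2l ?invr_gt0 ?mulr_gt0// ler_expR lerN2 ler_pM2r ?invr_gt0//.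
rewrite (_ : (x - m) / (2 * s) = u / 2); last by rewrite /u; field; rewrite gt_eqF.
rewrite expr_div_n ler_pdivrMr// ler_peMr ?sqr_ge0//.
by rewrite -natrX ler1n.
Qed.

(** A Gaussian of twice the width absorbs the factor [|x - m|], so that first moments are bounded by
    total masses. *)
Lemma normal_pdf_moment_wider m s x : 0 < s ->
  `|x - m| * normal_pdf m s x <= 2 * s * normal_pdf m (2 * s) x.
Proof.
move=> s0; have q0 := sqrt2pi_gt0; rewrite !normal_pdf_exp ?mulr_gt0//.
set u := (x - m) / s; rewrite (_ : `|x - m| = s * `|u|); last first.
  by rewrite normrM normfV (gtr0_norm s0) mulrC divfK ?gt_eqF.
rewrite (_ : (x - m) / (2 * s) = u / 2); last by rewrite /u; field; rewrite gt_eqF.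
rewrite (_ : 2 * s * _ = (Num.sqrt (pi *+ 2))^-1 * expR (- ((u / 2) ^+ 2 / 2))); last first.
  by field; rewrite !gt_eqF.
rewrite (_ : s * `|u| * _ = (Num.sqrt (pi *+ 2))^-1 * (`|u| * expR (- (u ^+ 2 / 2)))); last first.
  by field; rewrite !gt_eqF.
rewrite ler_pM2l ?invr_gt0//.
(* The exponents differ by u^2/2 - u^2/8 = 3u^2/8, and |u| <= 1 + 3u^2/8 <= exp(3u^2/8). *)
have /le_trans : `|u| * expR (- (u ^+ 2 / 2)) <=
    expR (3 / 8 * u ^+ 2) * expR (- (u ^+ 2 / 2)).
  rewrite ler_pM2r ?expR_gt0//.
  apply: (@le_trans _ _ (1 + 3 / 8 * u ^+ 2)); last exact: expR_ge1Dx.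
  rewrite -(real_normK (num_real u)); have := sqr_ge0 (`|u| - 2); nra.
apply; rewrite -expRD ler_expR le_eqVlt; apply/orP; left; apply/eqP; by field.
Qed.

Lemma integrable_normal_moment m s : 0 < s ->
  mu.-integrable setT (fun x => (`|x - m| * normal_pdf m s x)%:E).
Proof.
move=> s0; apply: (@integrable_le _ _ R mu _ (fun x => 2 * s * normal_pdf m (2 * s) x)).
- apply: measurable_funM; last exact: measurable_normal_pdf.
  by apply: measurableT_comp => //; exact: measurable_funB.
- move=> x; rewrite ger0_norm ?mulr_ge0 ?normal_pdf_ge0//.
  exact: normal_pdf_moment_wider.
- exact: (integrableZl measurableT (2 * s) (integrable_normal_pdf m (2 * s))).
Qed.

Lemma is_derive_normal_pdf m s x : 0 < s ->
  is_derive x 1 (normal_pdf m s) (- ((x - m) / s ^+ 2) * normal_pdf m s x).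
Proof.
move=> s0; rewrite (_ : normal_pdf m s = fun x =>
  (s * Num.sqrt (pi *+ 2))^-1 * expR (- (((x - m) / s) ^+ 2 / 2))); last first.
  by apply/funext => y; rewrite normal_pdf_exp.
apply: is_derive_eq; rewrite /GRing.scale /=; field; rewrite !gt_eqF ?sqrt2pi_gt0//.
Qed.

Lemma normal_pdf_decay m s : 0 < s ->
  exists K, forall x, `|x| * normal_pdf m s x <= K.
Proof.
move=> s0; exists (2 * s * normal_peak (2 * s) + `|m| * normal_peak s) => x.
have xm : `|x| <= `|x - m| + `|m| by rewrite -{1}(subrK m x) ler_normD.
apply: (le_trans (ler_wpM2r (normal_pdf_ge0 _ _ _) xm)); rewrite mulrDl lerD//.
  rewrite (le_trans (normal_pdf_moment_wider _ _ s0))// ler_pM2l ?mulr_gt0//.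
  by rewrite normal_pdf_ub// gt_eqF// mulr_gt0.
by rewrite ler_wpM2l// normal_pdf_ub// gt_eqF.
Qed.

Section characteristic_function.
Variables (m s theta : R).
Hypothesis s0 : 0 < s.

(** The free shift [theta] lets one real computation serve both parts of [cis (x * r)]: [x * m]
    gives the cosine and [x * m - pi / 2] the sine. *)
Let phase x r := x * (r - m) + theta.

Let is_derive_phase x r : is_derive r 1 (phase x) x.
Proof. by apply: is_derive_eq; rewrite /GRing.scale /=; ring. Qed.

Let is_derive_phase1 x r : is_derive x 1 (phase ^~ r) (r - m).
Proof. by apply: is_derive_eq; rewrite /GRing.scale /=; ring. Qed.

Let measurable_phase x : measurable_fun setT (phase x).
Proof.
apply: measurable_funD => //; apply: measurable_funM => //; exact: measurable_funB.
Qed.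

Let mcos : measurable_fun setT (@cos R).
Proof. by apply: continuous_measurable_fun; exact: continuous_cos. Qed.

Let msin : measurable_fun setT (@sin R).
Proof. by apply: continuous_measurable_fun; exact: continuous_sin. Qed.

Let int_cos x : mu.-integrable setT (fun r => (cos (phase x r) * normal_pdf m s r)%:E).
Proof.
apply: (@integrable_le _ _ R mu _ (fun r => normal_pdf m s r)).
- apply: measurable_funM; last exact: measurable_normal_pdf.
  exact: (measurableT_comp mcos (measurable_phase x)).
- move=> r; rewrite normrM (ger0_norm (normal_pdf_ge0 _ _ _)).
  by rewrite ler_piMl ?normal_pdf_ge0// ler_norml cos_geN1 cos_le1.
- exact: integrable_normal_pdf.
Qed.

Let int_sin x :
  mu.-integrable setT (fun r => ((r - m) * sin (phase x r) * normal_pdf m s r)%:E).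
Proof.
apply: (@integrable_le _ _ R mu _ (fun r => `|r - m| * normal_pdf m s r)).
- apply: measurable_funM; last exact: measurable_normal_pdf.
  by apply: measurable_funM; [exact: measurable_funB|exact: (measurableT_comp msin (measurable_phase x))].
- move=> r; rewrite !normrM (ger0_norm (normal_pdf_ge0 _ _ _)).
  rewrite ler_wpM2r ?normal_pdf_ge0// ler_piMr//.
  by rewrite ler_norml sin_geN1 sin_le1.
- exact: integrable_normal_moment.
Qed.

Let Phi x := \int[mu]_r (cos (phase x r) * normal_pdf m s r).

(** Gaussian integration by parts: [(r - m) * normal_pdf m s r] is [- s ^+ 2] times the derivative
    of the density, so the vanishing integral of the derivative of [F] relates the two sides. *)
Let stein x : \int[mu]_r ((r - m) * sin (phase x r) * normal_pdf m s r) =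
  s ^+ 2 * x * Phi x.
Proof.
pose F r := sin (phase x r) * normal_pdf m s r.
pose f r := x * (cos (phase x r) * normal_pdf m s r) -
  (s ^+ 2)^-1 * ((r - m) * sin (phase x r) * normal_pdf m s r).
have dF (r : R) : is_derive r 1 F (f r).
  have := is_derive_normal_pdf m r s0; have := is_derive_phase x r => h1 h2.
  apply: is_derive_eq; rewrite /GRing.scale /= /f; ring.
have cp : continuous (phase x).
  by move=> r; apply/differentiable_continuous/derivable1_diffP; case: (is_derive_phase x r).
have ccos : continuous (fun r => cos (phase x r)).
  by move=> r; apply: continuous_comp; [exact: cp|exact: continuous_cos].
have csin : continuous (fun r => sin (phase x r)).
  by move=> r; apply: continuous_comp; [exact: cp|exact: continuous_sin].
have cn : continuous (normal_pdf m s) by apply: continuous_normal_pdf; rewrite gt_eqF.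
have cf : continuous f.
  move=> r; apply: cvgB; apply: cvgM; (try exact: cvg_cst); apply: cvgM; (try exact: cn).
    exact: ccos.
  by apply: cvgM; [apply: cvgB; [exact: cvg_id|exact: cvg_cst]|exact: csin].
have i1 := integrableZl measurableT x (int_cos x).
have i2 := integrableZl measurableT (s ^+ 2)^-1 (int_sin x).
have intf : mu.-integrable setT (EFin \o f).
  by rewrite /f /comp; under eq_fun do rewrite EFinB; exact: integrableB.
have decay : exists K, forall r, `|r * F r| <= K.
  have [K HK] := normal_pdf_decay m s0; exists K => r.
  rewrite !normrM (ger0_norm (normal_pdf_ge0 _ _ _)) (le_trans _ (HK r))//.
  rewrite ler_wpM2l// ler_piMl ?normal_pdf_ge0//.
  by rewrite ler_norml sin_geN1 sin_le1.
have := Rintegral_derive_eq0 dF cf intf decay.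
rewrite /f RintegralB// (RintegralZl x measurableT (int_cos x)).
rewrite (RintegralZl (s ^+ 2)^-1 measurableT (int_sin x)).
by move=> /eqP; rewrite subr_eq0 => /eqP e; rewrite -mulrA e mulVKf// gt_eqF// exprn_gt0.
Qed.

(** Differentiation under the integral sign, dominated by the first absolute moment, leaves the
    integral that [stein] evaluates; [Phi] thus solves a linear differential equation. *)
Let is_derive_Phi x : is_derive x 1 Phi (- (s ^+ 2 * x * Phi x)).
Proof.
pose f x r := cos (phase x r) * normal_pdf m s r.
have df (y r : R) : is_derive y 1 (f ^~ r) (- ((r - m) * sin (phase y r) * normal_pdf m s r)).
  have := is_derive_phase1 y r => h1.
  apply: is_derive_eq; rewrite /GRing.scale /=; ring.
have xI : `]x - 1, x + 1[%classic x by rewrite /= in_itv/= ltrBlDr ltrDl ltr01.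
have d1E y r : (partial1of2 f) y r = - ((r - m) * sin (phase y r) * normal_pdf m s r).
  by rewrite partial1of2E; exact: derive_val.
have ub y r : `]x - 1, x + 1[%classic y -> setT r ->
    `|(partial1of2 f) y r| <= `|r - m| * normal_pdf m s r.
  move=> _ _; rewrite d1E normrN !normrM (ger0_norm (normal_pdf_ge0 _ _ _)).
  rewrite ler_wpM2r ?normal_pdf_ge0// ler_piMr//.
  by rewrite ler_norml sin_geN1 sin_le1.
have G0 r : 0 <= `|r - m| * normal_pdf m s r by rewrite mulr_ge0// normal_pdf_ge0.
have fd y r : `]x - 1, x + 1[%classic y -> setT r -> derivable (f ^~ r) y 1.
  by move=> _ _; case: (df y r).
have fi y : `]x - 1, x + 1[%classic y -> mu.-integrable setT (EFin \o f y).
  by move=> _; exact: int_cos.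
have d := derivable_under_integral measurableT xI fi fd G0 (integrable_normal_moment m s0) ub.
apply: DeriveDef; first exact: d.
rewrite -derive1E (differentiation_under_integral measurableT xI fi fd G0 (integrable_normal_moment m s0) ub).
transitivity (\int[mu]_r (- 1 * ((r - m) * sin (phase x r) * normal_pdf m s r))).
  by apply: eq_Rintegral => r _; rewrite /= d1E mulN1r.
by rewrite (RintegralZl (-1) measurableT (int_sin x)) stein mulN1r.
Qed.

Lemma Rintegral_cos_normal x :
  \int[mu]_r (cos (x * (r - m) + theta) * normal_pdf m s r) =
  cos theta * expR (- ((s * x) ^+ 2 / 2)).
Proof.
(* The integrating factor of Phi' = - s^2 x Phi: [z] is constant, and its value at 0 is explicit. *)
pose z x := Phi x * expR ((s * x) ^+ 2 / 2).
have dz (y : R) : is_derive y 1 z 0.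
  have := is_derive_Phi y => h.
  apply: is_derive_eq; rewrite /GRing.scale /=; by field.
have := @is_derive_0_is_cst _ z x 0 dz.
rewrite {2}/z mulr0 expr0n/= mul0r expR0 mulr1.
have -> : Phi 0 = cos theta.
  transitivity (\int[mu]_r (cos theta * normal_pdf m s r)).
    by apply: eq_Rintegral => r _; rewrite /phase mul0r add0r.
  rewrite RintegralZl//; last exact: integrable_normal_pdf.
  by rewrite /Rintegral integral_normal_pdf/= mulr1.
move=> zx.
by rewrite -zx /z -mulrA -expRD subrr expR0 mulr1.
Qed.

End characteristic_function.

Lemma cint_cis_normal m s x : 0 < s ->
  cint mu (fun r => cis (x * r) * (normal_pdf m s r)%:C) =
  cis (x * m) * (expR (- ((s * x) ^+ 2 / 2)))%:C.
Proof.
move=> s0; apply: complex_ext; rewrite ?Re_mul ?Im_mul /= ?mulr0 ?subr0 ?add0r.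
  rewrite -(Rintegral_cos_normal m (x * m) s0); apply: eq_Rintegral => r _.
  by rewrite mulr0 subr0; congr (cos _ * _); ring.
rewrite -[sin (x * m)]cosBpihalf.
rewrite -(Rintegral_cos_normal m (x * m - pi / 2) s0); apply: eq_Rintegral => r _.
by rewrite mulr0 add0r -cosBpihalf; congr (cos _ * _); ring.
Qed.

End gaussian.

(** * Fourier integrals on R^n *)

Section product_integral.
Context d1 d2 (T1 : measurableType d1) (T2 : measurableType d2) (R : realType).
Variables (m1 : {sigma_finite_measure set T1 -> \bar R})
  (m2 : {sigma_finite_measure set T2 -> \bar R}).

Lemma Rintegral_prod (u : T1 -> R) (v : T2 -> R) :
  m1.-integrable setT (EFin \o u) -> m2.-integrable setT (EFin \o v) ->
  \int[(m1 \x m2)%E]_p (u p.1 * v p.2) = \int[m1]_x u x * \int[m2]_y v y.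
Proof.
move=> iu iv; have iuv := integrable_prod iu iv.
rewrite {1}/Rintegral -integral12_prod_meas1// -RintegralZr// /Rintegral.
congr fine; apply: eq_integral => x _ /=.
transitivity ((u x)%:E * \int[m2]_y (v y)%:E)%E.
  by rewrite -integralZl//; apply: eq_integral => y _; rewrite -EFinM.
by rewrite EFinM fineK//; exact: (integrable_fin_num measurableT iv).
Qed.

Lemma cintable_prod (u : T1 -> R[i]) (v : T2 -> R[i]) :
  cintable m1 u -> cintable m2 v -> cintable (m1 \x m2)%E (fun p => u p.1 * v p.2).
Proof.
move=> iu iv; have [[u1 u2] [v1 v2]] := (cintable_cmeas iu, cintable_cmeas iv).
apply: (@cintable_le _ _ _ _ _ (fun p => normc (u p.1) * normc (v p.2))).
- apply: cmeasM; split.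
  + exact: measurableT_comp u1 measurable_fst.
  + exact: measurableT_comp u2 measurable_fst.
  + exact: measurableT_comp v1 measurable_snd.
  + exact: measurableT_comp v2 measurable_snd.
- by move=> p; rewrite normcM.
- exact: (integrable_prod (cintable_normc iu) (cintable_normc iv)).
Qed.

Lemma cint_prod (u : T1 -> R[i]) (v : T2 -> R[i]) :
  cintable m1 u -> cintable m2 v ->
  cint (m1 \x m2)%E (fun p => u p.1 * v p.2) = cint m1 u * cint m2 v.
Proof.
move=> [u1 u2] [v1 v2]; apply: complex_ext; rewrite ?Re_mul ?Im_mul /=.
  rewrite -(Rintegral_prod u1 v1) -(Rintegral_prod u2 v2) -RintegralB//.
  - by apply: eq_Rintegral => p _; rewrite Re_mul.
  - exact: (integrable_prod u1 v1).
  - exact: (integrable_prod u2 v2).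
rewrite -(Rintegral_prod u1 v2) -(Rintegral_prod u2 v1) -RintegralD//.
- by apply: eq_Rintegral => p _; rewrite Im_mul.
- exact: (integrable_prod u1 v2).
- exact: (integrable_prod u2 v1).
Qed.

End product_integral.

Section lebesgue_euclid_product.
Context (R : realType).
Local Notation leb := (@lebesgue_measure R).
Local Notation mu n := (lebesgue_euclid R n).

Lemma cintable_euclidS n (f : euclidean R n.+1 -> R[i]) : cmeas f ->
  cintable (leb \x mu n)%E (f \o @tcons R n) -> cintable (mu n.+1) f.
Proof.
move=> [f1 f2] [i1 i2]; split.
  by apply: (integrable_pushforward (@measurable_tcons R n)) => //; exact/measurable_EFinP.
by apply: (integrable_pushforward (@measurable_tcons R n)) => //; exact/measurable_EFinP.
Qed.

Lemma cint_euclidS n (f : euclidean R n.+1 -> R[i]) : cmeas f ->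
  cintable (leb \x mu n)%E (f \o @tcons R n) ->
  cint (mu n.+1) f = cint (leb \x mu n)%E (f \o @tcons R n).
Proof.
move=> [f1 f2] [i1 i2]; apply: complex_ext => /=.
  rewrite /Rintegral; congr fine.
  apply: (integral_pushforward (@measurable_tcons R n) _ i1) => //.
  exact/measurable_EFinP.
rewrite /Rintegral; congr fine.
apply: (integral_pushforward (@measurable_tcons R n) _ i2) => //.
exact/measurable_EFinP.
Qed.

Lemma cmeas_prod n (w : 'I_n -> R -> R[i]) : (forall i, cmeas (w i)) ->
  cmeas (fun x : euclidean R n => \prod_(i < n) w i (tnth x i)).
Proof.
move=> cw.
suff : forall s : seq 'I_n, cmeas (fun x : euclidean R n => \prod_(i <- s) w i (tnth x i)).
  by apply.
elim=> [|i s IH].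
  by under eq_fun do rewrite big_nil; exact: cmeas_cst.
under eq_fun do rewrite big_cons.
apply: cmeasM IH; have [w1 w2] := cw i; split.
  exact: measurableT_comp w1 (measurable_tnth i).
exact: measurableT_comp w2 (measurable_tnth i).
Qed.

(** Fubini, by induction along the construction of [lebesgue_euclid]. The functions integrated over
    R^n through it are products over the coordinates: Gaussians, tents, and the majorant of Schwartz
    functions. *)
Lemma cintable_cint_prod n (w : 'I_n -> R -> R[i]) : (forall i, cintable leb (w i)) ->
  cintable (mu n) (fun x => \prod_(i < n) w i (tnth x i)) /\
  cint (mu n) (fun x => \prod_(i < n) w i (tnth x i)) = \prod_(i < n) cint leb (w i).
Proof.
elim: n w => [|n IH] w iw.
  have e : (fun x : euclidean R 0 => \prod_(i < 0) w i (tnth x i)) = fun=> 1%:C.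
    by apply/funext => x; rewrite big_ord0.
  rewrite e big_ord0 cint_real; split.
    have i1 : (mu 0).-integrable setT (EFin \o (fun=> 1 : R)).
      apply/integrableP; split; first exact/measurable_EFinP.
      by rewrite integral_dirac// diracT mul1e /= normr1 ltry.
    split => //=.
    apply/integrableP; split; first exact/measurable_EFinP.
    by rewrite integral_dirac// diracT mul1e /= normr0 ltry.
  by rewrite /Rintegral integral_dirac// diracT mul1e.
have [IH1 IH2] := IH (fun i => w (lift ord0 i)) (fun i => iw _).
have E : (fun x : euclidean R n.+1 => \prod_(i < n.+1) w i (tnth x i)) \o @tcons R n =
    (fun p => w ord0 p.1 * (fun y : euclidean R n => \prod_(i < n) w (lift ord0 i) (tnth y i)) p.2).
  apply/funext => p /=; rewrite big_ord_recl tnth0; congr (_ * _).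
  by apply: eq_bigr => i _; rewrite tnthS.
have cp : cmeas (fun x : euclidean R n.+1 => \prod_(i < n.+1) w i (tnth x i)).
  by apply: cmeas_prod => i; exact: cintable_cmeas (iw i).
have ip := cintable_prod (iw ord0) IH1.
split; first by apply: cintable_euclidS => //; rewrite E.
by rewrite cint_euclidS ?E// (cint_prod (iw ord0) IH1) IH2 big_ord_recl.
Qed.

Lemma integrable_Rintegral_prod n (w : 'I_n -> R -> R) :
  (forall i, leb.-integrable setT (EFin \o w i)) ->
  (mu n).-integrable setT (fun x => (\prod_(i < n) w i (tnth x i))%:E) /\
  \int[mu n]_x (\prod_(i < n) w i (tnth x i)) = \prod_(i < n) \int[leb]_r w i r.
Proof.
move=> iw.
have [] := @cintable_cint_prod n (fun i r => (w i r)%:C) _.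
  by move=> i; split => //=; [exact: iw|exact: integrable0].
have e x : \prod_(i < n) (w i (tnth x i))%:C = (\prod_(i < n) w i (tnth x i))%:C.
  by rewrite rmorph_prod.
under eq_fun do rewrite e.
move=> [h _] h2; split => //.
move: h2; rewrite cint_real.
under [RHS]eq_bigr do rewrite cint_real.
by rewrite -rmorph_prod => /complexI.
Qed.

Lemma integrable_oneDsqrV : leb.-integrable setT (fun r => ((oneDsqr r)^-1)%:E).
Proof.
apply/integrableP; split.
  apply/measurable_EFinP; apply: continuous_measurable_fun; exact: continuous_oneDsqrV.
under eq_integral do rewrite /= ger0_norm ?invr_ge0//.
rewrite ge0_symfun_integralT//.
- rewrite (_ : [set x | _] = `[0, +oo[%classic); last first.
    by apply/seteqP; split => x/=; rewrite in_itv/= andbT.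
  by rewrite integral0y_oneDsqr -EFinM ltry.
- exact: continuous_oneDsqrV.
- by move=> x /=; rewrite /oneDsqr sqrrN.
Qed.

End lebesgue_euclid_product.

Section dot_product.
Context (R : realType) (n : nat).
Local Notation E := (euclidean R n).
Implicit Types x y z : E.

Lemma dotC x y : dot x y = dot y x.
Proof. by apply: eq_bigr => i _; rewrite mulrC. Qed.

Lemma measurable_dotl y : measurable_fun setT (fun x => dot x y).
Proof.
apply: measurable_sum => i; apply: measurable_funM => //; exact: measurable_tnth.
Qed.

Lemma measurable_dot2 : measurable_fun setT (fun p : E * E => dot p.1 p.2).
Proof.
apply: measurable_sum => i; apply: measurable_funM.
  exact: measurableT_comp (measurable_tnth i) measurable_fst.
exact: measurableT_comp (measurable_tnth i) measurable_snd.
Qed.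

Lemma measurable_enorm : measurable_fun setT (@enorm R n).
Proof.
apply: (@measurableT_comp _ _ _ E R R Num.sqrt _ (fun x => dot x x)).
  by apply: continuous_measurable_fun; exact: sqrt_continuous.
apply: measurable_sum => i; apply: measurable_funM; exact: measurable_tnth.
Qed.

Lemma cis_sum (I : finType) (F : I -> R) : cis (\sum_i F i) = \prod_i cis (F i).
Proof.
elim/big_rec2 : _ => [|i a b _ <-]; [exact: cis0|exact: cisD].
Qed.

Lemma cmeas_cis_dot c x : cmeas (fun y => cis (c * dot x y)).
Proof.
apply: cmeas_cis; apply: measurable_funM => //.
rewrite (_ : dot x = fun y => dot y x); first exact: measurable_dotl.
by apply/funext => y; rewrite dotC.
Qed.

End dot_product.

(** Tonelli makes the integrals of the positive and negative parts measurable in the parameter, with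
    extended real values; the real integral is [fine] of their difference. *)
Lemma measurable_Rintegral_param d1 d2 (T1 : measurableType d1)
    (T2 : measurableType d2) (R : realType)
    (m2 : {sigma_finite_measure set T2 -> \bar R}) (F : T1 * T2 -> R) :
  measurable_fun setT F -> measurable_fun setT (fun x => \int[m2]_y F (x, y)).
Proof.
move=> /measurable_EFinP mF.
apply: (measurableT_comp (fine_measurable measurableT)).
have -> : (fun x => \int[m2]_y (F (x, y))%:E)%E =
    (fubini_F m2 (EFin \o F)^\+ \- fubini_F m2 (EFin \o F)^\-)%E.
  apply/funext => x; rewrite [LHS]integralE.
  under eq_integral do rewrite (funepos_comp (EFin \o F))/=.
  by under [X in (_ - X)%E = _]eq_integral do rewrite (funeneg_comp (EFin \o F))/=.
apply: emeasurable_funB; apply: measurable_fun_fubini_tonelli_F => //.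
  exact: measurable_funepos.
exact: measurable_funeneg.
Qed.

Section fourier_kernel.
Context (R : realType) (n : nat).
Local Notation E := (euclidean R n).
Local Notation mu := (lebesgue_euclid R n).
Implicit Types (f g : E -> R[i]) (c s : R) (x y z : E).

(* Both the Fourier transform (c = -1) and its unnormalised inverse (c = 1). *)
Definition four c f x : R[i] := cint mu (fun y => cis (c * dot x y) * f y).

Lemma cintable_four c f x : cintable mu f -> cintable mu (fun y => cis (c * dot x y) * f y).
Proof.
move=> cf; apply: cintable_le (cintable_normc cf).
  by apply: cmeasM; [exact: cmeas_cis_dot|exact: (cintable_cmeas cf)].
by move=> y; rewrite normcM normc_cis mul1r.
Qed.

Lemma normc_four c f x : cintable mu f ->
  normc (four c f x) <= 2 * \int[mu]_y normc (f y).
Proof.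
move=> cf; rewrite (le_trans (normc_cint (cintable_four c x cf)))// ler_pM2l//.
by under eq_Rintegral do rewrite normcM normc_cis mul1r.
Qed.

Lemma cmeas_four c f : cintable mu f -> cmeas (four c f).
Proof.
move=> cf; have cmf := cintable_cmeas cf.
have cF : cmeas (fun p : E * E => cis (c * dot p.1 p.2) * f p.2).
  apply: cmeasM.
    by apply: cmeas_cis; apply: measurable_funM => //; exact: measurable_dot2.
  by case: cmf => f1 f2; split; [exact: measurableT_comp f1 measurable_snd
    |exact: measurableT_comp f2 measurable_snd].
case: cF => c1 c2; split.
  exact: (measurable_Rintegral_param mu c1).
exact: (measurable_Rintegral_param mu c2).
Qed.

(** The multiplication formula: Fubini, the kernel [cis (c * dot x y)] being symmetric in x and
    y. *)
Lemma four_swap c f g : cintable mu f -> cintable mu g ->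
  cint mu (fun x => f x * four c g x) = cint mu (fun y => four c f y * g y).
Proof.
move=> cf cg; have [[f1 f2] [g1 g2]] := (cintable_cmeas cf, cintable_cmeas cg).
pose F (p : E * E) := f p.1 * (cis (c * dot p.1 p.2) * g p.2).
have F1 x : cintable mu (fun y => F (x, y)).
  by rewrite /F /=; apply: cintableZl; exact: cintable_four.
have FE y x : F (x, y) = g y * (cis (c * dot y x) * f x).
  rewrite /F /= (dotC y x); ring.
have F2 y : cintable mu (fun x => F (x, y)).
  by under eq_fun do rewrite FE; apply: cintableZl; exact: cintable_four.
transitivity (cint mu (fun x => cint mu (fun y => F (x, y)))).
  by apply: eq_cint => x; rewrite /four -cintZl//; exact: cintable_four.
rewrite (@cint_swap _ _ _ _ _ mu mu F)//.
  apply: eq_cint => y; rewrite mulrC -cintZl//; last exact: cintable_four.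
  by apply: eq_cint => x; rewrite FE.
apply: (@cintable_le _ _ _ _ _ (fun p => normc (f p.1) * normc (g p.2))).
- apply: cmeasM.
    by split; [exact: measurableT_comp f1 measurable_fst|exact: measurableT_comp f2 measurable_fst].
  apply: cmeasM.
    by apply: cmeas_cis; apply: measurable_funM => //; exact: measurable_dot2.
  by split; [exact: measurableT_comp g1 measurable_snd|exact: measurableT_comp g2 measurable_snd].
- by move=> p; rewrite !normcM normc_cis mul1r.
- exact: (integrable_prod (cintable_normc cf) (cintable_normc cg)).
Qed.

End fourier_kernel.

(** * Gaussian summation, Bessel's inequality and Parseval's formula *)

Section limits_of_integrals.
Context d (T : measurableType d) (R : realType).
Variable m : {measure set T -> \bar R}.

(** Fatou's lemma, the lower limit being almost everywhere the limit. *)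
Lemma integral_le_of_cvg (f : nat -> T -> R) (g : T -> R) (K : \bar R) :
  (forall k, measurable_fun setT (f k)) -> measurable_fun setT g ->
  (forall k x, 0 <= f k x) -> (forall x, 0 <= g x) ->
  {ae m, forall x, f k x @[k --> \oo] --> g x} ->
  (forall k, \int[m]_x (f k x)%:E <= K)%E -> (\int[m]_x (g x)%:E <= K)%E.
Proof.
move=> mf mg f0 g0 fg fK.
have mf' k : measurable_fun setT (fun x => (f k x)%:E) by exact/measurable_EFinP.
have inf0 x : (0 <= limn_einf (fun k => (f k x)%:E))%E.
  rewrite limn_einf_lim; apply: lime_ge; first exact: is_cvg_einfs.
  by apply: nearW => k; apply: le_ereal_inf_tmp => _ [j _ <-]; rewrite lee_fin.
have mi : measurable_fun setT (fun x => limn_einf (fun k => (f k x)%:E)).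
  rewrite /limn_einf; apply: measurableT_comp => //.
  by apply: measurable_fun_limn_esup => k; apply: measurableT_comp.
rewrite (@ge0_ae_eq_integral _ _ _ m setT _ (fun x => limn_einf (fun k => (f k x)%:E)))//.
- apply: (le_trans (fatou m measurableT mf' _)).
    by move=> k x _; rewrite lee_fin.
  rewrite limn_einf_lim; apply: lime_le; first exact: is_cvg_einfs.
  apply: nearW => k; apply: le_trans (fK k); apply: ereal_inf_lbound.
  by exists k => //=.
- exact/measurable_EFinP.
- by move=> x _; rewrite lee_fin.
- apply: filterS fg => x fgx _.
  have h : ((f k x)%:E @[k --> \oo] --> (g x)%:E)%E by apply: cvg_EFin => //; exact: nearW.
  by rewrite is_cvg_limn_einfE; [exact/esym/cvg_lim|apply/cvg_ex; exists (g x)%:E].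
Qed.

Lemma Rintegral_vanish (u : nat -> T -> R) (g : T -> R) :
  (forall k, measurable_fun setT (u k)) -> (forall k x, 0 <= u k x <= 1) ->
  (forall x, u k x @[k --> \oo] --> (0 : R)) -> (forall x, 0 <= g x) ->
  m.-integrable setT (EFin \o g) ->
  \int[m]_x (u k x * g x) @[k --> \oo] --> (0 : R).
Proof.
move=> mu u01 u0 g0 ig; have /measurable_EFinP mg := measurable_int _ ig.
have muk k : measurable_fun setT (fun x => (u k x * g x)%:E).
  by apply/measurable_EFinP; exact: measurable_funM.
have m0 : measurable_fun setT (fun _ : T => (0 : R)%:E) by [].
have [||_ _ h] := @dominated_convergence _ _ _ m _ measurableT
    (fun k x => (u k x * g x)%:E) (fun=> 0%:E) (EFin \o g) muk m0 _ ig.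
- apply: aeW => x _; apply: cvg_EFin; first exact: nearW.
  rewrite -[X in _ --> X](mul0r (g x)); exact: cvgMl.
- apply: aeW => x k _ /=; rewrite lee_fin; have /andP[a b] := u01 k x.
  by rewrite ger0_norm ?mulr_ge0// ler_piMl.
by move: h; rewrite integral0 => /fine_cvg.
Qed.

Lemma cint_window (w : nat -> T -> R) (f : T -> R[i]) :
  (forall k, measurable_fun setT (w k)) -> (forall k x, 0 <= w k x <= 1) ->
  (forall x, w k x @[k --> \oo] --> (1 : R)) -> cintable m f ->
  normc (cint m (fun x => (w k x)%:C * f x) - cint m f) @[k --> \oo] --> (0 : R).
Proof.
move=> mw w01 w1 cf; have nf := cintable_normc cf.
have cwf k : cintable m (fun x => (w k x)%:C * f x).
  apply: cintable_le nf; first by apply: cmeasM; [exact: cmeas_real|exact: cintable_cmeas cf].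
  move=> x; have /andP[a b] := w01 k x.
  by rewrite normcM normc_real ger0_norm// ler_piMl ?normc_ge0.
have h : 2 * \int[m]_x ((1 - w k x) * normc (f x)) @[k --> \oo] --> (0 : R).
  rewrite -[X in _ --> X](mulr0 2); apply: cvgMr; apply: Rintegral_vanish => //.
  - by move=> k; exact: measurable_funB.
  - by move=> k x; have := w01 k x; rewrite subr_ge0 gerBl andbC.
  - by move=> x; rewrite -[X in _ --> X](subrr 1); apply: cvgB => //; exact: cvg_cst.
  - by move=> x; exact: normc_ge0.
apply: (@squeeze_cvgr _ _ _ _ (cst 0) _ _ _ _ _ h); last exact: cvg_cst.
apply: nearW => k; apply/andP; split; first exact: normc_ge0.
rewrite -cintB//.
rewrite (le_trans (normc_cint (cintableB _ _)))// ler_pM2l//.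
rewrite le_eqVlt; apply/orP; left; apply/eqP; apply: eq_Rintegral => x _.
rewrite -[in X in normc (_ - X)](mul1r (f x)) -mulrBl normcM -normcN opprB.
rewrite -(rmorphB (real_complex R) 1) normc_real ger0_norm// subr_ge0.
by case/andP : (w01 k x).
Qed.

End limits_of_integrals.

Section gaussian_window.
Context (R : realType) (n : nat).
Local Notation E := (euclidean R n).
Local Notation mu := (lebesgue_euclid R n).
Local Notation leb := (@lebesgue_measure R).
Implicit Types (f g : E -> R[i]) (c s : R) (x y z : E).

(** [gwin s x] is exp(-s^2 |x|^2 / 2), and [gker s x] is the Gaussian density of standard deviation
    s in each coordinate, centred at x. As s tends to 0 the window tends to 1 and the kernel
    concentrates at x; [cint_cis_gwin] relates them by Fourier transform. *)
Definition gwin s x : R := \prod_(i < n) expR (- ((s * tnth x i) ^+ 2 / 2)).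

Definition gker s x y : R := \prod_(i < n) normal_pdf (tnth x i) s (tnth y i).

Lemma gwin_gt0 s x : 0 < gwin s x.
Proof. by apply: prodr_gt0 => i _; exact: expR_gt0. Qed.

Lemma gwin_le1 s x : gwin s x <= 1.
Proof.
apply: prodr_ile1 => i _; rewrite expR_ge0/= -expR0 ler_expR oppr_le0.
by rewrite divr_ge0// sqr_ge0.
Qed.

Lemma gwin01 s x : 0 <= gwin s x <= 1.
Proof. by rewrite gwin_le1 andbT ltW// gwin_gt0. Qed.

Lemma gwin_normal s x : 0 < s -> gwin s x =
  \prod_(i < n) (Num.sqrt (pi *+ 2) / s * normal_pdf 0 s^-1 (tnth x i)).
Proof.
move=> s0; apply: eq_bigr => i _; rewrite normal_pdf_exp ?invr_gt0// subr0 invrK.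
rewrite (mulrC (tnth x i)) mulrA [X in X * expR _](_ : _ = 1) ?mul1r//.
by field; rewrite !gt_eqF ?sqrt2pi_gt0.
Qed.

Lemma measurable_gwin s : measurable_fun setT (gwin s).
Proof.
apply: measurable_prod => i _; apply: measurableT_comp => //.
apply: measurableT_comp => //; apply: measurable_funM => //.
apply: measurable_funX; apply: measurable_funM => //; exact: measurable_tnth.
Qed.

Lemma integrable_gwin s : 0 < s -> mu.-integrable setT (fun x => (gwin s x)%:E).
Proof.
move=> s0; under eq_fun do rewrite gwin_normal//.
apply: (@integrable_Rintegral_prod _ _ (fun i r => Num.sqrt (pi *+ 2) / s * normal_pdf 0 s^-1 r) _).1.
move=> i; exact: (integrableZl measurableT (Num.sqrt (pi *+ 2) / s) (integrable_normal_pdf 0 s^-1)).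
Qed.

Lemma gwin_cvg (s : nat -> R) x : s k @[k --> \oo] --> (0 : R) ->
  gwin (s k) x @[k --> \oo] --> (1 : R).
Proof.
move=> s0; rewrite /gwin.
rewrite -[X in _ --> X](_ : \prod_(i < n) 1 = _); last by rewrite big1.
suff : forall r : seq 'I_n, \prod_(i <- r) expR (- ((s k * tnth x i) ^+ 2 / 2)) @[k --> \oo] -->
    \prod_(i <- r) (1 : R) by apply.
elim=> [|i r IH].
  by rewrite big_nil; under eq_fun do rewrite big_nil; exact: cvg_cst.
rewrite big_cons; under eq_fun do rewrite big_cons.
apply: cvgM => //; rewrite -[X in _ --> X]expR0.
apply: continuous_cvg; first exact: continuous_expR.
rewrite -[X in _ --> X](_ : - ((0 * tnth x i) * (0 * tnth x i) / 2) = _); last first.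
  by rewrite !mul0r oppr0.
by apply: cvgN; apply: cvgMl; under eq_fun do rewrite expr2; apply: cvgM; exact: cvgMl.
Qed.

Lemma gkerC s x y : 0 < s -> gker s x y = gker s y x.
Proof. by move=> s0; apply: eq_bigr => i _; rewrite normal_pdf_sym. Qed.

Lemma gker_ge0 s x y : 0 <= gker s x y.
Proof. by apply: prodr_ge0 => i _; exact: normal_pdf_ge0. Qed.

Lemma gker_ub s x y : 0 < s -> gker s x y <= normal_peak s ^+ n.
Proof.
move=> s0; rewrite -[X in _ ^+ X]card_ord -prodr_const.
by apply: ler_prod => i _; rewrite normal_pdf_ge0 normal_pdf_ub// gt_eqF.
Qed.

Lemma integrable_gker s x : mu.-integrable setT (fun y => (gker s x y)%:E).
Proof.
apply: (@integrable_Rintegral_prod _ _ (fun i => normal_pdf (tnth x i) s) _).1 => i.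
exact: integrable_normal_pdf.
Qed.

Lemma Rintegral_gker s x : \int[mu]_y gker s x y = 1.
Proof.
rewrite (@integrable_Rintegral_prod _ _ (fun i => normal_pdf (tnth x i) s) _).2.
  by rewrite big1// => i _; rewrite /Rintegral integral_normal_pdf.
by move=> i; exact: integrable_normal_pdf.
Qed.

Lemma measurable_gker2 s : 0 < s -> measurable_fun setT (fun p : E * E => gker s p.1 p.2).
Proof.
move=> s0; apply: measurable_prod => i _.
rewrite (_ : (fun _ => _) = (fun p : E * E => normal_pdf 0 s (tnth p.2 i - tnth p.1 i))).
  apply: (measurableT_comp (measurable_normal_pdf 0 s)); apply: measurable_funB.
    exact: measurableT_comp (measurable_tnth i) measurable_snd.
  exact: measurableT_comp (measurable_tnth i) measurable_fst.
by apply/funext => p; rewrite normal_pdf_center.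
Qed.

Lemma measurable_gker s x : measurable_fun setT (gker s x).
Proof.
by have /measurable_EFinP := measurable_int _ (integrable_gker s x).
Qed.

(** Coordinate j contributes [2 * s] by [normal_pdf_moment_wider], and each other coordinate a 2 by
    [normal_pdf_wider]. *)
Lemma gker_moment_wider s x y (j : 'I_n) : 0 < s ->
  `|tnth y j - tnth x j| * gker s x y <= 2 ^+ n * s * gker (2 * s) x y.
Proof.
move=> s0; rewrite /gker (bigD1 j)//= [in leRHS](bigD1 j)//= mulrA.
have -> : 2 ^+ n = 2 * \prod_(i < n | i != j) 2 :> R.
  by rewrite -(bigD1 j (P := xpredT) (F := fun=> 2))//= prodr_const card_ord.
rewrite (_ : 2 * _ * s * _ = (2 * s * normal_pdf (tnth x j) (2 * s) (tnth y j)) *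
  \prod_(i < n | i != j) (2 * normal_pdf (tnth x i) (2 * s) (tnth y i))); last first.
  by rewrite big_split/=; ring.
apply: ler_pM; rewrite ?mulr_ge0 ?normal_pdf_ge0//.
- by apply: prodr_ge0 => i _; exact: normal_pdf_ge0.
- exact: normal_pdf_moment_wider.
- by apply: ler_prod => i _; rewrite normal_pdf_ge0 normal_pdf_wider.
Qed.

(** In each coordinate, the characteristic function of the density of width 1/s is evaluated at
    c(y_i - z_i). Its prefactor sqrt(2 pi)/s is 2 pi times the normalisation 1/(s sqrt(2 pi)) of the
    density of width s. The condition on c covers the transform and its inverse together. *)
Lemma cint_cis_gwin c s y z : 0 < s -> c ^+ 2 = 1 ->
  cint mu (fun x => cis (c * dot y x) * (cis (- c * dot z x) * (gwin s x)%:C)) =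
  ((pi *+ 2) ^+ n * gker s y z)%:C.
Proof.
move=> s0 c1.
pose w (i : 'I_n) r : R[i] := (Num.sqrt (pi *+ 2) / s)%:C *
  (cis (c * (tnth y i - tnth z i) * r) * (normal_pdf 0 s^-1 r)%:C).
have iw i : cintable leb (fun r => cis (c * (tnth y i - tnth z i) * r) * (normal_pdf 0 s^-1 r)%:C).
  apply: (cintable_le _ _ (integrable_normal_pdf 0 s^-1)).
    apply: cmeasM; last by apply: cmeas_real; exact: measurable_normal_pdf.
    by apply: cmeas_cis; apply: measurable_funM.
  by move=> r; rewrite normcM normc_cis mul1r normc_real ger0_norm// normal_pdf_ge0.
have iw' i : cintable leb (w i) by apply: cintableZl; exact: iw.
transitivity (cint mu (fun x => \prod_(i < n) w i (tnth x i))).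
  apply: eq_cint => x; rewrite gwin_normal// rmorph_prod mulrA -cisD.
  rewrite [X in cis X](_ : _ = \sum_(i < n) c * (tnth y i - tnth z i) * tnth x i).
    rewrite cis_sum -big_split/=; apply: eq_bigr => i _.
    by rewrite /w rmorphM/= mulrCA.
  rewrite /dot !mulr_sumr -big_split/=; apply: eq_bigr => i _; ring.
rewrite (cintable_cint_prod iw').2 -[X in _ ^+ X]card_ord -prodr_const.
rewrite /gker -big_split/= rmorph_prod; apply: eq_bigr => i _.
rewrite cintZl// cint_cis_normal ?invr_gt0// mulr0 cis0 mul1r -rmorphM; congr (_%:C).
rewrite normal_pdf_exp// -mulr_natr.
rewrite (_ : (s^-1 * _) ^+ 2 = ((tnth z i - tnth y i) / s) ^+ 2); last first.
  rewrite !exprMn c1; ring.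
rewrite mulrA; congr (_ * _).
have h : Num.sqrt (pi *+ 2) ^+ 2 = (pi *+ 2 : R) by rewrite sqr_sqrtr// pmulrn_lge0// pi_ge0.
rewrite [RHS](_ : _ = Num.sqrt (pi *+ 2) ^+ 2 / (s * Num.sqrt (pi *+ 2))); last by rewrite h.
by field; rewrite !gt_eqF ?sqrt2pi_gt0.
Qed.

Lemma cintable_gwinM_bounded s f M : 0 < s -> cmeas f -> (forall x, normc (f x) <= M) ->
  cintable mu (fun x => (gwin s x)%:C * f x).
Proof.
move=> s0 cf fM; have i := integrableZl measurableT M (integrable_gwin s0).
apply: (@cintable_le _ _ _ _ _ (fun x => M * gwin s x) _ _ i).
  by apply: cmeasM => //; apply: cmeas_real; exact: measurable_gwin.
by move=> x; rewrite normcM normc_real gtr0_norm ?gwin_gt0// mulrC ler_pM2r ?gwin_gt0.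
Qed.

Lemma cintable_gker s x f : 0 < s -> cintable mu f ->
  cintable mu (fun y => (gker s x y)%:C * f y).
Proof.
move=> s0 cf; have i := integrableZl measurableT (normal_peak s ^+ n) (cintable_normc cf).
apply: (@cintable_le _ _ _ _ _ (fun x => normal_peak s ^+ n * normc (f x)) _ _ i).
  by apply: cmeasM; [apply: cmeas_real; exact: measurable_gker|exact: cintable_cmeas cf].
move=> y; rewrite normcM normc_real ger0_norm ?gker_ge0// ler_wpM2r ?normc_ge0//.
exact: gker_ub.
Qed.

Definition gconv s f x : R[i] := cint mu (fun y => (gker s x y)%:C * f y).

(** Parseval's formula damped by a Gaussian. Two uses of the multiplication formula move both
    transforms onto the window, where [cint_cis_gwin] evaluates them. *)
Lemma cint_gwin_four c s f g : 0 < s -> c ^+ 2 = 1 -> cintable mu f -> cintable mu g ->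
  cint mu (fun x => (gwin s x)%:C * (four c f x * four (- c) g x)) =
  ((pi *+ 2) ^+ n)%:C * cint mu (fun y => f y * gconv s g y).
Proof.
move=> s0 c1 cf cg.
have cg4 : cintable mu (fun x => (gwin s x)%:C * four (- c) g x).
  apply: (cintable_gwinM_bounded s0 (cmeas_four _ cg)) => x; exact: normc_four.
transitivity (cint mu (fun x => (gwin s x)%:C * four (- c) g x * four c f x)).
  by apply: eq_cint => x; rewrite -mulrA [four c f x * _]mulrC.
rewrite four_swap//.
have key y : four c (fun x => (gwin s x)%:C * four (- c) g x) y = ((pi *+ 2) ^+ n)%:C * gconv s g y.
  pose B x := cis (c * dot y x) * (gwin s x)%:C.
  have cB : cintable mu B.
    apply: (cintable_le _ _ (integrable_gwin s0)).
      by apply: cmeasM; [exact: cmeas_cis_dot|apply: cmeas_real; exact: measurable_gwin].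
    by move=> x; rewrite normcM normc_cis mul1r normc_real gtr0_norm ?gwin_gt0.
  transitivity (cint mu (fun x => B x * four (- c) g x)).
    by apply: eq_cint => x; rewrite mulrA.
  rewrite four_swap// -cintZl; last exact: cintable_gker.
  have e z : four (- c) B z = ((pi *+ 2) ^+ n)%:C * (gker s y z)%:C.
    transitivity (((pi *+ 2) ^+ n * gker s y z)%:C); last by rewrite rmorphM.
    by rewrite -(cint_cis_gwin y z s0 c1); apply: eq_cint => x; rewrite /B mulrCA.
  by apply: eq_cint => z; rewrite e mulrA.
rewrite -cintZl.
  by apply: eq_cint => y; rewrite key -mulrA; congr (_ * _); exact: mulrC.
(* Integrability of [f * gconv s g] is read off from [key]: up to the constant (2 pi)^n, it is f
   times a bounded Fourier integral. *)
have ci : cintable mu (fun y => four c (fun x => (gwin s x)%:C * four (- c) g x) y * f y).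
  have i := integrableZl measurableT (2 * \int[mu]_y normc ((gwin s y)%:C * four (- c) g y)) (cintable_normc cf).
  apply: (@cintable_le _ _ _ _ _ (fun x => 2 * \int[mu]_y normc ((gwin s y)%:C * four (- c) g y) * normc (f x)) _ _ i).
    by apply: cmeasM; [exact: cmeas_four|exact: cintable_cmeas cf].
  by move=> x; rewrite normcM ler_wpM2r ?normc_ge0// normc_four.
have p0 : ((pi *+ 2) ^+ n : R) != 0 by rewrite expf_neq0// gt_eqF// pmulrn_lgt0// pi_gt0.
have p0C : ((pi *+ 2) ^+ n : R)%:C != 0 by apply: contra p0 => /eqP/complexI ->.
apply: eq_cintable (cintableZl (((pi *+ 2) ^+ n)%:C)^-1 ci) => y.
by rewrite key mulrA mulKf// mulrC.
Qed.

Lemma four_conj c f x : cintable mu f ->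
  four (- c) (fun y => (f y)^*) x = (four c f x)^*.
Proof.
move=> cf; rewrite /four -cint_conj; last exact: cintable_four.
by apply: eq_cint => y; rewrite conjcM cis_conj mulNr.
Qed.

Lemma integral_gkerM s x (a : R) : 0 <= a ->
  (\int[mu]_y (gker s x y * a)%:E = a%:E)%E.
Proof.
move=> a0; have i := integrable_gker s x.
rewrite -EFin_Rintegral; first by rewrite RintegralZr// Rintegral_gker mul1r.
exact: (integrableZr measurableT a i).
Qed.

(* The optimal constant is (2 pi)^n; the factor 4 comes from the crude bound
   normc_cint. *)
Lemma four_L2_le c f : c ^+ 2 = 1 -> cintable mu f ->
  mu.-integrable setT (fun x => (normc (f x) ^+ 2)%:E) ->
  (\int[mu]_x (normc (four c f x) ^+ 2)%:E <=
   (4 * (pi *+ 2) ^+ n)%:E * \int[mu]_x (normc (f x) ^+ 2)%:E)%E.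
Proof.
move=> c1 cf f2.
have nf := cintable_normc cf.
have /measurable_EFinP mnf := measurable_int _ nf.
have mF : measurable_fun setT (fun x => normc (four c f x) ^+ 2).
  by apply: measurable_funX; apply: cmeas_normc; exact: cmeas_four.
pose P : R := (pi *+ 2) ^+ n.
have P0 : 0 <= P by rewrite exprn_ge0// mulrn_wge0// pi_ge0.
pose s k : R := k.+1%:R^-1.
have s0 k : 0 < s k by rewrite invr_gt0.
apply: (@integral_le_of_cvg _ _ _ _ (fun k x => gwin (s k) x * normc (four c f x) ^+ 2)) => //.
- by move=> k; apply: measurable_funM => //; exact: measurable_gwin.
- by move=> k x; rewrite mulr_ge0 ?sqr_ge0// ltW// gwin_gt0.
- by move=> x; exact: sqr_ge0.
- apply: aeW => x; rewrite -[X in _ --> X]mul1r; apply: cvgMl.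
  apply: gwin_cvg; exact: cvg_harmonic.
move=> k.
have iw : mu.-integrable setT (fun x => (gwin (s k) x * normc (four c f x) ^+ 2)%:E).
  pose M := 2 * \int[mu]_y normc (f y).
  have M0 : 0 <= M by rewrite mulr_ge0// Rintegral_ge0// => x _; exact: normc_ge0.
  apply: (@integrable_le _ _ _ mu _ (fun x => M ^+ 2 * gwin (s k) x)).
  - by apply: measurable_funM => //; exact: measurable_gwin.
  - move=> x; rewrite ger0_norm; last by apply: mulr_ge0; [exact/ltW/gwin_gt0|exact: sqr_ge0].
    rewrite mulrC ler_pM2r ?gwin_gt0//; have h := normc_four c x cf.
    by apply: lerXn2r => //; rewrite nnegrE; exact: normc_ge0.
  - exact: (integrableZl measurableT (M ^+ 2) (integrable_gwin (s0 k))).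
pose G y := gconv (s k) (fun z => (f z)^*) y.
(* The damped Parseval formula with g the conjugate of f: the product of the two transforms is then
   |four c f|^2. *)
have AE : (\int[mu]_x (gwin (s k) x * normc (four c f x) ^+ 2))%:C =
    P%:C * cint mu (fun y => f y * G y).
  rewrite -(cint_gwin_four (s0 k) c1 cf (cintable_conj cf)).
  rewrite -cint_real; apply: eq_cint => x.
  by rewrite four_conj// mulc_conj rmorphM.
have ig y := cintable_gker y (s0 k) (cintable_conj cf).
have nG y : normc (G y) <= 2 * \int[mu]_z (gker (s k) y z * normc (f z)).
  rewrite (le_trans (normc_cint (ig y)))// ler_pM2l//.
  rewrite le_eqVlt; apply/orP; left; apply/eqP; apply: eq_Rintegral => z _.
  by rewrite normcM normc_real ger0_norm ?gker_ge0// normc_conj.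
have igk y : mu.-integrable setT (fun z => (gker (s k) y z * normc (f z))%:E).
  apply: eq_Rintegrable (cintable_normc (ig y)) => z.
  by rewrite normcM normc_real ger0_norm ?gker_ge0// normc_conj.
have nG0 y : 0 <= \int[mu]_z (gker (s k) y z * normc (f z)).
  by apply: Rintegral_ge0 => z _; rewrite mulr_ge0 ?gker_ge0 ?normc_ge0.
have mG : measurable_fun setT (fun y => \int[mu]_z (gker (s k) y z * normc (f z))).
  apply: (@measurable_Rintegral_param _ _ _ _ _ mu (fun p => gker (s k) p.1 p.2 * normc (f p.2))).
  apply: measurable_funM; first exact: measurable_gker2.
  exact: measurableT_comp mnf measurable_snd.
have cG : cmeas G.
  split.
    apply: (@measurable_Rintegral_param _ _ _ _ _ mu (fun p => Re ((gker (s k) p.1 p.2)%:C * (f p.2)^*))).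
    have [] : cmeas (fun p : E * E => (gker (s k) p.1 p.2)%:C * (f p.2)^*).
      apply: cmeasM; first by apply: cmeas_real; exact: measurable_gker2.
      apply: cmeas_conj; have [f1' f2'] := cintable_cmeas cf; split.
        exact: measurableT_comp f1' measurable_snd.
      exact: measurableT_comp f2' measurable_snd.
    by [].
  apply: (@measurable_Rintegral_param _ _ _ _ _ mu (fun p => Im ((gker (s k) p.1 p.2)%:C * (f p.2)^*))).
  have [] : cmeas (fun p : E * E => (gker (s k) p.1 p.2)%:C * (f p.2)^*).
    apply: cmeasM; first by apply: cmeas_real; exact: measurable_gker2.
    apply: cmeas_conj; have [f1' f2'] := cintable_cmeas cf; split.
      exact: measurableT_comp f1' measurable_snd.
    exact: measurableT_comp f2' measurable_snd.
  by [].
have mgk2 : measurable_fun setT (fun p : E * E => gker (s k) p.1 p.2).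
  exact: measurable_gker2.
have mf2 : measurable_fun setT (fun x => normc (f x) ^+ 2) by exact: measurable_funX.
(* Schur's test: AM-GM on |f y| |f z|, the kernel having mass 1 in either variable *)
have schur : (\int[mu]_y (normc (f y) * \int[mu]_z (gker (s k) y z * normc (f z)))%:E <=
    \int[mu]_x (normc (f x) ^+ 2)%:E)%E.
  apply: (@le_trans _ _ (\int[mu]_y \int[mu]_z (gker (s k) y z * ((normc (f y) ^+ 2 + normc (f z) ^+ 2) / 2))%:E)%E).
    apply: ge0_le_integral => //.
    - by move=> y _; rewrite lee_fin mulr_ge0 ?normc_ge0.
    - by apply/measurable_EFinP; exact: measurable_funM.
    - apply: (measurable_fun_fubini_tonelli_F (m2 := mu)
        (fun p : E * E => (gker (s k) p.1 p.2 * ((normc (f p.1) ^+ 2 + normc (f p.2) ^+ 2) / 2))%:E)).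
        apply/measurable_EFinP; apply: measurable_funM => //; apply: measurable_funM => //.
        apply: measurable_funD.
          exact: measurableT_comp mf2 measurable_fst.
        exact: measurableT_comp mf2 measurable_snd.
      move=> p; rewrite lee_fin mulr_ge0 ?gker_ge0// divr_ge0// addr_ge0 ?sqr_ge0//.
    - move=> y _; rewrite -RintegralZl//; last exact: igk.
      rewrite (EFin_Rintegral (r := fun z => normc (f y) * (gker (s k) y z * normc (f z)))); last first.
        exact: (integrableZl measurableT (normc (f y)) (igk y)).
      apply: ge0_le_integral => //.
      + by move=> z _; rewrite lee_fin mulr_ge0 ?normc_ge0// mulr_ge0 ?gker_ge0 ?normc_ge0.
      + apply/measurable_EFinP; apply: measurable_funM => //.
        by apply: measurable_funM => //; exact: measurable_gker.
      + apply/measurable_EFinP; apply: measurable_funM; first exact: measurable_gker.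
        by apply: measurable_funM => //; exact: measurable_funD.
      + move=> z _; rewrite lee_fin mulrCA ler_wpM2l ?gker_ge0//.
        have := sqr_ge0 (normc (f y) - normc (f z)); nra.
  pose A y := normc (f y) ^+ 2 / 2.
  have A0 y : 0 <= A y by rewrite divr_ge0// sqr_ge0.
  have mA : measurable_fun setT A by exact: measurable_funM.
  have mgA y : measurable_fun setT (fun z => (gker (s k) y z * A z)%:E).
    by apply/measurable_EFinP; apply: measurable_funM => //; exact: measurable_gker.
  have mgA2 : measurable_fun setT (fun p : E * E => (gker (s k) p.1 p.2 * A p.2)%:E).
    apply/measurable_EFinP; apply: measurable_funM => //.
    exact: measurableT_comp mA measurable_snd.
  have gA0 p : (0 <= (gker (s k) p.1 p.2 * A p.2)%:E)%E.
    by rewrite lee_fin mulr_ge0 ?gker_ge0.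
  rewrite (_ : (\int[mu]_y _ = \int[mu]_y ((A y)%:E + \int[mu]_z (gker (s k) y z * A z)%:E))%E); last first.
    apply: eq_integral => y _; rewrite -(integral_gkerM (s k) y (A0 y)) -ge0_integralD//.
    - by apply: eq_integral => z _; rewrite -EFinD -mulrDr; congr ((_ * _)%:E); rewrite /A mulrDl.
    - by move=> z _; rewrite lee_fin mulr_ge0 ?gker_ge0.
    - by apply/measurable_EFinP; apply: measurable_funM => //; exact: measurable_gker.
    - by move=> z _; rewrite lee_fin mulr_ge0 ?gker_ge0.
  rewrite ge0_integralD//; last 4 first.
  - by move=> y _; rewrite lee_fin.
  - exact/measurable_EFinP.
  - by move=> y _; apply: integral_ge0 => z _; rewrite lee_fin mulr_ge0 ?gker_ge0.
  - exact: (measurable_fun_fubini_tonelli_F (m2 := mu) _ mgA2 gA0).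
  rewrite (fubini_tonelli _ mgA2 gA0)/=.
  have -> : (\int[mu]_z \int[mu]_y (gker (s k) y z * A z)%:E = \int[mu]_z (A z)%:E)%E.
    apply: eq_integral => z _; rewrite -[RHS](integral_gkerM (s k) z (A0 z)).
    by apply: eq_integral => y _; rewrite gkerC.
  rewrite -ge0_integralD//; last 4 first.
  - by move=> y _; rewrite lee_fin.
  - exact/measurable_EFinP.
  - by move=> y _; rewrite lee_fin.
  - exact/measurable_EFinP.
  rewrite le_eqVlt; apply/orP; left; apply/eqP; apply: eq_integral => y _.
  by rewrite -EFinD; congr (_%:E); rewrite /A -splitr.
have iX : mu.-integrable setT
    (fun y => (normc (f y) * \int[mu]_z (gker (s k) y z * normc (f z)))%:E).
  apply/integrableP; split; first by apply/measurable_EFinP; exact: measurable_funM.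
  under eq_integral do rewrite /= ger0_norm ?mulr_ge0 ?normc_ge0//.
  apply: (le_lt_trans schur); move/integrableP : f2 => [_].
  by under eq_integral do rewrite /= ger0_norm ?sqr_ge0//.
have cfG : cintable mu (fun y => f y * G y).
  apply: (@cintable_le _ _ _ mu _ (fun y => 2 * (normc (f y) * \int[mu]_z (gker (s k) y z * normc (f z))))).
  - by apply: cmeasM => //; exact: cintable_cmeas cf.
  - by move=> y; rewrite normcM mulrCA ler_wpM2l ?normc_ge0.
  - exact: (integrableZl measurableT 2 iX).
have -> : (\int[mu]_x (gwin (s k) x * normc (four c f x) ^+ 2)%:E =
    (P * normc (cint mu (fun y => f y * G y)))%:E)%E.
  rewrite -EFin_Rintegral//; congr (_%:E).
  rewrite -[P in RHS]ger0_norm// -normc_real -normcM -AE normc_real ger0_norm//.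
  by apply: Rintegral_ge0 => x _; rewrite mulr_ge0 ?sqr_ge0// ltW// gwin_gt0.
apply: (@le_trans _ _ ((4 * P)%:E * (\int[mu]_y (normc (f y) * \int[mu]_z (gker (s k) y z * normc (f z)))%:E))%E).
  rewrite -EFin_Rintegral// -EFinM lee_fin mulrAC [leRHS]mulrC ler_wpM2l//.
  rewrite (le_trans (normc_cint cfG))// (_ : 4 = 2 * 2) -?mulrA ?ler_pM2l//; last by rewrite -natrM.
  rewrite -RintegralZl//; apply: le_Rintegral => //.
  - exact: cintable_normc.
  - exact: (integrableZl measurableT 2 iX).
  - by move=> y _; rewrite normcM mulrCA ler_wpM2l ?normc_ge0.
by apply: lee_wpmul2l => //; rewrite lee_fin mulr_ge0.
Qed.

(** The kernel has mass 1, so the difference is the average of f z - f y. The Lipschitz bound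
    reduces it to n first moments, each at most 2^n s by [gker_moment_wider]. *)
Lemma gconv_lipschitz s f L : 0 < s -> cintable mu f -> 0 <= L ->
  (forall x y, normc (f x - f y) <= L * \sum_(i < n) `|tnth x i - tnth y i|) ->
  forall y, normc (gconv s f y - f y) <= 2 * (L * n%:R * 2 ^+ n) * s.
Proof.
move=> s0 cf L0 Lf y.
have ic : cintable mu (fun z => (gker s y z)%:C * f y).
  have i := integrableZl measurableT (normc (f y)) (integrable_gker s y).
  apply: (cintable_le _ _ i).
    by apply: cmeasM; [apply: cmeas_real; exact: measurable_gker|exact: cmeas_cst].
  by move=> z; rewrite normcM normc_real ger0_norm ?gker_ge0// mulrC.
have -> : f y = cint mu (fun z => (gker s y z)%:C * f y).
  transitivity (cint mu (fun z => f y * (gker s y z)%:C)); last first.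
    by apply: eq_cint => z; rewrite mulrC.
  rewrite cintZl; first by rewrite cint_real Rintegral_gker mulr1.
  split => /=; [exact: integrable_gker|exact: integrable0].
have iB : mu.-integrable setT (fun z => (L * n%:R * (2 ^+ n * s * gker (2 * s) y z))%:E).
  have := integrable_gker (2 * s) y.
  move=> /(integrableZl measurableT (2 ^+ n * s)) /(integrableZl measurableT (L * n%:R)).
  by apply: eq_integrable => // z _; rewrite -!EFinM.
have iD := cintableB (cintable_gker y s0 cf) ic.
rewrite -cintB//; last exact: cintable_gker.
rewrite (le_trans (normc_cint iD))// -!mulrA ler_pM2l//.
apply: (@le_trans _ _ (\int[mu]_z (L * n%:R * (2 ^+ n * s * gker (2 * s) y z)))).
  apply: le_Rintegral => //; first exact: cintable_normc.
  move=> z _; rewrite -mulrBr normcM normc_real ger0_norm ?gker_ge0//.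
  apply: (@le_trans _ _ (gker s y z * (L * \sum_(i < n) `|tnth z i - tnth y i|))).
    by rewrite ler_wpM2l ?gker_ge0.
  rewrite mulrCA -mulrA.
  rewrite ler_wpM2l// mulr_sumr mulr_natl -[X in _ *+ X]card_ord -sumr_const.
  by apply: ler_sum => i _; rewrite mulrC gker_moment_wider.
rewrite !RintegralZl//; last 2 first.
- exact: integrable_gker.
- by have := integrableZl measurableT (2 ^+ n * s) (integrable_gker (2 * s) y).
by rewrite Rintegral_gker mulr1 !mulrA.
Qed.

Lemma cintableM_bounded f g M : cintable mu f -> cmeas g -> (forall x, normc (g x) <= M) ->
  cintable mu (fun x => f x * g x).
Proof.
move=> cf cg gM; have i := integrableZl measurableT M (cintable_normc cf).
apply: (@cintable_le _ _ _ mu _ (fun x => M * normc (f x)) _ _ i).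
  by apply: cmeasM => //; exact: cintable_cmeas cf.
by move=> x; rewrite normcM mulrC ler_wpM2r ?normc_ge0.
Qed.

(** By the damped Parseval formula only [gconv s g - g] has to be estimated, and for a Lipschitz g
    it is O(s) uniformly. *)
Lemma cint_gwin_four_cvg c f g L M : c ^+ 2 = 1 -> cintable mu f -> cintable mu g -> 0 <= L ->
  (forall x y, normc (g x - g y) <= L * \sum_(i < n) `|tnth x i - tnth y i|) ->
  (forall x, normc (g x) <= M) ->
  normc (cint mu (fun x => (gwin k.+1%:R^-1 x)%:C * (four c f x * four (- c) g x)) -
    ((pi *+ 2) ^+ n)%:C * cint mu (fun y => f y * g y)) @[k --> \oo] --> (0 : R).
Proof.
move=> c1 cf cg L0 gL gM.
pose P : R := (pi *+ 2) ^+ n.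
pose K := 2 * (L * n%:R * 2 ^+ n).
have K0 : 0 <= K by rewrite !mulr_ge0// exprn_ge0.
have cfg : cintable mu (fun y => f y * g y).
  exact: (cintableM_bounded cf (cintable_cmeas cg) gM).
pose B := normc P%:C * (2 * (K * \int[mu]_y normc (f y))).
apply: (@squeeze_cvgr _ _ _ _ (cst 0) (fun k => B * harmonic k)).
- apply: nearW => k; apply/andP; split; first exact: normc_ge0.
  have s0 : (0 : R) < k.+1%:R^-1 by rewrite invr_gt0.
  have cfG : cintable mu (fun y => f y * gconv k.+1%:R^-1 g y).
    have ch := cintable_gker _ s0 cg.
    apply: (cintableM_bounded (M := normal_peak k.+1%:R^-1 ^+ n * (2 * \int[mu]_y normc (g y))) cf).
      have [g1 g2] := cintable_cmeas cg.
      have [m1 m2] : cmeas (fun p : E * E => (gker k.+1%:R^-1 p.1 p.2)%:C * g p.2).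
        apply: cmeasM; first by apply: cmeas_real; exact: measurable_gker2.
        split; first exact: measurableT_comp g1 measurable_snd.
        exact: measurableT_comp g2 measurable_snd.
      split; first exact: (measurable_Rintegral_param mu m1).
      exact: (measurable_Rintegral_param mu m2).
    move=> y; rewrite (le_trans (normc_cint (ch y)))// mulrCA ler_pM2l//.
    rewrite -RintegralZl//; last exact: cintable_normc.
    apply: le_Rintegral => //; first exact: cintable_normc.
      exact: (integrableZl measurableT (normal_peak k.+1%:R^-1 ^+ n) (cintable_normc cg)).
    move=> z _; rewrite normcM normc_real ger0_norm ?gker_ge0// ler_wpM2r ?normc_ge0//.
    exact: gker_ub.
  rewrite cint_gwin_four// -mulrBr normcM -/P /B -mulrA ler_wpM2l ?normc_ge0//.
  rewrite -cintB//; have iD := cintableB cfG cfg.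
  rewrite (le_trans (normc_cint iD))// -mulrA ler_pM2l// mulrAC.
  rewrite -RintegralZl//; last exact: cintable_normc.
  apply: le_Rintegral => //; first exact: cintable_normc.
    exact: (integrableZl measurableT (K * harmonic k) (cintable_normc cf)).
  move=> y _; rewrite -mulrBr normcM mulrC ler_wpM2r ?normc_ge0//.
  exact: gconv_lipschitz.
- exact: cvg_cst.
- rewrite -[X in _ --> X](mulr0 B); apply: cvgMr; exact: cvg_harmonic.
Qed.

(** Convergence in R[i] is expressed in R, through [normc] of differences; the topology of R[i]
    enters at the end, by [cvg_complex]. *)
Lemma normc_cvg_unique (u : nat -> R[i]) (a b : R[i]) :
  normc (u k - a) @[k --> \oo] --> (0 : R) -> normc (u k - b) @[k --> \oo] --> (0 : R) -> a = b.
Proof.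
move=> ua ub; apply/eqP; rewrite -subr_eq0; apply/eqP; apply: eq0_normc.
apply/eqP; rewrite eq_le normc_ge0 andbT.
have h : normc (u k - b) + normc (u k - a) @[k --> \oo] --> (0 : R).
  by rewrite -[X in _ --> X](addr0 0); exact: cvgD.
rewrite -(cvg_lim _ h)//; apply: limr_ge; first by apply/cvg_ex; exists 0.
apply: nearW => k; rewrite (_ : a - b = (u k - b) + - (u k - a)); last by ring.
by rewrite (le_trans (le_normcD _ _))// normcN.
Qed.

(** Both sides are limits of the damped integrals: the left one by domination, since [four_L2_le]
    makes the product of the transforms integrable, the right one by [cint_gwin_four_cvg]. *)
Lemma cint_four_mul c f g L M : c ^+ 2 = 1 -> cintable mu f -> cintable mu g ->
  mu.-integrable setT (fun x => (normc (f x) ^+ 2)%:E) ->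
  mu.-integrable setT (fun x => (normc (g x) ^+ 2)%:E) -> 0 <= L ->
  (forall x y, normc (g x - g y) <= L * \sum_(i < n) `|tnth x i - tnth y i|) ->
  (forall x, normc (g x) <= M) ->
  cint mu (fun x => four c f x * four (- c) g x) =
    ((pi *+ 2) ^+ n)%:C * cint mu (fun y => f y * g y).
Proof.
move=> c1 cf cg f2 g2 L0 gL gM.
have sq F c' : c' ^+ 2 = 1 -> cintable mu F -> mu.-integrable setT (fun x => (normc (F x) ^+ 2)%:E) ->
    mu.-integrable setT (fun x => (normc (four c' F x) ^+ 2)%:E).
  move=> c1' cF F2; apply/integrableP; split.
    by apply/measurable_EFinP/measurable_funX; apply: cmeas_normc; exact: cmeas_four.
  under eq_integral do rewrite /= ger0_norm ?sqr_ge0//.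
  apply: (le_lt_trans (four_L2_le c1' cF F2)).
  apply: lte_mul_pinfty => //.
    by rewrite lee_fin mulr_ge0// exprn_ge0// mulrn_wge0// pi_ge0.
  move/integrableP : F2 => [_].
  by under eq_integral do rewrite /= ger0_norm ?sqr_ge0//.
have c1' : (- c) ^+ 2 = 1 by rewrite sqrrN.
have cF : cintable mu (fun x => four c f x * four (- c) g x).
  have := integrableD measurableT (sq _ _ c1 cf f2) (sq _ _ c1' cg g2).
  apply: cintable_le; first by apply: cmeasM; exact: cmeas_four.
  move=> x; rewrite normcM.
  have := sqr_ge0 (normc (four c f x) - normc (four (- c) g x)).
  have := sqr_ge0 (normc (four c f x) + normc (four (- c) g x)).
  nra.
apply: (@normc_cvg_unique (fun k => cint mu (fun x => (gwin k.+1%:R^-1 x)%:C * (four c f x * four (- c) g x)))).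
  apply: (cint_window (w := fun k x => gwin k.+1%:R^-1 x)) => //.
  - by move=> k; exact: measurable_gwin.
  - by move=> k x; exact: gwin01.
  - by move=> x; apply: gwin_cvg; exact: cvg_harmonic.
exact: (cint_gwin_four_cvg (L := L) (M := M)).
Qed.

(** Here f is only integrable. The damped integrals vanish identically, and [cint_gwin_four_cvg]
    identifies their limit. *)
Lemma cint_eq0_four c f g L M : c ^+ 2 = 1 -> cintable mu f -> cintable mu g ->
  (forall x, four c f x = 0) -> 0 <= L ->
  (forall x y, normc (g x - g y) <= L * \sum_(i < n) `|tnth x i - tnth y i|) ->
  (forall x, normc (g x) <= M) ->
  cint mu (fun y => f y * g y) = 0.
Proof.
move=> c1 cf cg f0 L0 gL gM.
have p0 : ((pi *+ 2) ^+ n : R) != 0 by rewrite expf_neq0// gt_eqF// pmulrn_lgt0// pi_gt0.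
have p0C : ((pi *+ 2) ^+ n : R)%:C != 0 by apply: contra p0 => /eqP/complexI ->.
apply: (mulfI p0C); rewrite mulr0; symmetry.
have h := cint_gwin_four_cvg c1 cf cg L0 gL gM.
apply: (normc_cvg_unique _ h).
apply: cvg_near_cst; apply: nearW => k.
rewrite (_ : (fun x => _) = fun=> 0); last by apply/funext => x; rewrite f0 mul0r mulr0.
by rewrite (cint_real mu (fun=> 0)) Rintegral_cst// mul0r subr0 normc0.
Qed.

End gaussian_window.

(** * Uniqueness for the Fourier transform *)

Section density_measure.
Context d (T : measurableType d) (R : realType) (m : {measure set T -> \bar R}).
Variables (f : T -> \bar R) (mf : measurable_fun setT f) (f0 : forall x, (0 <= f x)%E).

(** The measurability and positivity proofs are arguments so that the measure instance can be
    recovered from the term itself. *)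
Definition density_measure of measurable_fun setT f & (forall x, (0 <= f x)%E) :=
  fun A : set T => (\int[m]_(x in A) f x)%E.

Local Notation nu := (density_measure mf f0).

Let nu0 : nu set0 = 0%E. Proof. by rewrite /density_measure integral_set0. Qed.

Let nu_ge0 A : (0 <= nu A)%E. Proof. exact: integral_ge0. Qed.

Let nu_sigma_additive : semi_sigma_additive nu.
Proof.
move=> F mF tF mUF; rewrite /density_measure ge0_integral_bigcup//.
- by apply: is_cvg_ereal_nneg_natsum_cond => k _ _; exact: integral_ge0.
- exact: measurable_funTS.
Qed.

HB.instance Definition _ := isMeasure.Build _ _ _ nu nu0 nu_ge0 nu_sigma_additive.

End density_measure.

Section open_boxes.
Context (R : realType) (n : nat).
Local Notation E := (euclidean R n).
Local Notation mu := (lebesgue_euclid R n).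

Definition obox (u v : 'I_n -> R) : set E := [set x | forall i, u i < tnth x i < v i].

Definition oboxes : set (set E) := [set B | exists u v, B = obox u v].

Lemma measurable_obox u v : measurable (obox u v).
Proof.
have {1}-> : obox u v = \big[setI/setT]_(i < n) ((fun x : E => tnth x i) @^-1` `]u i, v i[%classic).
  rewrite /obox; suff h (s : seq 'I_n) : \big[setI/setT]_(i <- s)
      ((fun x : E => tnth x i) @^-1` `]u i, v i[%classic) =
      [set x | forall i, i \in s -> u i < tnth x i < v i].
    by rewrite h; apply/seteqP; split => x /= hx i; have := hx i; rewrite mem_index_enum => ->.
  elim: s => [|i s IH]; first by rewrite big_nil; apply/seteqP; split.
  rewrite big_cons IH; apply/seteqP; split => x /=.
    by rewrite in_itv/= => -[a b] j; rewrite inE => /predU1P[->//|]; exact: b.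
  move=> h; split => [|j js]; first by rewrite in_itv/= h// inE eqxx.
  by apply: h; rewrite inE js orbT.
apply: bigsetI_measurable => i _; rewrite -[X in measurable X]setTI.
by apply: (measurable_tnth i) => //; exact: measurable_itv.
Qed.

Lemma oboxes_setI : setI_closed oboxes.
Proof.
move=> _ _ [u [v ->]] [u' [v' ->]].
exists (fun i => Num.max (u i) (u' i)), (fun i => Num.min (v i) (v' i)).
apply/seteqP; split => x.
  by move=> [h h'] i; rewrite gt_max lt_min; have /andP[-> ->] := h i; exact: h'.
by move=> h; split => i; have := h i; rewrite gt_max lt_min => /andP[/andP[a b] /andP[c e]]; apply/andP.
Qed.

Lemma measurable_oboxes : @measurable _ E = <<s oboxes >>.
Proof.
apply/seteqP; split; last first.
  apply: smallest_sub; first exact: sigma_algebra_measurable.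
  by move=> _ [u [v ->]]; exact: measurable_obox.
apply: smallest_sub; first exact: smallest_sigma_algebra.
have mtnth i : measurable_fun setT (fun x : g_sigma_algebraType oboxes => tnth (x : E) i : measurableTypeR R).
  apply: (@measurability _ _ (g_sigma_algebraType oboxes) (measurableTypeR R) setT _ (@RGenOpens.G R)).
    exact: RGenOpens.measurableE.
  move=> _ [_ [p [q ->]] <-]; rewrite setTI.
  (* An open slab is the union of the boxes whose remaining sides are []-k, k[]; a k above the sum
     of all |x_j| captures x. *)
  rewrite (_ : _ @^-1` _ = \bigcup_k obox (fun j => if j == i then p else - k%:R)
      (fun j => if j == i then q else k%:R)).
    by apply: bigcupT_measurable => k; apply: sub_sigma_algebra; do 2 eexists.
  apply/seteqP; split => x /=.
    rewrite in_itv/= => xpq; pose M := \sum_(j < n) `|tnth x j|.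
    exists (Num.truncn M).+1 => // j; case: eqP => [->//|_].
    rewrite -ltr_norml; apply: le_lt_trans (truncnS_gt M).
    by rewrite /M (bigD1 j)//= lerDl sumr_ge0.
  by move=> [k _ /(_ i)]; rewrite eqxx in_itv.
elim/big_ind : _ => [//|A B hA hB|i _].
  by rewrite subUset.
move=> _ [B mB <-]; exact: mtnth.
Qed.

(* Both the positive and the negative part of f define finite measures, which
   agree on the pi-system of open boxes. *)
Lemma ae_eq0_oboxes (f : E -> R) : mu.-integrable setT (EFin \o f) ->
  (forall u v, \int[mu]_(x in obox u v) (f x)%:E = 0)%E ->
  {ae mu, forall x, f x = 0}.
Proof.
move=> fi f0; have mf := measurable_int _ fi.
pose m1 := density_measure mu (measurable_funepos mf) (funepos_ge0 (EFin \o f)).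
pose m2 := density_measure mu (measurable_funeneg mf) (funeneg_ge0 (EFin \o f)).
have fin1 A : measurable A -> (m1 A < +oo)%E.
  move=> mA; apply: (@integral_funepos_lt_pinfty _ _ _ mu A) => //; exact: (integrableS measurableT mA (@subsetT _ A) fi).
have fin2 A : measurable A -> (m2 A < +oo)%E.
  move=> mA; apply: (@integral_funeneg_lt_pinfty _ _ _ mu A) => //; exact: (integrableS measurableT mA (@subsetT _ A) fi).
have ge1 A : (0 <= m1 A)%E by exact: integral_ge0.
have ge2 A : (0 <= m2 A)%E by exact: integral_ge0.
have eq12 A : measurable A -> m1 A = m2 A.
  apply: (measure_unique oboxes (fun k => obox (fun=> - k%:R) (fun=> k%:R))).
  - exact: measurable_oboxes.
  - exact: oboxes_setI.
  - by move=> k; do 2 eexists.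
  - apply/seteqP; split => // x _; pose M := \sum_(j < n) `|tnth x j|.
    exists (Num.truncn M).+1 => // j.
    rewrite -ltr_norml; apply: le_lt_trans (truncnS_gt M).
    by rewrite /M (bigD1 j)//= lerDl sumr_ge0.
  - move=> _ [u [v ->]]; have mB := measurable_obox u v.
    have e : (m1 (obox u v) - m2 (obox u v) = 0)%E by rewrite -[RHS](f0 u v) [RHS]integralE.
    have f2 : m2 (obox u v) \is a fin_num by rewrite ge0_fin_numE//; exact: fin2.
    by change (m1 (obox u v) = m2 (obox u v)); rewrite -(subeK (m1 _) f2) e add0e.
  - by move=> k; apply: fin1; exact: measurable_obox.
have : ae_eq mu setT (EFin \o f) (cst 0%E).
  apply: integral_ae_eq => // A _ mA; rewrite integral0 integralE.
  rewrite -[X in (X - _)%E]/(m1 A) -[X in (_ - X)%E]/(m2 A) eq12// subee// ge0_fin_numE//.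
  exact: fin2.
by apply: filterS => x /(_ I) [].
Qed.

End open_boxes.

Section tent.
Context (R : realType).
Implicit Types (u v r : R) (k : nat).

(** A trapezoid with slopes k and -k, cut off at height 1 and supported in [[u, v]]. It is
    Lipschitz, as [cint_eq0_four] requires of test functions, and tends pointwise to the indicator
    of the open interval. *)
Definition tent k u v r : R :=
  Num.max 0 (Num.min 1 (Num.min (k%:R * (r - u)) (k%:R * (v - r)))).

Lemma tent01 k u v r : 0 <= tent k u v r <= 1.
Proof. by rewrite /tent le_max lexx/= ge_max ler01 ge_min lexx. Qed.

Lemma tent_lipschitz k u v r r' : `|tent k u v r - tent k u v r'| <= k%:R * `|r - r'|.
Proof.
have minL (a b a' b' e : R) : `|a - a'| <= e -> `|b - b'| <= e ->
    `|Num.min a b - Num.min a' b'| <= e.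
  by rewrite !ler_norml => /andP[? ?] /andP[? ?]; apply/andP; split;
    case: (lerP a b); case: (lerP a' b'); lra.
have maxL (b b' e : R) : `|b - b'| <= e -> `|Num.max 0 b - Num.max 0 b'| <= e.
  by rewrite !ler_norml => /andP[? ?]; apply/andP; split;
    case: (lerP 0 b); case: (lerP 0 b'); lra.
have k0 : (0 : R) <= k%:R by [].
rewrite /tent; apply: maxL; apply: (minL).
  by rewrite subrr normr0 mulr_ge0.
apply: minL.
  by rewrite -mulrBr normrM ger0_norm// (_ : r - u - _ = r - r')//; ring.
by rewrite -mulrBr normrM ger0_norm// (_ : v - r - _ = - (r - r')) ?normrN//; ring.
Qed.

Lemma tent_out k u v r : ~~ (u < r < v) -> tent k u v r = 0.
Proof.
move=> h; rewrite /tent; apply/max_idPl; rewrite ge_min; apply/orP; right.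
rewrite ge_min; move: h; rewrite negb_and -!leNgt => /orP[h|h]; apply/orP.
  by left; rewrite mulr_ge0_le0// subr_le0.
by right; rewrite mulr_ge0_le0// subr_le0.
Qed.

Lemma tent_cvg u v r : tent k u v r @[k --> \oo] --> (\1_(`]u, v[%classic : set R) r : R).
Proof.
rewrite indicE; have [h|h] := boolP (u < r < v).
  rewrite mem_set ?in_itv//=.
  have /andP[ur rv] := h.
  pose e := Num.min (r - u) (v - r).
  have e0 : 0 < e by rewrite lt_min !subr_gt0 ur.
  apply: cvg_near_cst; near=> k.
  have ke : 1 <= k%:R * e.
    rewrite -ler_pdivrMr// mul1r; apply: (le_trans (ltW (truncnS_gt _))).
    by rewrite ler_nat; near: k; exact: nbhs_infty_ge.
  rewrite /tent -minr_pMr// (min_idPl ke); apply/max_idPr; exact: ler01.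
rewrite memNset ?in_itv//=; last exact/negP.
by apply: cvg_near_cst; near=> k; rewrite tent_out.
Unshelve. all: end_near. Qed.

Lemma measurable_tent k u v : measurable_fun setT (tent k u v).
Proof.
apply: measurable_maxr => //; apply: measurable_minr => //; apply: measurable_minr;
  apply: measurable_funM => //; exact: measurable_funB.
Qed.

Lemma integrable_tent k u v :
  (@lebesgue_measure R).-integrable setT (EFin \o tent k u v).
Proof.
apply: (@integrable_le _ _ R lebesgue_measure _ (\1_(`]u, v[%classic : set R))).
- exact: measurable_tent.
- move=> r; have /andP[a b] := tent01 k u v r; rewrite ger0_norm// indicE.
  have [h|h] := boolP (u < r < v); first by rewrite mem_set ?in_itv.
  by rewrite tent_out.
- apply: integrable_indic_itv.
Qed.

End tent.

(** The factors are exchanged one at a time, while the others stay in [0, 1]. *)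
Lemma norm_prodB_le (R : realType) n (a b : 'I_n -> R) :
  (forall i, 0 <= a i <= 1) -> (forall i, 0 <= b i <= 1) ->
  `|\prod_i a i - \prod_i b i| <= \sum_i `|a i - b i|.
Proof.
move=> a01 b01.
suff : forall s : seq 'I_n, `|\prod_(i <- s) a i - \prod_(i <- s) b i| <= \sum_(i <- s) `|a i - b i| by [].
move=> s.
have p01 (c : 'I_n -> R) (t : seq 'I_n) : (forall i, 0 <= c i <= 1) -> 0 <= \prod_(i <- t) c i <= 1.
  move=> c01; rewrite prodr_ge0 ?prodr_ile1// => i _; by case/andP: (c01 i).
elim: s => [|i s IH]; first by rewrite !big_nil subrr normr0.
rewrite !big_cons.
rewrite (_ : _ - _ = (a i - b i) * \prod_(j <- s) a j + b i * (\prod_(j <- s) a j - \prod_(j <- s) b j)); last by ring.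
rewrite (le_trans (ler_normD _ _))// lerD//.
  have /andP[x y] := p01 a s a01.
  by rewrite normrM [X in _ * X]ger0_norm// ler_piMr.
have /andP[x y] := b01 i.
by rewrite normrM [X in X * _]ger0_norm// (le_trans _ IH)// ler_piMl.
Qed.

Section fourier_uniqueness.
Context (R : realType) (n : nat).
Local Notation E := (euclidean R n).
Local Notation mu := (lebesgue_euclid R n).

Lemma four_eq0 c (f : E -> R[i]) : c ^+ 2 = 1 -> cintable mu f ->
  (forall x, four c f x = 0) -> {ae mu, forall x, f x = 0}.
Proof.
move=> c1 cf f0.
have [f1 f2] := cf.
have key u v k : cint mu (fun x => f x * (\prod_(i < n) tent k (u i) (v i) (tnth x i))%:C) = 0.
  have ip := (integrable_Rintegral_prod (fun i : 'I_n => integrable_tent k (u i) (v i))).1.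
  apply: (cint_eq0_four (L := k%:R) (M := 1) c1 cf _ f0) => //.
  - split => /=; [exact: ip|exact: integrable0].
  - move=> x y; rewrite -(rmorphB (real_complex R)) normc_real.
    rewrite (le_trans (norm_prodB_le _ _))// ?mulr_sumr.
    + by move=> i; exact: tent01.
    + by move=> i; exact: tent01.
    + by apply: ler_sum => i _; exact: tent_lipschitz.
  - move=> x; rewrite normc_real ger0_norm.
      by apply: prodr_ile1 => i _; exact: tent01.
    by apply: prodr_ge0 => i _; case/andP : (tent01 k (u i) (v i) (tnth x i)).
(* For a real function, steepening the tents turns orthogonality into vanishing integrals over all
   open boxes, by dominated convergence. It is applied to the real and imaginary parts of f. *)
have real (g : E -> R) : mu.-integrable setT (EFin \o g) ->
    (forall u v k, \int[mu]_x (g x * \prod_(i < n) tent k (u i) (v i) (tnth x i)) = 0) ->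
    {ae mu, forall x, g x = 0}.
  move=> ig g0; have /measurable_EFinP mg := measurable_int _ ig.
  apply: ae_eq0_oboxes => // u v.
  have p01 k (x : E) : 0 <= \prod_(i < n) tent k (u i) (v i) (tnth x i) <= 1.
    rewrite prodr_ge0 ?prodr_ile1// => i _; first exact: tent01.
    by case/andP : (tent01 k (u i) (v i) (tnth x i)).
  have mp k : measurable_fun setT (fun x : E => \prod_(i < n) tent k (u i) (v i) (tnth x i)).
    apply: measurable_prod => i _.
    exact: (measurableT_comp (measurable_tent k (u i) (v i)) (measurable_tnth i)).
  have mB := measurable_obox u v.
  rewrite integral_mkcond.
  have mgp k : measurable_fun setT (fun x : E => (g x * \prod_(i < n) tent k (u i) (v i) (tnth x i))%:E).
    by apply/measurable_EFinP; exact: measurable_funM.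
  have mgB : measurable_fun setT ((fun x => (g x)%:E) \_ (obox u v)).
    by apply/(measurable_restrictT _ _).1 => //; apply: measurable_funTS; exact/measurable_EFinP.
  have [||_ _ h] := @dominated_convergence _ _ _ mu _ measurableT
    (fun k (x : E) => (g x * \prod_(i < n) tent k (u i) (v i) (tnth x i))%:E)
    ((fun x => (g x)%:E) \_ (obox u v)) (fun x => `|g x|%:E) mgp mgB _ (integrable_norm ig).
  - apply: aeW => x _; rewrite patchE.
    have -> : (if x \in obox u v then (g x)%:E else 0%E) =
        (g x * \prod_(i < n) \1_(`]u i, v i[%classic : set R) (tnth x i))%:E.
      case: ifPn => [|/negP xB].
        rewrite inE => xB; rewrite big1 ?mulr1// => i _.
        by rewrite indicE mem_set//= in_itv/= xB.
      have [i xi] : exists i, ~~ (u i < tnth x i < v i).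
        by apply/not_existsP => h; apply: xB; rewrite inE => i; apply: contrapT => /negP; exact: h.
      rewrite (bigD1 i)//= indicE memNset ?mul0r ?mulr0//= in_itv/=; exact/negP.
    apply: cvg_EFin; first exact: nearW.
    apply: cvgMr.
    suff : forall s : seq 'I_n, \prod_(i <- s) tent k (u i) (v i) (tnth x i) @[k --> \oo] -->
        (\prod_(i <- s) \1_(`]u i, v i[%classic : set R) (tnth x i) : R) by apply.
    elim=> [|i s IH].
      by rewrite big_nil; under eq_fun do rewrite big_nil; exact: cvg_cst.
    rewrite big_cons; under eq_fun do rewrite big_cons.
    by apply: cvgM => //; exact: tent_cvg.
  - apply: aeW => x k _; rewrite /= lee_fin normrM; have /andP[a b] := p01 k x.
    by rewrite [X in _ * X]ger0_norm// ler_piMr.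
  rewrite -(cvg_lim (@ereal_hausdorff R) h); apply: lim_near_cst => //; apply: nearW => k.
  rewrite /= -(EFin_Rintegral (r := fun x : E => g x * \prod_(i < n) tent k (u i) (v i) (tnth x i))) ?g0//.
  apply: (@integrable_le _ _ R mu _ (fun x => `|g x|)).
  - exact: measurable_funM.
  - move=> x; rewrite normrM; have /andP[a b] := p01 k x.
    by rewrite [X in _ * X]ger0_norm// ler_piMr.
  - exact: integrable_norm.
have aeR : {ae mu, forall x, Re (f x) = 0}.
  apply: real => // u v k.
  transitivity (Re (cint mu (fun x => f x * (\prod_(i < n) tent k (u i) (v i) (tnth x i))%:C))).
    by apply: eq_Rintegral => x _; rewrite Re_mul/= mulr0 subr0.
  by rewrite key.
have aeI : {ae mu, forall x, Im (f x) = 0}.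
  apply: real => // u v k.
  transitivity (Im (cint mu (fun x => f x * (\prod_(i < n) tent k (u i) (v i) (tnth x i))%:C))).
    by apply: eq_Rintegral => x _; rewrite Im_mul/= mulr0 add0r.
  by rewrite key.
by apply: filterS2 aeR aeI => x; case: (f x) => a b /= -> ->.
Qed.

End fourier_uniqueness.

(** * Schwartz functions *)

Section lipschitz_functions.
Context (R : realType) (n : nat).
Local Notation E := (euclidean R n).
Implicit Types (x y : E) (f : E -> R[i]).

Definition dist1 x y : R := \sum_(i < n) `|tnth x i - tnth y i|.

Lemma measurable_dist1 y : measurable_fun setT (fun x => dist1 x y).
Proof.
apply: measurable_sum => i; apply: measurableT_comp => //.
by apply: measurable_funB => //; exact: measurable_tnth.
Qed.

(* g is the supremum of countably many functions g q - L * dist1 _ q. *)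
Lemma measurable_lipschitz (g : E -> R) L : 0 <= L ->
  (forall x y, `|g x - g y| <= L * dist1 x y) -> measurable_fun setT g.
Proof.
move=> L0 gL.
apply: (@measurability _ _ E (measurableTypeR R) setT _ (@RGenOInfty.G R)).
  exact: RGenOInfty.measurableE.
move=> _ [_ [a ->] <-]; rewrite setTI.
pose q (z : n.-tuple rat) : E := [tuple ratr (tnth z i) | i < n].
rewrite (_ : _ @^-1` _ = \bigcup_(z in [set: n.-tuple rat])
    ((fun x => g (q z) - L * dist1 x (q z)) @^-1` `]a, +oo[%classic)).
  apply: countable_bigcupT_measurable; first exact: countableP.
  move=> z; rewrite -[X in measurable X]setTI.
  have : measurable_fun setT (fun x => g (q z) - L * dist1 x (q z)).
    by apply: measurable_funB => //; apply: measurable_funM => //; exact: measurable_dist1.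
  by apply => //; exact: measurable_itv.
apply/seteqP; split => x /=.
  rewrite in_itv/= andbT => ax.
  (* A rational point within e of x in every coordinate is at distance at most n e, so replacing g x
     by g(q z) - L dist(x, q z) costs at most 2 L n e < g x - a. *)
  pose e := (g x - a) / (2 * L * n%:R + 1).
  have D0 : 0 < 2 * L * n%:R + 1 by rewrite ltr_wpDl// !mulr_ge0.
  have e0 : 0 < e by rewrite divr_gt0// subr_gt0.
  have hq i : exists r : rat, `|tnth x i - ratr r| < e.
    have /rat_in_itvoo[r] : tnth x i - e < tnth x i + e by rewrite ltrBlDr -addrA ltrDl addr_gt0.
    by rewrite in_itv/= => ?; exists r; rewrite ltr_distlC.
  pose z : n.-tuple rat := [tuple sval (cid (hq i)) | i < n].
  exists z => //=; rewrite in_itv/= andbT.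
  have dz : dist1 x (q z) <= n%:R * e.
    rewrite mulr_natl -[X in _ *+ X]card_ord -sumr_const; apply: ler_sum => i _.
    by rewrite !tnth_mktuple ltW//; case: cid.
  have gz := gL x (q z); rewrite ler_norml in gz; have /andP[_ gz2] := gz.
  have Ld : L * dist1 x (q z) <= L * (n%:R * e) by rewrite ler_wpM2l.
  have eD : (2 * L * n%:R + 1) * e = g x - a by rewrite /e mulrC divfK// gt_eqF.
  nra.
move=> [z _] /=; rewrite !in_itv/= !andbT => az.
have := gL (q z) x; rewrite ler_norml => /andP[_].
have -> : dist1 (q z) x = dist1 x (q z) by apply: eq_bigr => i _; rewrite distrC.
lra.
Qed.

Lemma cmeas_lipschitz f L : 0 <= L ->
  (forall x y, normc (f x - f y) <= L * dist1 x y) -> cmeas f.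
Proof.
move=> L0 fL; split; apply: (measurable_lipschitz L0) => x y; apply: (le_trans _ (fL x y)).
  by rewrite -Re_opp -Re_add norm_Re_le_normc.
by rewrite -Im_opp -Im_add norm_Im_le_normc.
Qed.

End lipschitz_functions.

Lemma lipschitz_derive1 (R : realType) (F : R -> R) M :
  (forall r : R, derivable F r 1) -> (forall r, `|derive1 F r| <= M) ->
  forall a b, `|F a - F b| <= M * `|a - b|.
Proof.
move=> dF FM.
suff h a b : a < b -> `|F b - F a| <= M * `|b - a|.
  move=> a b; have [ab|ba|->] := ltgtP a b.
  - by rewrite distrC [X in _ * X]distrC; exact: h.
  - exact: h.
  - by rewrite !subrr normr0 mulr0.
move=> ab.
have [||c _ ->] := @MVT R F (derive1 F) a b ab _ _.
- by move=> x _; apply: DeriveDef; rewrite ?derive1E.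
- apply: derivable_within_continuous => x _; exact: dF.
by rewrite normrM ler_wpM2r.
Qed.

Section schwartz_bounds.
Context (R : realType) (n : nat).
Local Notation E := (euclidean R n).
Local Notation mu := (lebesgue_euclid R n).
Implicit Types (x y : E) (phi : E -> R[i]).

Lemma tnth_upd x i r j : tnth (upd x i r) j = if j == i then r else tnth x j.
Proof. by rewrite tnth_mktuple. Qed.

Lemma upd_upd x i r r' : upd (upd x i r) i r' = upd x i r'.
Proof. by apply: eq_from_tnth => j; rewrite !tnth_upd; case: (j == i). Qed.

Lemma upd_id x i : upd x i (tnth x i) = x.
Proof. by apply: eq_from_tnth => j; rewrite !tnth_upd; case: eqP => [->|]. Qed.

Lemma enorm_ge0 x : 0 <= enorm x. Proof. exact: sqrtr_ge0. Qed.

Lemma norm_tnth_le_enorm x i : `|tnth x i| <= enorm x.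
Proof.
rewrite -sqrtr_sqr; apply: ler_wsqrtr; rewrite /dot (bigD1 i)//= -expr2 lerDl.
by apply: sumr_ge0 => j _; rewrite -expr2 sqr_ge0.
Qed.

Lemma enorm_le_sum x : enorm x <= \sum_(i < n) `|tnth x i|.
Proof.
have S0 : 0 <= \sum_(i < n) `|tnth x i| by apply: sumr_ge0.
rewrite -[leRHS]ger0_norm// -sqrtr_sqr; apply: ler_wsqrtr.
rewrite expr2 mulr_suml; apply: ler_sum => i _.
rewrite -expr2 -(real_normK (num_real (tnth x i))) expr2 ler_wpM2l//.
by rewrite (bigD1 i)//= lerDl sumr_ge0.
Qed.

(** The definition of [schwartz] speaks only of partial derivatives. The Lipschitz bound supplies
    the measurability of phi, and the hypothesis on g in [cint_four_mul]. *)
Lemma schwartz_lipschitz phi : schwartz phi ->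
  exists2 L, 0 <= L & forall x y, normc (phi x - phi y) <= L * dist1 x y.
Proof.
move=> [dphi bphi].
have hM i : exists M, forall x, normc (pderiv i phi x) <= M.
  have [M HM] := bphi [:: i] 0%N; exists M => x.
  by have := HM x; rewrite expr0 mul1r.
pose M i := sval (cid (hM i)).
have MP i x : normc (pderiv i phi x) <= M i by rewrite /M; case: cid.
have M0 i : 0 <= M i by apply: le_trans (MP i [tuple 0 | i < n]); exact: normc_ge0.
(* The mean value theorem is applied to the real and imaginary parts separately, hence the 2. *)
have step i x r : normc (phi (upd x i r) - phi x) <= 2 * M i * `|r - tnth x i|.
  rewrite -{2}(upd_id x i) -mulrA mulr_natl mulr2n (le_trans (normc_le_ReIm _))//.
  rewrite Re_add Im_add Re_opp Im_opp; apply: lerD.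
    pose F r := Re (phi (upd x i r)).
    have eF t : (fun r => Re (phi (upd (upd x i t) i r))) = F.
      by apply/funext => r'; rewrite upd_upd.
    apply: (@lipschitz_derive1 R F) => t.
      by have [+ _] := dphi [::] i (upd x i t); rewrite tnth_upd eqxx /= eF.
    rewrite (_ : derive1 F t = Re (pderiv i phi (upd x i t))).
      exact: le_trans (norm_Re_le_normc _) (MP _ _).
    by rewrite /pderiv /= eF tnth_upd eqxx.
  pose F r := Im (phi (upd x i r)).
  have eF t : (fun r => Im (phi (upd (upd x i t) i r))) = F.
    by apply/funext => r'; rewrite upd_upd.
  apply: (@lipschitz_derive1 R F) => t.
    by have [_ +] := dphi [::] i (upd x i t); rewrite tnth_upd eqxx /= eF.
  rewrite (_ : derive1 F t = Im (pderiv i phi (upd x i t))).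
    exact: le_trans (norm_Im_le_normc _) (MP _ _).
  by rewrite /pderiv /= eF tnth_upd eqxx.
exists (\sum_(i < n) 2 * M i).
  by apply: sumr_ge0 => i _; rewrite mulr_ge0.
move=> x y.
(* [z s] has the coordinates of x at the indices in s and those of y elsewhere; as s grows it moves
   from y to x one coordinate at a time. *)
pose z (s : seq 'I_n) : E := foldr (fun i w => upd w i (tnth x i)) y s.
have zP s j : tnth (z s) j = if j \in s then tnth x j else tnth y j.
  elim: s => //= i s IH; rewrite tnth_upd inE; case: eqP => [->//|_] /=.
  exact: IH.
have zx : z (index_enum 'I_n) = x.
  by apply: eq_from_tnth => j; rewrite zP mem_index_enum.
have : forall s : seq 'I_n, uniq s -> normc (phi (z s) - phi y) <=
    \sum_(i <- s) 2 * M i * `|tnth x i - tnth y i|.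
  elim=> [_|i s IH /= /andP[iNs us]]; first by rewrite big_nil subrr normc0.
  rewrite big_cons /=; set w := z s.
  rewrite (_ : _ - _ = (phi (upd w i (tnth x i)) - phi w) + (phi w - phi y)); last by rewrite addrA subrK.
  rewrite (le_trans (le_normcD _ _))// lerD//; last exact: IH.
  by have := step i w (tnth x i); rewrite /w zP (negbTE iNs).
move=> /(_ _ (index_enum_uniq _)); rewrite zx => /le_trans; apply.
rewrite /dist1 mulr_sumr; apply: ler_sum => i _; rewrite ler_wpM2r//.
by rewrite (bigD1 i)//= lerDl sumr_ge0// => j _; rewrite mulr_ge0.
Qed.

Lemma schwartz_cmeas phi : schwartz phi -> cmeas phi.
Proof. by move=> /schwartz_lipschitz[L L0 phiL]; exact: cmeas_lipschitz phiL. Qed.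

Lemma schwartz_bounded phi : schwartz phi -> exists M, forall x, normc (phi x) <= M.
Proof.
move=> [_ /(_ [::] 0%N)[M MP]]; exists M => x.
by have := MP x; rewrite expr0 mul1r.
Qed.

(** The exponent 2n pays (1 + |x|)^2 >= 1 + x_i^2 once for each coordinate, and the resulting
    product majorant is integrable by Fubini. *)
Lemma schwartz_decay phi : schwartz phi ->
  exists M, forall x, normc (phi x) <= M * \prod_(i < n) (oneDsqr (tnth x i))^-1.
Proof.
move=> [_ /(_ [::] (2 * n)%N)[M MP]]; exists M => x.
rewrite prodfV ler_pdivlMr; last by apply: prodr_gt0 => i _; exact: (lt_le_trans ltr01 (oneDsqr_ge1 _)).
apply: le_trans (MP x); rewrite mulrC ler_wpM2r ?normc_ge0//.
rewrite exprM -[X in _ ^+ X]card_ord -prodr_const; apply: ler_prod => i _.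
rewrite (le_trans ler01 (oneDsqr_ge1 _))/= /oneDsqr sqrrD expr1n mul1r -addrA lerD2l.
rewrite -(real_normK (num_real (tnth x i))) ler_wpDl ?mulrn_wge0 ?enorm_ge0//.
by apply: lerXn2r; rewrite ?nnegrE ?enorm_ge0// norm_tnth_le_enorm.
Qed.

Lemma schwartz_cintable phi : schwartz phi -> cintable mu phi.
Proof.
move=> sphi; have [M MP] := schwartz_decay sphi.
have [i _] := @integrable_Rintegral_prod R n (fun=> fun r => (oneDsqr r)^-1) (fun=> integrable_oneDsqrV R).
apply: (cintable_le _ MP); first exact: schwartz_cmeas.
exact: (integrableZl measurableT M i).
Qed.

Lemma integrable_schwartz_sqr phi : schwartz phi ->
  mu.-integrable setT (fun x => (normc (phi x) ^+ 2)%:E).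
Proof.
move=> sphi; have [M MP] := schwartz_bounded sphi.
have i := cintable_normc (schwartz_cintable sphi).
apply: (@integrable_le _ _ _ mu _ (fun x => M * normc (phi x))).
- by apply: measurable_funX; apply: cmeas_normc; exact: schwartz_cmeas.
- by move=> x; rewrite ger0_norm ?sqr_ge0// expr2 ler_wpM2r ?normc_ge0.
- exact: (integrableZl measurableT M i).
Qed.

End schwartz_bounds.

Section gaussian_schwartz.
Context (R : realType) (n : nat).
Local Notation E := (euclidean R n).
Local Notation mu := (lebesgue_euclid R n).
Implicit Types (x y : E) (P : 'I_n -> {poly R}).

(** Polynomials times Gaussians form a class closed under differentiation, p becoming p' - (X - a)
    p; all iterated derivatives of a Gaussian can therefore be bounded at once. *)
Let g (p : {poly R}) (a r : R) : R := p.[r] * expR (- ((r - a) ^+ 2 / 2)).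

Let is_derive_g (p : {poly R}) (a r : R) :
  is_derive r 1 (g p a) (g (p^`() - ('X - a%:P) * p) a r).
Proof.
have h : is_derive r 1 (horner p) (p^`()).[r].
  apply: DeriveDef; first exact: derivable_horner.
  by rewrite derivE derive1E.
have he : is_derive r 1 (fun r => expR (- ((r - a) ^+ 2 / 2))) (- (r - a) * expR (- ((r - a) ^+ 2 / 2))).
  apply: is_derive_eq; rewrite /GRing.scale /=; by field.
have -> : g (p^`() - ('X - a%:P) * p) a r =
    p.[r] * (- (r - a) * expR (- ((r - a) ^+ 2 / 2))) + expR (- ((r - a) ^+ 2 / 2)) * (p^`()).[r].
  rewrite /g hornerD hornerN hornerM hornerXsubC.
  set e := expR _; move: (p.[r]) (p^`().[r]) => q q'; ring.
exact: is_deriveM.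
Qed.

Let pol_bound (p : {poly R}) : exists2 C, 0 <= C & forall r, `|p.[r]| <= C * (1 + `|r|) ^+ (size p).
Proof.
exists (\sum_(i < size p) `|p`_i|); first by apply: sumr_ge0.
move=> r; rewrite horner_coef (le_trans (ler_norm_sum _ _ _))// mulr_suml.
apply: ler_sum => i _; rewrite normrM ler_wpM2l// normrX.
apply: (@le_trans _ _ ((1 + `|r|) ^+ i)); first by apply: lerXn2r; rewrite ?nnegrE ?addr_ge0// lerDr.
by apply: ler_weXn2l; [rewrite lerDl|exact: ltnW].
Qed.

Let g_bound (p : {poly R}) (a : R) N : exists2 C, 0 <= C & forall r, (1 + `|r|) ^+ N * `|g p a r| <= C.
Proof.
have [C C0 Cp] := pol_bound p; pose k := (N + size p)%N.
(* From 1 + |r| <= (1 + |a|) exp|r - a| and, completing the square, k u - u^2/2 <= k^2/2 with u = |r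
   - a|. *)
exists (C * ((1 + `|a|) ^+ k * expR (k%:R ^+ 2 / 2))).
  by rewrite !mulr_ge0// ?exprn_ge0 ?addr_ge0// expR_ge0.
move=> r; rewrite /g normrM (ger0_norm (expR_ge0 _)).
have h0 : 0 <= 1 + `|r| by rewrite addr_ge0.
apply: (@le_trans _ _ ((1 + `|r|) ^+ N * (C * (1 + `|r|) ^+ size p * expR (- ((r - a) ^+ 2 / 2))))).
  by rewrite ler_wpM2l ?exprn_ge0// ler_wpM2r ?expR_ge0.
have -> : (1 + `|r|) ^+ N * (C * (1 + `|r|) ^+ size p * expR (- ((r - a) ^+ 2 / 2))) =
    C * ((1 + `|r|) ^+ k * expR (- ((r - a) ^+ 2 / 2))).
  by rewrite /k exprD; set A := (1 + _) ^+ N; set B := (1 + _) ^+ _; ring.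
rewrite ler_wpM2l//.
have h1 : 1 + `|r| <= (1 + `|a|) * expR `|r - a|.
  apply: (@le_trans _ _ ((1 + `|a|) * (1 + `|r - a|))).
    have : `|r| <= `|a| + `|r - a| by rewrite addrC -{1}(subrK a r) ler_normD.
    have := mulr_ge0 (normr_ge0 a) (normr_ge0 (r - a)); lra.
  by rewrite ler_wpM2l ?addr_ge0// expR_ge1Dx.
apply: (@le_trans _ _ (((1 + `|a|) * expR `|r - a|) ^+ k * expR (- ((r - a) ^+ 2 / 2)))).
  by rewrite ler_wpM2r ?expR_ge0// lerXn2r ?nnegrE// mulr_ge0 ?addr_ge0 ?expR_ge0.
rewrite exprMn -mulrA ler_wpM2l ?exprn_ge0 ?addr_ge0//.
rewrite -expRM_natl -expRD ler_expR -(real_normK (num_real (r - a))).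
have := sqr_ge0 (`|r - a| - k%:R); nra.
Qed.

Let G P y x : R[i] := (\prod_(i < n) g (P i) (tnth y i) (tnth x i))%:C.

Let G_upd P y x i r : G P y (upd x i r) =
  (g (P i) (tnth y i) r * \prod_(j < n | j != i) g (P j) (tnth y j) (tnth x j))%:C.
Proof.
rewrite /G (bigD1 i)//= tnth_upd eqxx; congr ((_ * _)%:C).
by apply: eq_bigr => j /negbTE ji; rewrite tnth_upd ji.
Qed.

Let dP P y i j := if j == i then (P i)^`() - ('X - (tnth y i)%:P) * P i else P j.

Let is_derive_G P y x i : is_derive (tnth x i) 1 (fun r => Re (G P y (upd x i r)))
  (Re (G (dP P y i) y x)).
Proof.
under eq_fun do rewrite G_upd /=.
have h := is_derive_g (P i) (tnth y i) (tnth x i).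
apply: is_derive_eq; rewrite /GRing.scale /= mulr0 add0r.
rewrite [in RHS](bigD1 i)//= /dP eqxx mulrC; congr (_ * _).
by apply: eq_bigr => j /negbTE ->.
Qed.

Let pderiv_G P y i : pderiv i (G P y) = G (dP P y i) y.
Proof.
apply/funext => x; apply: complex_ext => /=.
  by rewrite derive1E; exact: (@derive_val _ _ _ _ _ _ _ (is_derive_G P y x i)).
by rewrite derive1_cst.
Qed.

Let schwartz_G P y : schwartz (G P y).
Proof.
have hs (s : seq 'I_n) : exists Q, pderivs s (G P y) = G Q y.
  elim: s => [|i s [Q IH]]; first by exists P.
  by exists (dP Q y i); rewrite /= IH pderiv_G.
split => s i.
  move=> x; have [Q ->] := hs s; split => /=; last exact: derivable_cst.
  exact: (@ex_derive _ _ _ _ _ _ _ (is_derive_G Q y x i)).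
have [Q ->] := hs s; pose N := i.
have hC j : exists C, 0 <= C /\ forall r, (1 + `|r|) ^+ N * `|g (Q j) (tnth y j) r| <= C.
  by have [C ? ?] := g_bound (Q j) (tnth y j) N; exists C.
pose C j := sval (cid (hC j)).
have CP j r : (1 + `|r|) ^+ N * `|g (Q j) (tnth y j) r| <= C j.
  by rewrite /C; case: cid => ? [].
exists (\prod_(j < n) C j) => x; rewrite normc_real normr_prod.
(* Decay in |x| splits into decay in each coordinate because 1 + |x| is at most the product of the 1
   + |x_j|. *)
apply: (@le_trans _ _ ((\prod_(j < n) (1 + `|tnth x j|)) ^+ N * \prod_(j < n) `|g (Q j) (tnth y j) (tnth x j)|)).
  apply: ler_wpM2r; first by apply: prodr_ge0.
  apply: lerXn2r; rewrite ?nnegrE.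
  - by rewrite addr_ge0// enorm_ge0.
  - by apply: prodr_ge0 => j _; rewrite addr_ge0.
  apply: (@le_trans _ _ (1 + \sum_(j < n) `|tnth x j|)); first by rewrite lerD2l enorm_le_sum.
  suff : 0 <= \sum_(j < n) `|tnth x j| /\ 1 + \sum_(j < n) `|tnth x j| <= \prod_(j < n) (1 + `|tnth x j|) by case.
  elim/big_rec2 : _ => [|j a b _ [b0 h]]; first by rewrite addr0.
  have a0 : 0 <= `|tnth x j| by [].
  split; first by rewrite addr_ge0.
  rewrite mulrDl mul1r; have : `|tnth x j| <= `|tnth x j| * a; last lra.
  by rewrite ler_peMr//; lra.
rewrite -prodrXl -big_split/=; apply: ler_prod => j _.
by rewrite mulr_ge0 ?exprn_ge0 ?addr_ge0// CP.
Qed.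

Definition gaussian y x : R[i] :=
  (\prod_(i < n) expR (- ((tnth x i - tnth y i) ^+ 2 / 2)))%:C.

Lemma schwartz_gaussian y : schwartz (gaussian y).
Proof.
have := schwartz_G (fun=> 1%:P) y; congr schwartz; apply/funext => x.
by rewrite /G /gaussian; congr (_%:C); apply: eq_bigr => i _; rewrite /g hornerC mul1r.
Qed.

Lemma fourier_gaussian y x : fourier (gaussian y) x =
  (Num.sqrt (pi *+ 2) ^+ n)%:C * (cis (- dot x y) * (gwin 1 x)%:C).
Proof.
pose w (i : 'I_n) r : R[i] := (Num.sqrt (pi *+ 2))%:C *
  (cis (- tnth x i * r) * (normal_pdf (tnth y i) 1 r)%:C).
have iw i : cintable (@lebesgue_measure R) (fun r => cis (- tnth x i * r) * (normal_pdf (tnth y i) 1 r)%:C).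
  apply: (cintable_le _ _ (integrable_normal_pdf (tnth y i) 1)).
    apply: cmeasM; last by apply: cmeas_real; exact: measurable_normal_pdf.
    by apply: cmeas_cis; apply: measurable_funM.
  by move=> r; rewrite normcM normc_cis mul1r normc_real ger0_norm// normal_pdf_ge0.
have iw' i : cintable (@lebesgue_measure R) (w i) by apply: cintableZl; exact: iw.
transitivity (cint mu (fun z => \prod_(i < n) w i (tnth z i))).
  apply: eq_cint => z; rewrite /gaussian rmorph_prod /dot -sumrN cis_sum -big_split/=.
  apply: eq_bigr => i _; rewrite /w mulrCA mulNr; congr (_ * _).
  rewrite -rmorphM; congr (_%:C); rewrite normal_pdf_exp// mul1r divr1 mulrA divff ?mul1r//.
  by rewrite gt_eqF// sqrt2pi_gt0.
rewrite (cintable_cint_prod iw').2 -[X in _ ^+ X]card_ord -prodr_const.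
rewrite /dot -sumrN cis_sum /gwin !rmorph_prod -!big_split/=; apply: eq_bigr => i _.
by rewrite cintZl// cint_cis_normal// mulNr mulrN sqrrN.
Qed.

Lemma gaussian0E x : gaussian [tuple 0 | i < n] x = (gwin 1 x)%:C.
Proof.
by congr (_%:C); apply: eq_bigr => i _; rewrite tnth_mktuple subr0 mul1r.
Qed.

End gaussian_schwartz.

(** * Almost everywhere convergence of series *)

Lemma cvg_normc (R : realType) (u : nat -> R[i]) (z : R[i]) :
  normc (u k - z) @[k --> \oo] --> (0 : R) -> normc (u k) @[k --> \oo] --> normc z.
Proof.
move=> uz; apply/subr_cvg0/norm_cvg0P.
apply: (@squeeze_cvgr _ _ _ _ (cst 0) (fun k => normc (u k - z))) => //; last exact: cvg_cst.
apply: nearW => k; rewrite normr_ge0/= ler_norml; apply/andP; split.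
  rewrite lerNl opprB lerBlDr -[X in normc X <= _](subKr (u k)).
  by rewrite (le_trans (le_normcD _ _))// normcN addrC.
rewrite lerBlDr -[X in normc X <= _](subrK z).
by rewrite (le_trans (le_normcD _ _)).
Qed.

Section almost_everywhere_series.
Context d (T : measurableType d) (R : realType) (m : {measure set T -> \bar R}).

Lemma ae_bounded_series (g : nat -> T -> R) (a : nat -> R) A :
  (forall l, measurable_fun setT (g l)) -> (forall l x, 0 <= g l x) ->
  (forall l, \int[m]_x (g l x)%:E <= (a l)%:E)%E ->
  (forall N, \sum_(0 <= l < N) a l <= A) ->
  {ae m, forall x, exists B, forall N, \sum_(0 <= l < N) g l x <= B}.
Proof.
move=> mg g0 ga aA.
have mg' l : measurable_fun setT (fun x => (g l x)%:E) by exact/measurable_EFinP.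
pose S x := (\sum_(l <oo) (g l x)%:E)%E.
have S0 x : (0 <= S x)%E by apply: nneseries_ge0 => l _ _; rewrite lee_fin.
have mS : measurable_fun setT S.
  by apply: ge0_emeasurable_sum => // l x _ _; rewrite lee_fin.
have iS : (\int[m]_x S x <= A%:E)%E.
  rewrite integral_nneseries//; last by move=> l x _; rewrite lee_fin.
  apply: lime_le.
    by apply: is_cvg_nneseries => l _ _; apply: integral_ge0 => x _; rewrite lee_fin.
  apply: nearW => N; apply: (le_trans (lee_sum _ (fun l _ => ga l))).
  by rewrite sumEFin lee_fin.
have : m.-integrable setT S.
  apply/integrableP; split => //; rewrite (eq_integral S).
    by apply: (le_lt_trans iS); rewrite ltry.
  by move=> x _; rewrite gee0_abs.
move=> /(integrable_ae measurableT); apply: filterS => x /(_ I) Sfin.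
exists (fine (S x)) => N; rewrite -lee_fin fineK// -sumEFin.
by apply: nneseries_lim_ge => l _ _; rewrite lee_fin.
Qed.

(** The measure may be infinite, so L^2 bounds give no L^1 bounds. Instead f_l <= q^l + q^(-l)
    f_l^2, where the first terms form a geometric series and the integrals of the second are at most
    K q^l. *)
Lemma ae_bounded_series_geometric (f : nat -> T -> R) K q :
  0 < q < 1 -> 0 <= K ->
  (forall l, measurable_fun setT (f l)) -> (forall l x, 0 <= f l x) ->
  (forall l, \int[m]_x (f l x ^+ 2)%:E <= (K * q ^+ l ^+ 2)%:E)%E ->
  {ae m, forall x, exists B, forall N, \sum_(0 <= l < N) f l x <= B}.
Proof.
move=> /andP[q0 q1] K0 mf f0 fK.
have geo N : \sum_(0 <= l < N) q ^+ l <= (1 - q)^-1.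
  have q1' : 0 < 1 - q by rewrite subr_gt0.
  rewrite -[leRHS]mul1r ler_pdivlMr// big_mkord mulrC -opprB mulNr -subrX1 opprB.
  by rewrite gerBl exprn_ge0// ltW.
have h : {ae m, forall x, exists B, forall N, \sum_(0 <= l < N) q ^- l * f l x ^+ 2 <= B}.
apply: (@ae_bounded_series (fun l x => q ^- l * f l x ^+ 2) (fun l => K * q ^+ l) (K / (1 - q))).
- by move=> l; apply: measurable_funM => //; exact: measurable_funX.
- by move=> l x; rewrite mulr_ge0 ?sqr_ge0// invr_ge0 exprn_ge0// ltW.
- move=> l; under eq_integral do rewrite EFinM.
  rewrite ge0_integralZl_EFin//; last 3 first.
  + by move=> x _; rewrite lee_fin sqr_ge0.
  + by apply/measurable_EFinP; exact: measurable_funX.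
  + by rewrite invr_ge0 exprn_ge0// ltW.
  apply: (@le_trans _ _ ((q ^- l)%:E * (K * q ^+ l ^+ 2)%:E)%E).
    by apply: lee_wpmul2l => //; rewrite lee_fin invr_ge0 exprn_ge0// ltW.
  by rewrite -EFinM lee_fin expr2 mulrCA mulKf// expf_neq0// gt_eqF.
- by move=> N; rewrite -mulr_sumr ler_wpM2l.
apply: filterS h => x [B HB]; exists (B + (1 - q)^-1) => N.
apply: le_trans (lerD (HB N) (geo N)); rewrite -big_split/=; apply: ler_sum => l _.
have ql : 0 < q ^+ l by rewrite exprn_gt0.
rewrite -(ler_pM2l ql) mulrDr mulrA mulfV ?gt_eqF// mul1r.
have := sqr_ge0 (f l x - q ^+ l / 2); nra.
Qed.

Lemma series_cvg_bounded (u : nat -> R) B : (forall l, 0 <= u l) ->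
  (forall N, \sum_(0 <= l < N) u l <= B) -> cvgn (series u).
Proof.
move=> u0 uB; apply: nondecreasing_is_cvgn.
  by apply: nondecreasing_series.
by exists B => _ [N _ <-]; exact: uB.
Qed.

Lemma ae_cvg_L2_geometric (F : nat -> T -> R) K : 0 <= K ->
  (forall l, measurable_fun setT (F l)) ->
  (forall l, \int[m]_x ((F l.+1 x - F l x) ^+ 2)%:E <= (K * 2^-1 ^+ l ^+ 2)%:E)%E ->
  exists2 G, measurable_fun setT G & {ae m, forall x, F l x @[l --> \oo] --> (G x : R)}.
Proof.
move=> K0 mF FK.
(* The upper limit is measurable and defined everywhere; it is the limit wherever the sequence
   converges. *)
exists (fun x => fine (limn_esup (fun l => (F l x)%:E))).
  apply: (measurableT_comp (fine_measurable measurableT)).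
  by apply: measurable_fun_limn_esup => l; exact/measurable_EFinP.
have h : {ae m, forall x, exists B, forall N, \sum_(0 <= l < N) `|F l.+1 x - F l x| <= B}.
apply: (@ae_bounded_series_geometric (fun l x => `|F l.+1 x - F l x|) K 2^-1 _ K0).
- by rewrite invr_gt0 ltr0n invf_lt1// ltr1n.
- by move=> l; apply: measurableT_comp => //; exact: measurable_funB.
- by [].
- by move=> l; under eq_integral do rewrite real_normK ?num_real//; exact: FK.
apply: filterS h => x [B HB].
have c1 : cvgn (series (fun l => F l.+1 x - F l x)).
  by apply: normed_cvg; exact: series_cvg_bounded HB.
have c2 : cvgn (fun l => F l x).
  have -> : (fun l => F l x) = (fun l => series (fun l => F l.+1 x - F l x) l + F 0%N x).
    by apply/funext => l; rewrite /series /= telescope_sumr// subrK.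
  by apply: is_cvgD => //; exact: is_cvg_cst.
have h : ((F l x)%:E @[l --> \oo] --> (limn (fun l => F l x))%:E)%E.
  by apply: cvg_EFin; [exact: nearW|exact: c2].
rewrite is_cvg_limn_esupE; last by apply/cvg_ex; eexists; exact: h.
by rewrite (cvg_lim _ h).
Qed.

(** Completeness of L^2 along a rapidly Cauchy sequence: the pointwise limit comes from the real and
    imaginary parts, and Fatou's lemma passes the rate on to it. *)
Lemma ae_cvg_cL2_geometric (F : nat -> T -> R[i]) K : 0 <= K ->
  (forall l, cmeas (F l)) ->
  (forall i j, (i <= j)%N ->
    \int[m]_x (normc (F j x - F i x) ^+ 2)%:E <= (K * 2^-1 ^+ i ^+ 2)%:E)%E ->
  exists2 G, cmeas G & {ae m, forall x, normc (F l x - G x) @[l --> \oo] --> (0 : R)} /\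
    forall i, (\int[m]_x (normc (F i x - G x) ^+ 2)%:E <= (K * 2^-1 ^+ i ^+ 2)%:E)%E.
Proof.
move=> K0 cF FK.
have mn (f : T -> R[i]) : cmeas f -> measurable_fun setT (fun x => (normc (f x) ^+ 2)%:E).
  by move=> cf; apply/measurable_EFinP/measurable_funX; exact: cmeas_normc.
have [||g mg Fg] := @ae_cvg_L2_geometric (fun l x => Re (F l x)) K K0.
- by move=> l; case: (cF l).
- move=> l; apply: le_trans (FK l l.+1 (leqnSn l)); apply: ge0_le_integral => //.
  + by move=> x _; rewrite lee_fin sqr_ge0.
  + apply/measurable_EFinP/measurable_funX; apply: measurable_funB.
      by case: (cF l.+1).
    by case: (cF l).
  + by apply: mn; exact: cmeasB.
  + by move=> x _; rewrite lee_fin sqr_normc_ReIm Re_add Re_opp lerDl sqr_ge0.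
have [||h mh Fh] := @ae_cvg_L2_geometric (fun l x => Im (F l x)) K K0.
- by move=> l; case: (cF l).
- move=> l; apply: le_trans (FK l l.+1 (leqnSn l)); apply: ge0_le_integral => //.
  + by move=> x _; rewrite lee_fin sqr_ge0.
  + apply/measurable_EFinP/measurable_funX; apply: measurable_funB.
      by case: (cF l.+1).
    by case: (cF l).
  + by apply: mn; exact: cmeasB.
  + by move=> x _; rewrite lee_fin sqr_normc_ReIm Im_add Im_opp lerDr sqr_ge0.
pose G x := g x +i* h x.
have cG : cmeas G by split.
have nG : {ae m, forall x, normc (F l x - G x) @[l --> \oo] --> (0 : R)}.
  apply: filterS2 Fg Fh => x gx hx.
  apply: (@squeeze_cvgr _ _ _ _ (cst 0) (fun l => `|Re (F l x) - g x| + `|Im (F l x) - h x|)).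
  - apply: nearW => l; rewrite normc_ge0 (le_trans (normc_le_ReIm _))//.
    by rewrite Re_add Im_add Re_opp Im_opp.
  - exact: cvg_cst.
  - rewrite -[X in _ --> X](addr0 0); apply: cvgD; apply/norm_cvg0P/subr_cvg0 => //.
exists G => //; split => // i.
(* The index is shifted by i because the Cauchy bound compares only later terms with [F i]. *)
apply: (@integral_le_of_cvg _ _ _ m (fun k x => normc (F (k + i)%N x - F i x) ^+ 2)).
- by move=> k; apply: measurable_funX; apply: cmeas_normc; exact: cmeasB.
- by apply: measurable_funX; apply: cmeas_normc; exact: cmeasB.
- by move=> k x; exact: sqr_ge0.
- by move=> x; exact: sqr_ge0.
- apply: filterS nG => x nx.
  have nx' : normc (F (k + i)%N x - F i x) @[k --> \oo] --> normc (F i x - G x).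
    rewrite -(normcN (F i x - G x)) opprB.
    apply: cvg_normc; under eq_fun do rewrite opprB addrA subrK.
    by move: nx; rewrite -(cvg_shiftn i (fun k => normc (F k x - G x))).
  by under eq_fun do rewrite expr2; rewrite expr2; exact: cvgM.
- by move=> k; apply: FK; exact: leq_addl.
Qed.

Lemma cintableM_L2 (f g : T -> R[i]) : cmeas f -> cmeas g ->
  m.-integrable setT (fun x => (normc (f x) ^+ 2)%:E) ->
  m.-integrable setT (fun x => (normc (g x) ^+ 2)%:E) -> cintable m (fun x => f x * g x).
Proof.
move=> cf cg f2 g2.
apply: (@cintable_le _ _ _ m _ (fun x => normc (f x) ^+ 2 + normc (g x) ^+ 2)).
- exact: cmeasM.
- move=> x; rewrite normcM; have := normc_ge0 (f x); have := normc_ge0 (g x).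
  by have := sqr_ge0 (normc (f x) - normc (g x)); nra.
- exact: (integrableD measurableT f2 g2).
Qed.

(** With the weight 2^j, |F_j - G| |g| <= 2^j |F_j - G|^2 + 2^(-j) |g|^2, and both terms integrate
    to O(2^(-j)). *)
Lemma cint_cvg_L2_geometric (F : nat -> T -> R[i]) (G g : T -> R[i]) K :
  (forall j, cmeas (F j)) -> cmeas G -> cmeas g ->
  (forall j, \int[m]_x (normc (F j x - G x) ^+ 2)%:E <= (K * 2^-1 ^+ j ^+ 2)%:E)%E ->
  m.-integrable setT (fun x => (normc (g x) ^+ 2)%:E) ->
  (forall j, cintable m (fun x => F j x * g x)) -> cintable m (fun x => G x * g x) ->
  normc (cint m (fun x => F j x * g x) - cint m (fun x => G x * g x)) @[j --> \oo] --> (0 : R).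
Proof.
move=> cF cG cg FG g2 cFg cGg.
pose I := \int[m]_x (normc (g x) ^+ 2).
have q0 : 0 < 2^-1 :> R by rewrite invr_gt0.
have i1 j : m.-integrable setT (fun x => (normc (F j x - G x) ^+ 2)%:E).
  apply/integrableP; split.
    by apply/measurable_EFinP/measurable_funX; apply: cmeas_normc; exact: cmeasB.
  under eq_integral do rewrite /= ger0_norm ?sqr_ge0//.
  by apply: (le_lt_trans (FG j)); rewrite ltry.
apply: (@squeeze_cvgr _ _ _ _ (cst 0) (fun j => (2 * (K + I)) * 2^-1 ^+ j)); last 2 first.
- exact: cvg_cst.
- rewrite -[X in _ --> X](mulr0 (2 * (K + I))); apply: cvgM; first exact: cvg_cst.
  by apply: cvg_expr; rewrite ger0_norm ?ltW// invf_lt1// ltr1n.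
apply: nearW => j; apply/andP; split; first exact: normc_ge0.
have qj : 0 < 2^-1 ^+ j :> R by rewrite exprn_gt0.
rewrite -cintB//.
have -> : cint m (fun x => F j x * g x - G x * g x) = cint m (fun x => (F j x - G x) * g x).
  by apply: eq_cint => x; rewrite mulrBl.
have cd : cintable m (fun x => (F j x - G x) * g x).
  by apply: (eq_cintable _ (cintableB (cFg j) cGg)) => x; rewrite mulrBl.
rewrite (le_trans (normc_cint cd))// -mulrA ler_pM2l//.
have i2 := integrableZl measurableT (2^-1 ^- j) (i1 j).
have i3 := integrableZl measurableT (2^-1 ^+ j) g2.
apply: (@le_trans _ _ (\int[m]_x (2^-1 ^- j * normc (F j x - G x) ^+ 2 + 2^-1 ^+ j * normc (g x) ^+ 2))).
  apply: le_Rintegral => //.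
  - exact: (cintable_normc cd).
  - exact: (integrableD measurableT i2 i3).
  - move=> x _; rewrite normcM.
    set a := normc _; set b := normc _; rewrite -(ler_pM2l qj) mulrDr [X in _ <= X + _]mulrA mulfV ?gt_eqF// mul1r.
    have : 0 <= a * (2^-1 ^+ j * b) by rewrite !mulr_ge0 ?normc_ge0 ?ltW.
    by have := sqr_ge0 (a - 2^-1 ^+ j * b); nra.
rewrite RintegralD// !RintegralZl//; last exact: i1.
rewrite -/I mulrDl (mulrC I) lerD2r.
rewrite ler_pdivrMl// mulrCA -expr2.
by rewrite -lee_fin (EFin_Rintegral (i1 j)).
Qed.

End almost_everywhere_series.

(** * Inverse Fourier transform on L^2 *)

Section plancherel.
Context (R : realType) (n : nat).
Local Notation E := (euclidean R n).
Local Notation mu := (lebesgue_euclid R n).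
Implicit Types (x y : E) (f g h phi G : E -> R[i]).

Lemma fourB c f g x : cintable mu f -> cintable mu g ->
  four c (fun y => f y - g y) x = four c f x - four c g x.
Proof.
move=> cf cg; rewrite /four -cintB; [|exact: cintable_four..].
by apply: eq_cint => y; rewrite mulrBr.
Qed.

Lemma integrable_gwin_sqr (s : R) : 0 < s ->
  mu.-integrable setT (fun x => (normc (gwin s x)%:C ^+ 2)%:E).
Proof.
move=> s0; have ig : mu.-integrable setT (EFin \o gwin s) by exact: integrable_gwin.
apply: (@integrable_le _ _ R mu (fun x => normc (gwin s x)%:C ^+ 2) (gwin s) _ _ ig).
  by apply: measurable_funX; apply: cmeas_normc; apply: cmeas_real; exact: measurable_gwin.
move=> x; rewrite normc_real ger0_norm ?sqr_ge0// real_normK ?num_real//.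
by have /andP[a b] := gwin01 s x; rewrite expr2 ler_piMl.
Qed.

Lemma fourierE phi : fourier phi = four (-1) phi.
Proof. by apply/funext => x; apply: eq_cint => y; rewrite mulN1r. Qed.

(** As a function of the centre y, the pairing with the transformed Gaussian is itself a Fourier
    integral, that of [h * gwin 1]; this is the form to which [four_eq0] applies. *)
Lemma cint_fourier_gaussian h y : cintable mu (fun x => h x * (gwin 1 x)%:C) ->
  cint mu (fun x => h x * fourier (gaussian y) x) =
    (Num.sqrt (pi *+ 2) ^+ n)%:C * four (-1) (fun x => h x * (gwin 1 x)%:C) y.
Proof.
move=> ch; rewrite -cintZl; last exact: cintable_four.
apply: eq_cint => x; rewrite fourier_gaussian mulN1r dotC.
by rewrite mulrCA; congr (_ * _); rewrite mulrCA.
Qed.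

Lemma cmeas_fourier phi : schwartz phi -> cmeas (fourier phi).
Proof. by move=> sphi; rewrite fourierE; apply: cmeas_four; exact: schwartz_cintable. Qed.

Lemma L2P f : L2 f <-> cmeas f /\ mu.-integrable setT (fun x => (normc (f x) ^+ 2)%:E).
Proof.
split=> [[cf f2]|[cf f2]]; split => //.
  apply/integrableP; split.
    by apply/measurable_EFinP/measurable_funX; exact: cmeas_normc.
  by under eq_integral do rewrite /= ger0_norm ?sqr_ge0//.
move/integrableP : f2 => [_]; under eq_integral do rewrite /= ger0_norm ?sqr_ge0//.
by [].
Qed.

Lemma integrable_fourier_sqr phi : schwartz phi ->
  mu.-integrable setT (fun x => (normc (fourier phi x) ^+ 2)%:E).
Proof.
move=> sphi; apply/(proj2 (iffLR (L2P _) _)); split; first exact: cmeas_fourier.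
rewrite fourierE; have i := integrable_schwartz_sqr sphi.
apply: (le_lt_trans (four_L2_le _ (schwartz_cintable sphi) i)); first by rewrite sqrrN expr1n.
rewrite -EFin_Rintegral// -EFinM; exact: ltry.
Qed.

(** Windows are selected so that the integral of (1 - gwin)|G|^2 is at most 4^(-i). For a, b in
    [0, 1] one has (a - b)^2 <= (1 - a) + (1 - b), whence the 2. *)
Lemma gwin_approx_L2 G : L2 G -> exists s : nat -> R,
  [/\ forall i, 0 < s i, s i @[i --> \oo] --> (0 : R) &
    forall i j, (i <= j)%N -> (\int[mu]_x
      (normc ((gwin (s j) x)%:C * G x - (gwin (s i) x)%:C * G x) ^+ 2)%:E <=
        (2 * 2^-1 ^+ i ^+ 2)%:E)%E].
Proof.
move=> /L2P[cG G2].
have van : \int[mu]_x ((1 - gwin k.+1%:R^-1 x) * normc (G x) ^+ 2) @[k --> \oo] --> (0 : R).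
  apply: Rintegral_vanish => //.
  - by move=> k; apply: measurable_funB => //; exact: measurable_gwin.
  - by move=> k x; have /andP[a b] := gwin01 k.+1%:R^-1 x; rewrite subr_ge0 b gerBl.
  - move=> x; rewrite -[X in _ --> X](subrr 1); apply: cvgB; first exact: cvg_cst.
    by apply: gwin_cvg; exact: cvg_harmonic.
  - by move=> x; exact: sqr_ge0.
have q0 i : 0 < 2^-1 ^+ i ^+ 2 :> R by rewrite !exprn_gt0// invr_gt0.
(* The requirement [i <= k] makes the widths tend to 0 even when the error bound is no constraint,
   as for G = 0. *)
have ex i : exists k, (i <= k)%N /\
    \int[mu]_x ((1 - gwin k.+1%:R^-1 x) * normc (G x) ^+ 2) <= 2^-1 ^+ i ^+ 2.
  have /cvgrPdist_le/(_ _ (q0 i))[N _ HN] := van.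
  exists (maxn N i); split; first exact: leq_maxr.
  have := HN (maxn N i) (leq_maxl _ _); rewrite sub0r normrN; exact: (le_trans (ler_norm _)).
pose k i := sval (cid (ex i)).
have [ki kP] : (forall i, (i <= k i)%N) /\ forall i,
    \int[mu]_x ((1 - gwin (k i).+1%:R^-1 x) * normc (G x) ^+ 2) <= 2^-1 ^+ i ^+ 2.
  by split=> i; have [] := svalP (cid (ex i)).
exists (fun i => (k i).+1%:R^-1); split.
- by move=> i; rewrite invr_gt0 ltr0n.
- apply: (@squeeze_cvgr _ _ _ _ (cst 0) (fun i => i.+1%:R^-1)); last 2 first.
  + exact: cvg_cst.
  + exact: cvg_harmonic.
  + by apply: nearW => i; rewrite invr_ge0 ler0n/= lef_pV2 ?posrE ?ltr0n// ler_nat ltnS.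
move=> i j ij.
have iw l : mu.-integrable setT (EFin \o (fun x => (1 - gwin (k l).+1%:R^-1 x) * normc (G x) ^+ 2)).
  apply: (@integrable_le _ _ _ mu _ (fun x => normc (G x) ^+ 2)) => //.
    apply: measurable_funM; last by apply: measurable_funX; exact: cmeas_normc.
    by apply: measurable_funB => //; exact: measurable_gwin.
  move=> x; have /andP[a b] := gwin01 (k l).+1%:R^-1 x.
  by rewrite normrM ger0_norm ?subr_ge0// ger0_norm ?sqr_ge0// ler_piMl ?sqr_ge0// gerBl.
have iw2 := integrableD measurableT (iw i) (iw j).
apply: (@le_trans _ _ (\int[mu]_x ((1 - gwin (k i).+1%:R^-1 x) * normc (G x) ^+ 2 +
    (1 - gwin (k j).+1%:R^-1 x) * normc (G x) ^+ 2)%:E)%E).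
  apply: ge0_le_integral => //.
  - by move=> x _; rewrite lee_fin sqr_ge0.
  - apply/measurable_EFinP/measurable_funX; apply: cmeas_normc.
    by apply: cmeasB; apply: cmeasM => //; apply: cmeas_real; exact: measurable_gwin.
  - exact: (measurable_int _ iw2).
  - move=> x _; rewrite lee_fin -mulrBl normcM exprMn -mulrDl ler_wpM2r ?sqr_ge0//.
    rewrite -(rmorphB (real_complex R)) normc_real real_normK ?num_real//.
    have /andP[a b] := gwin01 (k i).+1%:R^-1 x; have /andP[a' b'] := gwin01 (k j).+1%:R^-1 x.
    nra.
rewrite -(EFin_Rintegral (r := fun x => (1 - gwin (k i).+1%:R^-1 x) * normc (G x) ^+ 2 +
    (1 - gwin (k j).+1%:R^-1 x) * normc (G x) ^+ 2)) // lee_fin.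
rewrite RintegralD// mulr_natl mulr2n lerD ?kP//; apply: (le_trans (kP j)).
by rewrite ler_pXn2r ?nnegrE ?exprn_ge0 ?invr_ge0//; apply: ler_wiXn2l => //;
   rewrite ?invr_ge0// invf_le1// ler1n.
Qed.

(* h is the inverse Fourier transform of G; the 4 comes from four_L2_le. *)
Lemma fourier_preimage G : L2 G -> exists h, [/\ L2 h,
  forall phi, schwartz phi -> cint mu (fun x => h x * fourier phi x) = cint mu (fun x => G x * phi x) &
  (\int[mu]_x (normc (h x) ^+ 2)%:E <=
    (4 / (pi *+ 2) ^+ n)%:E * \int[mu]_x (normc (G x) ^+ 2)%:E)%E].
Proof.
move=> LG; have [cG G2] := iffLR (L2P G) LG.
have [s [s0 s_cvg sP]] := gwin_approx_L2 LG.
pose P : R := (pi *+ 2) ^+ n.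
have P0 : 0 < P by rewrite exprn_gt0// pmulrn_lgt0// pi_gt0.
pose f j x := (gwin (s j) x)%:C * G x.
have cw j : cmeas (fun x : E => (gwin (s j) x)%:C : R[i]) by apply: cmeas_real; exact: measurable_gwin.
have cf j : cmeas (f j) by exact: cmeasM.
have if1 j : cintable mu (f j).
  apply: cintableM_L2 => //.
  exact: integrable_gwin_sqr.
have fG j x : normc (f j x) ^+ 2 <= normc (G x) ^+ 2.
  rewrite ler_pXn2r ?nnegrE ?normc_ge0// normcM normc_real.
  by have /andP[a b] := gwin01 (s j) x; rewrite ger0_norm// ler_piMl ?normc_ge0.
have if2 j : mu.-integrable setT (fun x => (normc (f j x) ^+ 2)%:E).
  apply: (integrable_le _ _ G2); first by apply: measurable_funX; exact: cmeas_normc.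
  by move=> x; rewrite ger0_norm ?sqr_ge0.
have bessel g : cintable mu g -> mu.-integrable setT (fun x => (normc (g x) ^+ 2)%:E) ->
    (\int[mu]_x (normc ((P^-1)%:C * four 1 g x) ^+ 2)%:E <=
      (4 / P)%:E * \int[mu]_x (normc (g x) ^+ 2)%:E)%E.
  move=> cg g2; under eq_integral do rewrite normcM exprMn EFinM.
  rewrite ge0_integralZl_EFin//; last 3 first.
  - by move=> x _; rewrite lee_fin sqr_ge0.
  - by apply/measurable_EFinP/measurable_funX; apply: cmeas_normc; exact: cmeas_four.
  - exact: sqr_ge0.
  apply: (le_trans (lee_wpmul2l _ (four_L2_le _ cg g2))).
  - by rewrite lee_fin sqr_ge0.
  - by rewrite expr1n.
  rewrite muleA -EFinM -/P normc_real real_normK ?num_real//.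
  by rewrite (_ : P^-1 ^+ 2 * (4 * P) = 4 / P)//; field; rewrite gt_eqF.
pose H j x := (P^-1)%:C * four 1 (f j) x.
have cH j : cmeas (H j) by apply: cmeasM; [exact: cmeas_cst|exact: cmeas_four].
have [||h ch [hH hK]] := @ae_cvg_cL2_geometric _ _ _ mu H (4 / P * 2) _ cH.
- by rewrite mulr_ge0// divr_ge0// ltW.
- move=> i j ij.
  have cd := cintableB (if1 j) (if1 i).
  have HB x : H j x - H i x = (P^-1)%:C * four 1 (fun x => f j x - f i x) x.
    by rewrite /H -mulrBr fourB.
  under eq_integral do rewrite HB.
  have d2 : mu.-integrable setT (fun x => (normc (f j x - f i x) ^+ 2)%:E).
    apply/integrableP; split.
      by apply/measurable_EFinP/measurable_funX; apply: cmeas_normc; exact: cmeasB.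
    under eq_integral do rewrite /= ger0_norm ?sqr_ge0//.
    by apply: (le_lt_trans (sP i j ij)); rewrite ltry.
  apply: (le_trans (bessel _ cd d2)); rewrite -(mulrA (4 / P)) [leRHS]EFinM.
  by apply: lee_wpmul2l; [rewrite lee_fin divr_ge0// ltW|exact: sP].
have hG : (\int[mu]_x (normc (h x) ^+ 2)%:E <=
    (4 / P)%:E * \int[mu]_x (normc (G x) ^+ 2)%:E)%E.
  apply: (@integral_le_of_cvg _ _ _ mu (fun k x => normc (H k x) ^+ 2)).
  - by move=> k; apply: measurable_funX; exact: cmeas_normc.
  - by apply: measurable_funX; exact: cmeas_normc.
  - by move=> k x; exact: sqr_ge0.
  - by move=> x; exact: sqr_ge0.
  - apply: filterS hH => x /cvg_normc nx.
    by under eq_fun do rewrite expr2; rewrite expr2; exact: cvgM.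
  - move=> k; apply: (le_trans (bessel _ (if1 k) (if2 k))).
    apply: lee_wpmul2l; first by rewrite lee_fin divr_ge0// ltW.
    apply: ge0_le_integral => //.
    + by move=> x _; rewrite lee_fin sqr_ge0.
    + by apply/measurable_EFinP/measurable_funX; exact: cmeas_normc.
    + by apply/measurable_EFinP/measurable_funX; exact: cmeas_normc.
    + by move=> x _; rewrite lee_fin.
have Lh : L2 h.
  split => //; apply: (le_lt_trans hG); rewrite -(EFin_Rintegral G2) -EFinM; exact: ltry.
have [_ h2] := iffLR (L2P h) Lh.
exists h; split => // phi sphi.
have cphi := schwartz_cintable sphi.
have chp : cintable mu (fun x => h x * fourier phi x).
  by apply: cintableM_L2 => //; [exact: cmeas_fourier|exact: integrable_fourier_sqr].
have cHp j : cintable mu (fun x => H j x * fourier phi x).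
  apply: cintableM_L2 => //; [exact: cmeas_fourier| |exact: integrable_fourier_sqr].
  apply: (proj2 (iffLR (L2P _) _)); split; first exact: cH.
  apply: (le_lt_trans (bessel _ (if1 j) (if2 j))).
  rewrite -(EFin_Rintegral (if2 j)) -EFinM; exact: ltry.
have hp := cint_cvg_L2_geometric cH ch (cmeas_fourier sphi) hK (integrable_fourier_sqr sphi) cHp chp.
apply: (normc_cvg_unique hp).
have [M phiM] := schwartz_bounded sphi; have [L L0 phiL] := schwartz_lipschitz sphi.
have cGp : cintable mu (fun x => G x * phi x).
  by apply: cintableM_L2 => //; [exact: schwartz_cmeas|exact: integrable_schwartz_sqr].
(* The windowed functions [f j] are integrable, so Parseval's formula holds for them. The identity
   for G follows by L^2 convergence on the left and domination on the right. *)
have HE j : cint mu (fun x => H j x * fourier phi x) =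
    cint mu (fun x => (gwin (s j) x)%:C * (G x * phi x)).
  transitivity ((P^-1)%:C * cint mu (fun x => four 1 (f j) x * four (-1) phi x)).
    rewrite -cintZl.
      by apply: eq_cint => x; rewrite /H fourierE mulrA.
    apply: (eq_cintable _ (cintableZl P%:C (cHp j))) => x.
    rewrite /H fourierE !mulrA -(rmorphM (real_complex R)) mulfV ?gt_eqF// rmorph1 mul1r//.
  rewrite (@cint_four_mul _ _ 1 (f j) phi L M)//; last 2 first.
  - by rewrite expr1n.
  - exact: integrable_schwartz_sqr.
  rewrite mulrA -(rmorphM (real_complex R)) mulVf ?gt_eqF// rmorph1 mul1r.
  by apply: eq_cint => x; rewrite /f mulrA.
under eq_fun do rewrite HE.
apply: cint_window => //.
- by move=> k; exact: measurable_gwin.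
- by move=> k x; exact: gwin01.
- by move=> x; exact: gwin_cvg.
Qed.

(* Only Gaussian test functions are used: the functions h_i need not be
   integrable against other Fourier transforms. *)
Lemma fourier_preimageB_le h1 h2 G1 G2 :
  cintable mu (fun x => h1 x * (gwin 1 x)%:C) -> cintable mu (fun x => h2 x * (gwin 1 x)%:C) ->
  cmeas h1 -> cmeas h2 -> L2 G1 -> L2 G2 ->
  (forall phi, schwartz phi -> cint mu (fun x => h1 x * fourier phi x) = cint mu (fun x => G1 x * phi x)) ->
  (forall phi, schwartz phi -> cint mu (fun x => h2 x * fourier phi x) = cint mu (fun x => G2 x * phi x)) ->
  (\int[mu]_x (normc (h1 x - h2 x) ^+ 2)%:E <=
    (4 / (pi *+ 2) ^+ n)%:E * \int[mu]_x (normc (G1 x - G2 x) ^+ 2)%:E)%E.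
Proof.
move=> ch1 ch2 mh1 mh2 LG1 LG2 hG1 hG2.
have [[mG1 G12] [mG2 G22]] := (iffLR (L2P _) LG1, iffLR (L2P _) LG2).
have LG : L2 (fun x => G1 x - G2 x).
  apply/L2P; split; first exact: cmeasB.
  have i := integrableZl measurableT 2 (integrableD measurableT G12 G22).
  apply: (@integrable_le _ _ R mu (fun x => normc (G1 x - G2 x) ^+ 2)
    (fun x => 2 * (normc (G1 x) ^+ 2 + normc (G2 x) ^+ 2)) _ _ i).
    by apply: measurable_funX; apply: cmeas_normc; exact: cmeasB.
  by move=> x; rewrite ger0_norm ?sqr_ge0// mulr_natl sqr_normcB_le.
(* D already satisfies the bound; it remains to see that h1 - h2 = D almost everywhere, which is
   tested after multiplication by the positive function [gwin 1]. *)
have [D [LD DG DK]] := fourier_preimage LG.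
have [mD D2] := iffLR (L2P _) LD.
have cD : cintable mu (fun x => D x * (gwin 1 x)%:C).
  apply: cintableM_L2 => //; first by apply: cmeas_real; exact: measurable_gwin.
  exact: integrable_gwin_sqr.
have s0 : (Num.sqrt (pi *+ 2) ^+ n)%:C != 0 :> R[i].
  by rewrite eq_complex/= eqxx andbT expf_neq0// gt_eqF// sqrt2pi_gt0.
have e0 : {ae mu, forall x, h1 x * (gwin 1 x)%:C - h2 x * (gwin 1 x)%:C - D x * (gwin 1 x)%:C = 0}.
  apply: (@four_eq0 _ _ (-1)); first by rewrite sqrrN expr1n.
    by apply: cintableB => //; exact: cintableB.
  move=> y; apply: (mulfI s0); rewrite mulr0.
  have sg := schwartz_gaussian y; have mg := schwartz_cmeas sg; have g2 := integrable_schwartz_sqr sg.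
  rewrite !fourB//; last exact: cintableB.
  rewrite !mulrBr -!cint_fourier_gaussian// hG1// hG2// DG//.
  have c1 := cintableM_L2 mG1 mg G12 g2; have c2 := cintableM_L2 mG2 mg G22 g2.
  rewrite -(cintB c1 c2); apply/eqP; rewrite subr_eq0; apply/eqP/eq_cint => x.
  by rewrite mulrBl.
suff -> : (\int[mu]_x (normc (h1 x - h2 x) ^+ 2)%:E = \int[mu]_x (normc (D x) ^+ 2)%:E)%E by [].
apply: ge0_ae_eq_integral => //.
- by apply/measurable_EFinP/measurable_funX; apply: cmeas_normc; exact: cmeasB.
- by apply/measurable_EFinP/measurable_funX; exact: cmeas_normc.
- by move=> x _; rewrite lee_fin sqr_ge0.
- by move=> x _; rewrite lee_fin sqr_ge0.
apply: filterS e0 => x /eqP; rewrite -!mulrBl mulf_eq0 => /orP[|].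
  by rewrite subr_eq0 => /eqP ->.
by rewrite eq_complex/= eqxx andbT gt_eqF// gwin_gt0.
Qed.

End plancherel.

(** * Chaining *)

Section dyadic.
Context (R : realType).
Implicit Types (t b : R) (l i : nat).

Definition dyadic l i : R := i%:R / 2 ^+ l.

Lemma pow2_gt0 l : 0 < 2 ^+ l :> R. Proof. by rewrite exprn_gt0. Qed.

Lemma pow2E l : 2 ^+ l = 2 `^ l%:R :> R. Proof. by rewrite powR_mulrn. Qed.

Lemma dyadic_ge0 l i : 0 <= dyadic l i.
Proof. by rewrite divr_ge0// ltW// pow2_gt0. Qed.

Lemma dyadic_half l i : `|dyadic l.+1 i - dyadic l i./2| <= (2 ^+ l.+1)^-1.
Proof.
have -> : dyadic l.+1 i - dyadic l i./2 = (odd i)%:R / 2 ^+ l.+1.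
  rewrite /dyadic -{1}(odd_double_half i) natrD -mul2n natrM exprS.
  by field; rewrite gt_eqF// pow2_gt0.
have p2 := ltW (pow2_gt0 l.+1).
rewrite ger0_norm; last by rewrite divr_ge0.
rewrite ler_piMl ?invr_ge0//.
by case: (odd i).
Qed.

Lemma dyadic_half_le l i : dyadic l i./2 <= dyadic l.+1 i.
Proof.
rewrite /dyadic ler_pdivrMr ?pow2_gt0// exprS invfM mulrA divfK ?gt_eqF ?pow2_gt0//.
rewrite ler_pdivlMr// -natrM ler_nat muln2 -{2}(odd_double_half i) leq_addl.
by [].
Qed.

Definition dyadic_floor l t : nat := Num.truncn (2 ^+ l * t).

(** The successive roundings of t form a path in the binary tree in which the parent of i is
    [i./2]. *)
Lemma half_dyadic_floor l t : 0 <= t -> (dyadic_floor l.+1 t)./2 = dyadic_floor l t.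
Proof.
move=> t0; have p2 : 0 <= 2 ^+ l * t by rewrite mulr_ge0// ltW// pow2_gt0.
have p2' : 0 <= 2 ^+ l.+1 * t by rewrite mulr_ge0// ltW// pow2_gt0.
apply/esym/truncn_def; have /andP[] := truncn_itv p2'; rewrite -/(dyadic_floor _ _).
set k := dyadic_floor _ _; rewrite exprS -mulrA => h1 h2.
have k2 : k%:R = (odd k)%:R + 2 * (k./2)%:R :> R.
  by rewrite -{1}(odd_double_half k) natrD -mul2n natrM.
have ok : 0 <= ((odd k)%:R : R) <= 1 by rewrite ler0n lern1; case: (odd k).
rewrite -natr1 in h2; rewrite -natr1; apply/andP; split; lra.
Qed.

Lemma dyadic_floor_itv l t : 0 <= t ->
  dyadic l (dyadic_floor l t) <= t /\ t - dyadic l (dyadic_floor l t) <= (2 ^+ l)^-1.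
Proof.
move=> t0; have p2 : 0 <= 2 ^+ l * t by rewrite mulr_ge0// ltW// pow2_gt0.
have /andP[h1 h2] := truncn_itv p2; rewrite /dyadic.
split; first by rewrite ler_pdivrMr ?pow2_gt0// mulrC.
rewrite lerBlDr -[X in X + _]mul1r -mulrDl ler_pdivlMr ?pow2_gt0// mulrC addrC natr1.
exact: ltW.
Qed.

Lemma dyadic_floor_eq0 l t : 0 <= t -> t < (2 ^+ l)^-1 -> dyadic_floor l t = 0%N.
Proof.
move=> t0 tl; apply: truncn_def; rewrite mulr_ge0 ?(ltW (pow2_gt0 _ _))//=.
by rewrite mulrC -ltr_pdivlMr ?pow2_gt0// mul1r.
Qed.

Lemma ex_dyadic_scale t : 0 < t -> t <= 1 ->
  exists l, (2 ^+ l.+1)^-1 < t /\ t <= (2 ^+ l)^-1.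
Proof.
move=> t0 t1.
have ex : exists l, (2 ^+ l.+1)^-1 < t.
  have h : (2^-1 : R) ^+ l @[l --> \oo] --> (0 : R).
    by apply: cvg_expr; rewrite ger0_norm// invf_lt1// ltr1n.
  have /cvgrPdist_lt/(_ _ t0)[N _ HN] := h.
  exists N; have := HN N.+1 (leqnSn N); rewrite sub0r normrN ger0_norm ?exprn_ge0//.
  by rewrite exprVn.
case: (ex_minnP ex) => l hl min; exists l; split => //.
case: l hl min => [|l] hl min; first by rewrite expr0 invr1.
by rewrite leNgt; apply/negP => /min; rewrite ltnn.
Qed.

End dyadic.

Section chaining.
Context d (T : measurableType d) (R : realType) (m : {measure set T -> \bar R}).
Variables (X : R -> T -> R) (C p b : R) (t : nat -> R).
Hypotheses (mX : forall u, measurable_fun setT (X u)) (C0 : 0 <= C)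
  (p1 : p <= 1) (b1 : 1 < b) (bp : 1 - b^-1 < p).
Hypothesis XC : forall u v : R, 0 <= u <= 1 -> 0 <= v <= 1 ->
  (\int[m]_x ((X u x - X v x) ^+ 2)%:E <= (C * `|u - v| `^ p)%:E)%E.
Hypotheses (t0 : forall k, 0 < t k) (t1 : forall k, t k < 1)
  (tcvg : t k @[k --> \oo] --> (0 : R)) (tsum : cvgn (series (fun k => t k `^ (b - 1)))).

Local Notation kappa := (1 - b^-1).

Let b0 : 0 < b. Proof. exact: lt_trans b1. Qed.
Let kappa_ge0 : 0 <= kappa. Proof. by rewrite subr_ge0 invf_le1// ltW. Qed.
Let p_gt0 : 0 < p. Proof. exact: le_lt_trans bp. Qed.

Let width l : nat := (Num.truncn ((2 : R) `^ (kappa * l%:R))).+1.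

(* Up to one node, the sum is over the i with i/2^(l.+1) <= 2^(- l.+1 / b), which
   are those met by the path of t_k when t_k^b <= 2^(- l.+1). *)
Let Z l x := Num.sqrt (\sum_(i < width l.+1)
  (X (dyadic R l.+1 i) x - X (dyadic R l i./2) x) ^+ 2).

Let sqrZ l x : Z l x ^+ 2 =
  \sum_(i < width l.+1) (X (dyadic R l.+1 i) x - X (dyadic R l i./2) x) ^+ 2.
Proof. by rewrite sqr_sqrtr// sumr_ge0// => i _; rewrite sqr_ge0. Qed.

(** At most 2 * 2^(kappa (l+1)) nodes, each contributing C 2^(-p (l+1)), where kappa < p. Taking a
    sum of squares instead of a maximum lets the integral pass inside while still dominating each
    increment. *)
Let Z_geometric l : (\int[m]_x (Z l x ^+ 2)%:E <=
  (2 * C * ((2 : R) `^ ((kappa - p) / 2)) ^+ l ^+ 2)%:E)%E.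
Proof.
under eq_integral do rewrite sqrZ -sumEFin.
have mD i : measurable_fun setT (fun x => ((X (dyadic R l.+1 i) x - X (dyadic R l i./2) x) ^+ 2)%:E).
  by apply/measurable_EFinP/measurable_funX; exact: measurable_funB.
rewrite ge0_integral_sum//; last by move=> i x _; rewrite lee_fin sqr_ge0.
have w0 : 0 <= (2 : R) `^ (kappa * l.+1%:R) by exact: powR_ge0.
apply: (@le_trans _ _ (\sum_(i < width l.+1) (C * (2 ^+ l.+1)^-1 `^ p)%:E)%E).
  apply: lee_sum => i _.
  (* The increment bound [XC] is confined to [0, 1]; the nodes stay there because kappa <= 1. *)
  have i1 : dyadic R l.+1 i <= 1.
    rewrite /dyadic ler_pdivrMr ?pow2_gt0// mul1r.
    apply: (@le_trans _ _ ((2 : R) `^ (kappa * l.+1%:R))).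
      have /andP[tw _] := truncn_itv w0; apply: le_trans tw; rewrite ler_nat -ltnS; exact: ltn_ord.
    rewrite pow2E; apply: ler_powR; rewrite ?ler1n// ler_piMl// gerBl invr_ge0 ltW//.
  apply: (le_trans (XC _ _)).
  - by rewrite dyadic_ge0.
  - by rewrite dyadic_ge0/= (le_trans (dyadic_half_le _ _ _)).
  - rewrite lee_fin ler_wpM2l//; apply: ge0_ler_powR; rewrite ?nnegrE ?invr_ge0 ?(ltW p_gt0) ?(ltW (pow2_gt0 _ _))//.
    exact: dyadic_half.
rewrite sumEFin lee_fin sumr_const card_ord -[leLHS]mulr_natl.
have hw : (width l.+1)%:R <= 2 * (2 : R) `^ (kappa * l.+1%:R).
  rewrite /width -natr1 mulr_natl mulr2n; apply: lerD; first by rewrite truncn_le.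
  by rewrite -[leLHS](powRr0 2); apply: ler_powR; rewrite ?ler1n// mulr_ge0.
apply: (@le_trans _ _ (2 * (2 : R) `^ (kappa * l.+1%:R) * (C * (2 ^+ l.+1)^-1 `^ p))).
  by rewrite ler_wpM2r// mulr_ge0// powR_ge0.
rewrite mulrACA ler_wpM2l ?mulr_ge0//.
rewrite pow2E -powRN -powRrM -powRD; last by rewrite pnatr_eq0 implybT.
rewrite -!powR_mulrn ?powR_ge0// -!powRrM; apply: ler_powR; rewrite ?ler1n//.
have -> : (kappa - p) / 2 * (l%:R * 2) = (kappa - p) * l%:R.
  by rewrite (mulrC _ 2) mulrA divfK.
have -> : kappa * l.+1%:R + - l.+1%:R * p = (kappa - p) * l.+1%:R by ring.
by rewrite ler_nM2l ?subr_lt0// ler_nat.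
Qed.

Let increment_le_Z l (s : R) x : 0 <= s -> s `^ b <= (2 ^+ l.+1)^-1 ->
  `|X (dyadic R l.+1 (dyadic_floor l.+1 s)) x - X (dyadic R l (dyadic_floor l s)) x| <= Z l x.
Proof.
move=> s0 sl.
(* Since s <= 2^(-(l+1)/b), the index of its node is at most 2^(l+1) s <= 2^(kappa (l+1)). *)
have lt : (dyadic_floor l.+1 s < width l.+1)%N.
  rewrite ltnS; apply: le_truncn.
  have sE : s = (s `^ b) `^ b^-1 by rewrite -powRrM mulfV ?gt_eqF// powRr1.
  have : s <= ((2 ^+ l.+1)^-1) `^ b^-1.
    by rewrite sE; apply: ge0_ler_powR; rewrite ?nnegrE ?invr_ge0 ?powR_ge0 ?(ltW b0) ?(ltW (pow2_gt0 _ _)).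
  rewrite pow2E -powRN -powRrM => sl'.
  rewrite -(ler_pM2l (pow2_gt0 R l.+1)) pow2E in sl'; apply: (le_trans sl').
  rewrite -powRD; last by rewrite pnatr_eq0 implybT.
  by apply: ler_powR; rewrite ?ler1n// le_eqVlt; apply/orP; left; apply/eqP; ring.
rewrite -sqrtr_sqr; apply: ler_wsqrtr; rewrite -(half_dyadic_floor l s0).
rewrite (bigD1 (Ordinal lt))//= lerDl; apply: sumr_ge0 => i _; exact: sqr_ge0.
Qed.

(** Both halves rest on [bp]. In the form b - 1 < b p it bounds the rounding errors by the terms of
    [tsum]; in the form kappa < p it lets the increments outweigh the number of nodes. *)
Lemma ae_cvg_chaining : {ae m, forall x, X (t k) x @[k --> \oo] --> X 0 x}.
Proof.
have tb k : 0 < t k `^ b <= 1.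
  by rewrite powR_gt0//= -(congr1 (@^~ b) (powR1 R))/=; apply: ge0_ler_powR; rewrite ?nnegrE// ltW.
have lev k : exists l, (2 ^+ l.+1)^-1 < t k `^ b /\ t k `^ b <= (2 ^+ l)^-1.
  by have /andP[a c] := tb k; exact: ex_dyadic_scale.
pose l k := sval (cid (lev k)).
have lP k : (2 ^+ (l k).+1)^-1 < t k `^ b /\ t k `^ b <= (2 ^+ l k)^-1 by exact: svalP (cid (lev k)).
pose tau k := dyadic R (l k) (dyadic_floor (l k) (t k)).
have YB : {ae m, forall x, exists B, forall N,
    \sum_(0 <= k < N) (X (t k) x - X (tau k) x) ^+ 2 <= B}.
  apply: (@ae_bounded_series _ _ _ m _ (fun k => 2 * C * t k `^ (b - 1))
      (2 * C * limn (series (fun k => t k `^ (b - 1))))).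
  - by move=> k; apply: measurable_funX; exact: measurable_funB.
  - by move=> k x; exact: sqr_ge0.
  - move=> k; have [h1 h2] := dyadic_floor_itv (l k) (ltW (t0 k)).
    have tau0 : 0 <= tau k by exact: dyadic_ge0.
    apply: (le_trans (XC _ _)).
    + by rewrite !ltW.
    + by rewrite tau0 (le_trans h1)// ltW.
    rewrite lee_fin (mulrC 2) -mulrA ler_wpM2l// ger0_norm ?subr_ge0//.
    (* The grid step 2^(-l) is twice 2^(-l-1), hence below 2 t^b. Then (2 t^b)^p <= 2 t^(b-1), from
       p <= 1 for the factor and from b - 1 < b p, t < 1 for the power. *)
    apply: (@le_trans _ _ ((2 * t k `^ b) `^ p)).
      apply: ge0_ler_powR; rewrite ?nnegrE ?subr_ge0 ?mulr_ge0 ?powR_ge0 ?(ltW p_gt0)//.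
      apply: (le_trans h2); have [h _] := lP k.
      rewrite -ler_pdivrMl//; apply: ltW; apply: le_lt_trans h.
      by rewrite exprS invfM.
    rewrite powRM ?powR_ge0//; apply: ler_pM; rewrite ?powR_ge0//.
      by rewrite -[leRHS](powRr1 (a := 2))//; apply: ler_powR; rewrite ?ler1n.
    rewrite -powRrM; apply: ger_powR; first by rewrite t0 ltW.
    have := bp; rewrite -(ltr_pM2l b0) mulrBr mulr1 mulfV ?gt_eqF//; exact: ltW.
  - move=> N; rewrite -mulr_sumr ler_wpM2l ?mulr_ge0//.
    apply: nondecreasing_cvgn_le => //.
    by apply: nondecreasing_series => k _ _; exact: powR_ge0.
have ZB : {ae m, forall x, exists B, forall N, \sum_(0 <= l < N) Z l x <= B}.
  apply: (@ae_bounded_series_geometric _ _ _ m Z (2 * C) (2 `^ ((kappa - p) / 2))).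
  - rewrite powR_gt0//= lt_neqAle powR_eq1; apply/andP; split; last first.
      by rewrite -[leRHS](powRr0 2); apply: ler_powR; [rewrite ler1n|rewrite pmulr_lle0 ?invr_gt0// subr_le0 ltW].
    by rewrite !negb_or gt_eqF ?ltr1n// -leNgt ler0n mulf_neq0// ?invr_eq0// subr_eq0 lt_eqF.
  - by rewrite mulr_ge0.
  - move=> j; apply: (@measurableT_comp _ _ _ T R R Num.sqrt).
      by apply: continuous_measurable_fun; exact: sqrt_continuous.
    apply: measurable_sum => i; apply: measurable_funX; exact: measurable_funB.
  - by move=> j x; exact: sqrtr_ge0.
  - exact: Z_geometric.
apply: filterS2 YB ZB => x [BY hY] [BZ hZ].
have Y0 : (X (t k) x - X (tau k) x) ^+ 2 @[k --> \oo] --> (0 : R).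
  by apply: cvg_series_cvg_0; apply: (series_cvg_bounded _ hY) => k; exact: sqr_ge0.
have Zc : cvgn (series (fun l => Z l x)).
  by apply: (series_cvg_bounded _ hZ) => k; exact: sqrtr_ge0.
apply/cvgrPdist_le => e e0.
have e2 : 0 < e / 2 by rewrite divr_gt0.
(* M depends on x and e but not on k: the part of any path beyond level M contributes at most
   e/2. *)
have [M HM] : exists M, forall N, (M <= N)%N -> \sum_(M <= j < N) Z j x <= e / 2.
  have /cvgrPdist_le/(_ _ e2)[M _ HM] := Zc.
  exists M => N MN; apply: le_trans (le_trans (ler_norm _) (HM M (leqnn M))).
  rewrite lerBrDr addrC -big_cat_nat//; apply: (nondecreasing_cvgn_le _ Zc).
  by apply: nondecreasing_series => j _ _; exact: sqrtr_ge0.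
have e22 : 0 < (e / 2) ^+ 2 by rewrite exprn_gt0.
have pM : 0 < (2 ^+ M)^-1 :> R by rewrite invr_gt0 pow2_gt0.
near=> k.
have tM : t k < (2 ^+ M)^-1.
  near: k; have /cvgrPdist_lt/(_ _ pM) := tcvg; apply: filterS => k.
  by rewrite sub0r normrN ger0_norm// ltW.
have Yk : `|X (t k) x - X (tau k) x| <= e / 2.
  rewrite -(@ler_pXn2r _ 2)// ?nnegrE ?(ltW e2)// real_normK ?num_real//.
  near: k; have /cvgrPdist_le/(_ _ e22) := Y0; apply: filterS => k.
  by rewrite sub0r normrN ger0_norm// sqr_ge0.
(* 2^(-l-1) < t_k^b <= t_k < 2^(-M), the middle inequality because b > 1. *)
have Ml : (M <= l k)%N.
  have [h _] := lP k.
  have : (2 ^+ (l k).+1)^-1 < (2 ^+ M)^-1 :> R.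
    apply: (lt_le_trans h); apply: le_trans (ltW tM).
    rewrite -[leRHS](powRr1 (ltW (t0 k))); apply: ger_powR; last exact: ltW.
    by rewrite t0 ltW.
  by rewrite ltf_pV2 ?posrE ?pow2_gt0// ltr_eXn2l ?ltr1n// ltnS.
have step j : (j < l k)%N ->
    `|X (dyadic R j.+1 (dyadic_floor j.+1 (t k))) x - X (dyadic R j (dyadic_floor j (t k))) x| <= Z j x.
  move=> jl; apply: increment_le_Z; first exact: ltW.
  have [_ h] := lP k; apply: (le_trans h); rewrite lef_pV2 ?posrE ?pow2_gt0//.
  by apply: ler_weXn2l => //; rewrite ler1n.
have tele : `|X (tau k) x - X 0 x| <= e / 2.
  (* As t_k < 2^(-M), its path is still at the node 0 at level M, so telescoping from there compares
     with time 0. *)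
  have -> : X 0 x = X (dyadic R M (dyadic_floor M (t k))) x.
    by rewrite dyadic_floor_eq0 ?ltW// /dyadic mul0r.
  rewrite /tau -(telescope_sumr (fun j => X (dyadic R j (dyadic_floor j (t k))) x) Ml).
  apply: (le_trans (ler_norm_sum _ _ _)); apply: le_trans (HM _ Ml).
  rewrite !big_nat; apply: ler_sum => j /andP[_ jl]; exact: step.
rewrite distrC (_ : X (t k) x - X 0 x = (X (t k) x - X (tau k) x) + (X (tau k) x - X 0 x)); last by ring.
by rewrite (le_trans (ler_normD _ _))// (le_trans (lerD Yk tele))// -splitr.
Unshelve. all: by end_near.
Qed.

End chaining.

(** * The Schrodinger flow *)

Section schrodinger_differences.
Context (R : realType).

(** For |x - y| >= 1 the trivial bound 4 is enough. Otherwise cos and sin are 1-Lipschitz, and |x -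
    y|^2 <= |x - y|^p. *)
Lemma normc_cisB_le (x y p : R) : 0 <= p <= 1 ->
  normc (cis x - cis y) ^+ 2 <= 4 * `|x - y| `^ p.
Proof.
move=> /andP[p0 p1].
have [xy|xy] := leP 1 `|x - y|.
  apply: (@le_trans _ _ 4).
    apply: (le_trans (sqr_normcB_le _ _)); rewrite !normc_cis expr1n.
    by rewrite -mulr_natr; lra.
  by rewrite ler_peMr// -(powRr0 `|x - y|); apply: ler_powR.
have lip (F dF : R -> R) : (forall r : R, is_derive r 1 F (dF r)) -> (forall r, `|dF r| <= 1) ->
    (F x - F y) ^+ 2 <= `|x - y| ^+ 2.
  move=> hF bF; rewrite -(real_normK (num_real (F x - F y))).
  apply: lerXn2r; rewrite ?nnegrE//.
  rewrite -[leRHS]mul1r; apply: lipschitz_derive1 => r.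
    exact: (@ex_derive _ _ _ _ _ _ _ (hF r)).
  by rewrite derive1E (@derive_val _ _ _ _ _ _ _ (hF r)).
rewrite sqr_normc_ReIm Re_add Im_add Re_opp Im_opp /=.
have hc := @lip cos (fun r => - sin r) (fun r => _) _.
have hs := @lip sin cos _ _.
have q : `|x - y| ^+ 2 <= `|x - y| `^ p.
  have [->|xy0] := eqVneq (x - y) 0.
    by rewrite normr0 expr0n /= powR_ge0.
  rewrite -powR_mulrn//; apply: ger_powR; last by rewrite (le_trans p1)// ler1n.
  by rewrite normr_gt0 xy0 ltW.
apply: (@le_trans _ _ (`|x - y| ^+ 2 + `|x - y| ^+ 2)).
  apply: lerD; [apply: hc|apply: hs].
  - by move=> r; rewrite normrN; have := sin_max.
  - exact: cos_max.
have := powR_ge0 `|x - y| p; lra.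
Qed.

Context (n : nat).
Local Notation E := (euclidean R n).
Local Notation mu := (lebesgue_euclid R n).

(** This determines the exponent 2s/a: it turns |xi|^a into |xi|^(2s), which the Sobolev weight
    controls. *)
Lemma powR_enorm_le (a s : R) (xi : E) : 0 < s -> 0 < a ->
  (enorm xi `^ a) `^ (2 * s / a) <= (1 + enorm xi ^+ 2) `^ s.
Proof.
move=> s0 a0; rewrite -powRrM mulrC divfK ?gt_eqF// powRrM (powR_mulrn 2 (enorm_ge0 _)).
apply: ge0_ler_powR; rewrite ?nnegrE ?(ltW s0) ?addr_ge0 ?sqr_ge0//.
by rewrite lerDr.
Qed.

Lemma normc_symbolB_le (a s u v : R) (z : R[i]) (xi : E) : 0 < s -> 2 * s <= a ->
  normc (cis (u * enorm xi `^ a) * z - cis (v * enorm xi `^ a) * z) ^+ 2 <=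
  4 * `|u - v| `^ (2 * s / a) * ((1 + enorm xi ^+ 2) `^ s * normc z ^+ 2).
Proof.
move=> s0 sa; have a0 : 0 < a by rewrite (lt_le_trans _ sa)// mulr_gt0.
rewrite -mulrBl normcM exprMn mulrA ler_wpM2r ?sqr_ge0//.
apply: (le_trans (normc_cisB_le (p := 2 * s / a) _ _ _)).
  apply/andP; split; first by rewrite divr_ge0 ?mulr_ge0 ?(ltW s0) ?(ltW a0).
  by rewrite ler_pdivrMr// mul1r.
rewrite -[leRHS]mulrA ler_wpM2l// -mulrBl normrM powRM// ler_wpM2l ?powR_ge0//.
by rewrite ger0_norm ?powR_ge0// powR_enorm_le.
Qed.

Definition symbol (a u : R) (g : E -> R[i]) xi := cis (u * enorm xi `^ a) * g xi.

Lemma cmeas_symbol a u g : cmeas g -> cmeas (symbol a u g).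
Proof.
move=> cg; apply: cmeasM => //; apply: cmeas_cis; apply: measurable_funM => //.
exact: (measurableT_comp (measurable_powR a) (@measurable_enorm R n)).
Qed.

Lemma L2_symbol a u g : L2 g -> L2 (symbol a u g).
Proof.
move=> [cg g2]; split; first exact: cmeas_symbol.
by under eq_integral do rewrite /symbol normcM normc_cis mul1r.
Qed.

Section sobolev.
Variables (s a : R) (f : E -> R[i]).
Hypotheses (s0 : 0 < s) (sa : 2 * s <= a) (f_Hs : sobolev_fun s f).

Local Notation g := (fourier_fun (distr f)).

Let a0 : 0 < a. Proof. by rewrite (lt_le_trans _ sa)// mulr_gt0. Qed.

Let weight (xi : E) : R := (1 + enorm xi ^+ 2) `^ s * normc (g xi) ^+ 2.

(** [fourier_fun] falls back on its default unless a representative exists; the second clause of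
    [sobolev] provides one. *)
Let g_represents : represents g (dfourier (distr f)).
Proof. by case: f_Hs => _ [_ [g' gP] _]; exact: (xgetI (cst 0) (gP : [set g | represents g (dfourier (distr f))] g')). Qed.

Let integrable_weight : mu.-integrable setT (EFin \o weight).
Proof.
have [cg _] := g_represents; case: f_Hs => _ [_ _ fin].
apply/integrableP; split.
  apply/measurable_EFinP; apply: measurable_funM; last by apply: measurable_funX; exact: cmeas_normc.
  apply: (measurableT_comp (measurable_powR s)); apply: measurable_funD => //.
  by apply: measurable_funX; exact: measurable_enorm.
rewrite (eq_integral (fun x => (weight x)%:E)).
  by apply: lty_poweRy fin; rewrite invr_eq0.
by move=> x _ /=; rewrite ger0_norm// mulr_ge0 ?powR_ge0 ?sqr_ge0.
Qed.

Let L2_g : L2 g.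
Proof.
have [cg _] := g_represents; apply/L2P; split; first exact: cg.
apply: (@integrable_le _ _ R mu (fun x => normc (g x) ^+ 2) weight _ _ integrable_weight).
  by apply: measurable_funX; exact: cmeas_normc.
move=> x; rewrite ger0_norm ?sqr_ge0// ler_peMl ?sqr_ge0// -[leLHS](powRr0 (1 + enorm x ^+ 2)).
by apply: ler_powR; rewrite ?(ltW s0)// lerDl sqr_ge0.
Qed.

(** At time 0 the process is f itself and not a representative of S_0 f, so the limit given by
    chaining is literally f x. *)
Definition flow u : E -> R[i] := if u == 0 then f else schrodinger a u f.

(** What time 0 and the other times share: f is integrable against Schwartz functions, S_u f is
    square integrable, and either gives integrability against [gwin 1], which is the Gaussian
    centred at the origin. *)
Let flow_spec u : [/\ cmeas (flow u), cintable mu (fun x => flow u x * (gwin 1 x)%:C) &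
  forall phi, schwartz phi ->
    cint mu (fun x => flow u x * fourier phi x) = cint mu (fun x => symbol a u g x * phi x)].
Proof.
have LG := L2_symbol a u L2_g.
rewrite /flow; case: eqP => [->|_].
  have [[cf fphi] _] := f_Hs; split => //.
    have [i _] := fphi _ (schwartz_gaussian [tuple 0 | i < n]).
    by apply: (eq_cintable _ i) => x; rewrite gaussian0E.
  move=> phi sphi; have [_ gphi] := g_represents; have [_ h] := gphi _ sphi.
  by apply: (etrans h); apply: eq_cint => x; rewrite /symbol mul0r cis0 mul1r.
(* An inverse transform of the symbol shows that the set from which [schrodinger] chooses is
   inhabited, so its default value is not taken. *)
have [h [Lh hG _]] := fourier_preimage LG.
have [cG G2] := iffLR (L2P _) LG.
have hP : [set h | L2 h /\ represents (symbol a u g) (dfourier (distr h))] h.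
  split => //; split => // phi sphi; split; last exact: hG.
  by apply: cintableM_L2 => //; [exact: schwartz_cmeas|exact: integrable_schwartz_sqr].
have [] : L2 (schrodinger a u f) /\ represents (symbol a u g) (dfourier (distr (schrodinger a u f))).
  exact: (xgetI (cst 0) hP).
move=> LX [_ XG]; have [cX X2] := iffLR (L2P _) LX; split => //.
  apply: cintableM_L2 => //; first by apply: cmeas_real; exact: measurable_gwin.
  exact: integrable_gwin_sqr.
by move=> phi sphi; have [_] := XG _ sphi.
Qed.

Lemma cmeas_flow u : cmeas (flow u). Proof. by case: (flow_spec u). Qed.

Lemma flow_holder : exists2 C, 0 <= C & forall u v,
  (\int[mu]_x (normc (flow u x - flow v x) ^+ 2)%:E <= (C * `|u - v| `^ (2 * s / a))%:E)%E.
Proof.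
have P0 : 0 < (pi *+ 2) ^+ n :> R by rewrite exprn_gt0// pmulrn_lgt0// pi_gt0.
have W0 : 0 <= \int[mu]_x weight x.
  by apply: Rintegral_ge0 => x _; rewrite mulr_ge0 ?powR_ge0 ?sqr_ge0.
(* The first 4/(2 pi)^n is that of [fourier_preimageB_le], the second 4 that of [normc_cisB_le]; the
   integral is the squared H_s norm. *)
exists (4 / (pi *+ 2) ^+ n * 4 * \int[mu]_x weight x).
  by rewrite !mulr_ge0// invr_ge0 ltW.
move=> u v; have [cu iu uG] := flow_spec u; have [cv iv vG] := flow_spec v.
have [Lu Lv] := (L2_symbol a u L2_g, L2_symbol a v L2_g).
have [[mu' _] [mv' _]] := (iffLR (L2P _) Lu, iffLR (L2P _) Lv).
apply: (le_trans (fourier_preimageB_le iu iv cu cv Lu Lv uG vG)).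
have i4 := integrableZl measurableT (4 * `|u - v| `^ (2 * s / a)) integrable_weight.
apply: (@le_trans _ _ ((4 / (pi *+ 2) ^+ n)%:E *
    \int[mu]_x (4 * `|u - v| `^ (2 * s / a) * weight x)%:E)%E).
  apply: lee_wpmul2l; first by rewrite lee_fin divr_ge0// ltW.
  apply: ge0_le_integral => //.
  - by move=> x _; rewrite lee_fin sqr_ge0.
  - by apply/measurable_EFinP/measurable_funX; apply: cmeas_normc; exact: cmeasB.
  - exact: measurable_int i4.
  - by move=> x _; rewrite lee_fin normc_symbolB_le.
rewrite -(EFin_Rintegral (r := fun x => 4 * `|u - v| `^ (2 * s / a) * weight x))//.
rewrite RintegralZl// -EFinM lee_fin le_eqVlt; apply/orP; left; apply/eqP; ring.
Qed.

End sobolev.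

(** The radius e is itself an element of R[i]; its positivity says that it is real and positive,
    which reduces the estimate to [Re e]. *)
Lemma cvg_complex (z_ : nat -> R[i]) (z : R[i]) :
  Re (z_ k) @[k --> \oo] --> Re z -> Im (z_ k) @[k --> \oo] --> Im z ->
  (z_ k : R[i]^o) @[k --> \oo] --> (z : R[i]^o).
Proof.
move=> cRe cIm; apply/cvgrPdist_lt => e; rewrite ltcE => /andP[/eqP/= ie re].
have r2 : 0 < Re e / 2 by rewrite divr_gt0.
have /cvgrPdist_lt/(_ _ r2) hRe := cRe; have /cvgrPdist_lt/(_ _ r2) hIm := cIm.
apply: filterS2 hRe hIm => k hR hI.
rewrite ltcE/= ie eqxx/= -[X in X < _]/(normc (z - z_ k)).
apply: (le_lt_trans (normc_le_ReIm _)); rewrite Re_add Im_add Re_opp Im_opp.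
by rewrite (splitr (Re e)) ltrD.
Qed.

End schrodinger_differences.

Theorem corollary7 (R : realType) (t : nat -> R)
    (t_lt1 : t 0%N < 1) (t_decr : forall k : nat, t k.+1 < t k)
    (t_gt0 : forall k : nat, 0 < t k) (t_lim : t k @[k --> \oo] --> (0 : R))
    (n : nat) (n_ge1 : (1 <= n)%N)
    (s : R) (s_gt0 : 0 < s) (s_le : s <= 1 / 2)
    (a : R) (a_ge : 2 * s <= a)
    (gamma : R)
    (t_sum : cvgn (series (fun k : nat => t k `^ gamma)))
    (gamma_gt : (a - 2 * s) / (2 * s) < 1 / gamma)
    (f : euclidean R n -> R[i]) (f_Hs : sobolev_fun s f) :
  {ae lebesgue_euclid R n, forall x : euclidean R n,
    (schrodinger a (t k) f x : R[i]^o) @[k --> \oo] --> (f x : R[i]^o)}.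
Proof.
have s2 : 0 < 2 * s by rewrite mulr_gt0.
have a0 : 0 < a by exact: lt_le_trans a_ge.
(* Since a >= 2s, the lower bound on 1/gamma is nonnegative, and a positive inverse forces gamma >
   0. *)
have g0 : 0 < gamma.
  rewrite -invr_gt0 -[ltRHS]mul1r; apply: le_lt_trans gamma_gt.
  by rewrite divr_ge0 ?subr_ge0// ltW.
have t_lt k : t k < 1.
  by elim: k => [//|k IH]; exact: lt_trans (t_decr k) IH.
have b1 : 1 < 1 + gamma by rewrite ltrDl.
have b0 : 0 < 1 + gamma by exact: lt_trans b1.
have p1 : 2 * s / a <= 1 by rewrite ler_pdivrMr// mul1r.
(* As 1 - 1/(1 + gamma) = gamma/(1 + gamma), the claim amounts to gamma (a - 2s) < 2s, which is
   [gamma_gt]. *)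
have bp : 1 - (1 + gamma)^-1 < 2 * s / a.
  have -> : 1 - (1 + gamma)^-1 = gamma / (1 + gamma) by field; rewrite gt_eqF.
  rewrite ltr_pdivrMr// mulrAC ltr_pdivlMr//.
  move: gamma_gt; rewrite ltr_pdivrMr// mulrAC ltr_pdivlMr// mul1r; lra.
have tsum : cvgn (series (fun k => t k `^ (1 + gamma - 1))).
  by rewrite (_ : 1 + gamma - 1 = gamma)//; ring.
have [C C0 flowC] := flow_holder s_gt0 a_ge f_Hs.
have mflow u := cmeas_flow a s_gt0 f_Hs u.
(* Chaining concerns real processes; an additive r bounded by [normc] inherits the Holder bound, and
   [Re] and [Im] are such. *)
have chain (r : R[i] -> R) : (forall z w, r (z - w) = r z - r w) ->
    (forall z, `|r z| <= normc z) ->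
    (forall u, measurable_fun setT (fun x => r (flow a f u x))) ->
    {ae lebesgue_euclid R n, forall x, r (flow a f (t k) x) @[k --> \oo] --> r (flow a f 0 x)}.
  move=> rB r_le mr.
  apply: (@ae_cvg_chaining _ _ _ (lebesgue_euclid R n) (fun u x => r (flow a f u x))
    C (2 * s / a) (1 + gamma)) => // u v _ _.
  apply: (le_trans _ (flowC u v)); apply: ge0_le_integral => //.
  - by move=> x _; rewrite lee_fin sqr_ge0.
  - by apply/measurable_EFinP/measurable_funX; exact: measurable_funB.
  - apply/measurable_EFinP/measurable_funX; apply: cmeas_normc.
    exact: cmeasB (mflow u) (mflow v).
  - move=> x _; rewrite lee_fin -rB -(real_normK (num_real (r _))).
    by apply: lerXn2r; rewrite ?nnegrE ?normc_ge0.
have hRe := chain _ (fun z w => _) (@norm_Re_le_normc R) (fun u => (mflow u).1).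
have hIm := chain _ (fun z w => _) (@norm_Im_le_normc R) (fun u => (mflow u).2).
apply: filterS2 (hRe _) (hIm _) => [x xRe xIm||].
- have flow0 : flow a f 0 x = f x by rewrite /flow eqxx.
  have flowt k : flow a f (t k) x = schrodinger a (t k) f x by rewrite /flow gt_eqF.
  rewrite flow0 in xRe xIm.
  by apply: cvg_complex; under eq_fun do rewrite -flowt.
- by move=> z w; rewrite Re_add Re_opp.
- by move=> z w; rewrite Im_add Im_opp.
Qed.
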